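(* Let $X_1,\ldots,X_n$ be independent random vectors in $\mathbb{R}^d$, each distributed according to the probability measure $\mu(dx)=\phi(x)dx$. Suppose that $\phi$ is even and has positive and integrable Fourier transform, such that for each $t\in\mathbb{R}^d$ the function $r\mapsto\hat\phi(\sqrt r\,t)$ is log-convex on $[0,+\infty)$. Assume moreover that $\mathbb{E}|X_1|^N<+\infty$ for each $N>0$. Let $l\in(0,d)$, let $(\mathbb{R}^d,\|\cdot\|)$ be a quasi-normed space that embeds in $L_{-l}$, and assume $\mathbb{E}\|X_1\|^{-l}<+\infty$. Then the function $$(a_1,\ldots,a_n)\mapsto\mathbb{E}\left\|\sqrt{a_1}X_1+\cdots+\sqrt{a_n}X_n\right\|^{-l}$$ is log-convex on $[0,+\infty)^n$.
   Context: Fourier transform convention: $\hat f(x)=\int_{\mathbb{R}^d}f(y)e^{-2\pi i\langle x,y\rangle}dy$; ''positive'' means $\ge0$. $|\cdot|$ is the Euclidean norm. Quasi-norms $\|\cdot\|$ on $\mathbb{R}^d$ are Minkowski functionals $\|x\|=\inf\{\lambda>0:x\in\lambda K\}$ of symmetric star bodies $K$ ($K=-K$ compact, $tK\subset K$ for $t\in[0,1]$, $\|\cdot\|$ continuous). For $l\in(0,d)$, $(\mathbb{R}^d,\|\cdot\|)$ embeds in $L_{-l}$ if there is a finite Borel measure $\sigma_l$ on $S^{d-1}$ such that for every even Schwartz function $\psi\in\mathcal{S}(\mathbb{R}^d)$, $$\int_{\mathbb{R}^d}\frac{1}{\|x\|^l}\psi(x)\,dx=\int_0^\infty\int_{S^{d-1}}t^{l-1}\hat\psi(t\theta)\,d\sigma_l(\theta)\,dt.$$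 A function $f:C\to[0,+\infty]$ on a convex set is log-convex if $f(\lambda x+(1-\lambda)y)\le f(x)^\lambda f(y)^{1-\lambda}$ for all $x,y\in C$, $\lambda\in(0,1)$; convention $\|0\|^{-l}=+\infty$, so the function above equals $+\infty$ at $a=0$. *)

(* Defs.v *)
From HB Require Import structures.
From mathcomp Require Import all_boot all_order all_algebra.
From mathcomp Require Import all_classical all_reals all_analysis.
From mathcomp Require Import measurable_realfun complex.

Set Implicit Arguments.
Unset Strict Implicit.
Unset Printing Implicit Defensive.
Import Order.TTheory GRing.Theory Num.Theory.
Import numFieldNormedType.Exports.
Local Open Scope classical_set_scope.
Local Open Scope ring_scope.

(* R^d is ['rV[R]_d], whose topology comes from the library; its measurable
   sets are the Borel sets. *)
HB.instance Definition _ (R : realType) (d : nat) :=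
  Measurable.copy 'rV[R]_d (g_sigma_algebraType (@open 'rV[R]_d)).

Section borel_rV.
Context {R : realType} {d : nat}.

Lemma open_measurable_rV (A : set 'rV[R]_d) : open A -> measurable A.
Proof. exact: sub_sigma_algebra. Qed.

Lemma measurable_coord (i : 'I_d) :
  measurable_fun setT (fun x : 'rV[R]_d => x ord0 i).
Proof.
apply: (measurability _ (RGenOInfty.measurableE R)).
move=> _ [_ [r ->] <-]; rewrite setTI; apply: open_measurable_rV.
by apply: open_comp => [x _|]; [exact: coord_continuous|exact: interval_open].
Qed.

End borel_rV.

Lemma measurable_fun_rV d (T : measurableType d) (R : realType) (n : nat)
    (f : T -> 'rV[R]_n) :
  (forall i, measurable_fun setT (fun x => f x ord0 i)) ->
  measurable_fun setT f.
Proof.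
move=> mf; apply: (measurability (@open 'rV[R]_n)) => //.
move=> _ [U oU <-]; rewrite setTI.
pose b (q : 'rV[rat]_n * nat) : set 'rV[R]_n :=
  [set x | forall i, `|ratr (q.1 ord0 i) - x ord0 i| < (q.2.+1%:R)^-1].
have UE : U = \bigcup_(q in [set q | b q `<=` U]) b q.
  rewrite eqEsubset; split; last by move=> x [q /= qU]; exact: qU.
  move=> x Ux.
  have /nbhs_ballP[e /= e0 eU] : nbhs x U by exact: open_nbhs_nbhs.
  have [k] : exists k, 0 + k.+1%:R^-1 < e / 2 :> R.
    by apply: ltr_add_invr; rewrite divr_gt0.
  rewrite add0r => ke.
  have k0 : 0 < k.+1%:R^-1 :> R by rewrite invr_gt0.
  have /choice[q qP] : forall i : 'I_n, exists q : rat,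
      `|ratr q - x ord0 i| < k.+1%:R^-1.
    move=> i.
    have /rat_in_itvoo[q] : x ord0 i < x ord0 i + k.+1%:R^-1 by rewrite ltrDl.
    rewrite in_itv/= => /andP[q1 q2]; exists q.
    by rewrite ger0_norm ?subr_ge0 ?ltW// ltrBlDl.
  exists (\row_i q i, k); last by move=> i /=; rewrite mxE.
  move=> y /= yP; apply: eU; rewrite mx_norm_ball.
  rewrite /ball_ /= /Num.norm/= mx_normrE bigmax_lt// => -[i0 j] _ /=.
  rewrite ord1 !mxE.
  have := yP j; have := qP j; rewrite !mxE => h1 h2.
  rewrite [e]splitr (le_lt_trans (ler_distD (ratr (q j)) _ _))// ltrD//.
    by rewrite distrC (lt_trans h1).
  exact: lt_trans h2 _.
rewrite UE preimage_bigcup bigcup_mkcond.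
apply: countable_bigcupT_measurable => [|q]; first exact: countableP.
case: ifPn => // _.
rewrite [X in measurable X](_ : _ = \bigcap_(i in [set: 'I_n])
    [set x | `|ratr (q.1 ord0 i) - f x ord0 i| < (q.2.+1%:R)^-1]); last first.
  by rewrite eqEsubset; split=> x /= h i *; exact: h.
apply: fin_bigcap_measurable => // i _.
have mg : measurable_fun setT (fun x => `|ratr (q.1 ord0 i) - f x ord0 i|).
  by apply: measurableT_comp => //; apply: measurable_funB.
rewrite -[X in measurable X]setTI -preimage_itvNyo.
exact: mg.
Qed.

Section lebesgue_rV_step.
Context {R : realType} {d : nat}.

Definition rV_cons (p : R * 'rV[R]_d) : 'rV[R]_d.+1 :=
  row_mx (const_mx p.1 : 'rV[R]_1) p.2.

Lemma measurable_rV_cons : measurable_fun setT rV_cons.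
Proof.
apply: measurable_fun_rV => i; rewrite /rV_cons.
have -> : (fun p : R * 'rV[R]_d =>
    (row_mx (const_mx p.1 : 'rV[R]_1) p.2 : 'rV_d.+1) ord0 i) =
  match fintype.split (i : 'I_(1 + d)) with
  | inl _ => fst | inr j => (fun v : 'rV[R]_d => v ord0 j) \o snd end.
  by apply/funext => p; rewrite mxE; case: fintype.split => j //; rewrite mxE.
by case: fintype.split => j //; apply: measurableT_comp; [exact: measurable_coord|].
Qed.

Variable mu : {sigma_finite_measure set 'rV[R]_d -> \bar R}.

Definition lebesgue_rV_step : set 'rV[R]_d.+1 -> \bar R :=
  pushforward (@lebesgue_measure R \x mu)%E rV_cons.

Let lebesgue_rV_step0 : lebesgue_rV_step set0 = 0%E.
Proof. by rewrite /lebesgue_rV_step /pushforward preimage_set0 measure0. Qed.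

Let lebesgue_rV_step_ge0 A : (0 <= lebesgue_rV_step A)%E.
Proof. by rewrite /lebesgue_rV_step /pushforward measure_ge0. Qed.

Let lebesgue_rV_step_sigma_additive : semi_sigma_additive lebesgue_rV_step.
Proof.
exact: (@measure_semi_sigma_additive _ _ _
  (measure_function_pushforward__canonical__measure_function_Measure
    (@lebesgue_measure R \x mu)%E measurable_rV_cons)).
Qed.

HB.instance Definition _ := isMeasure.Build _ _ _ lebesgue_rV_step
  lebesgue_rV_step0 lebesgue_rV_step_ge0 lebesgue_rV_step_sigma_additive.

Lemma lebesgue_rV_step_sigma_finite : sigma_finite setT lebesgue_rV_step.
Proof.
have /sigma_finiteP[F [TF ndF Foo]] := sigma_finiteT (@lebesgue_measure R).
have /sigma_finiteP[G [TG ndG Goo]] := sigma_finiteT mu.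
pose g (v : 'rV[R]_d.+1) : R * 'rV[R]_d :=
  (v ord0 ord0, rsubmx (v : 'rV_(1 + d))).
have mg : measurable_fun setT g.
  apply/measurable_fun_pairP; split; first exact: measurable_coord.
  apply: measurable_fun_rV => i /=.
  rewrite [X in measurable_fun _ X](_ : _ =
      fun v : 'rV[R]_d.+1 => v ord0 (rshift 1 i : 'I_(1 + d))).
    exact: measurable_coord.
  by apply/funext => v; rewrite mxE.
have gK : cancel rV_cons g.
  move=> [x v]; rewrite /g /rV_cons/= row_mxKr; congr pair.
  have -> : (ord0 : 'I_d.+1) = lshift d (ord0 : 'I_1) by exact: val_inj.
  by apply: etrans (row_mxEl _ _ _ _) _; rewrite mxE.
exists (fun n => g @^-1` (F n `*` G n)).
  apply/esym; rewrite -subTset => v _.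
  have : (\bigcup_n F n) (g v).1 by rewrite -TF.
  have : (\bigcup_n G n) (g v).2 by rewrite -TG.
  move=> [m _ Gm] [n _ Fn]; exists (maxn n m) => //; split.
    by move: Fn; exact/subsetPset/ndF/leq_maxl.
  by move: Gm; exact/subsetPset/ndG/leq_maxr.
move=> n; have [mF Fn] := Foo n; have [mG Gn] := Goo n; split.
  by rewrite -[X in measurable X]setTI; apply: mg => //; exact: measurableX.
rewrite /lebesgue_rV_step /pushforward -comp_preimage.
rewrite [X in X @^-1` _](_ : _ = id); last by apply/funext => p; exact: gK.
by rewrite product_measure1E// lte_mul_pinfty// ge0_fin_numE.
Qed.

HB.instance Definition _ := Measure_isSigmaFinite.Build _ _ _
  lebesgue_rV_step lebesgue_rV_step_sigma_finite.

End lebesgue_rV_step.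

Fixpoint lebesgue_rV (R : realType) (d : nat) :
    {sigma_finite_measure set 'rV[R]_d -> \bar R} :=
  match d with
  | 0 => \d_(0 : 'rV[R]_0)
  | d'.+1 => lebesgue_rV_step (lebesgue_rV R d')
  end.

Lemma lebesgue_rV_box (R : realType) (d : nat) (A : 'I_d -> set R) :
  (forall i, measurable (A i)) ->
  lebesgue_rV R d [set x : 'rV[R]_d | forall i, A i (x ord0 i)] =
  (\prod_(i < d) lebesgue_measure (A i))%E.
Proof.
elim: d A => [|d IH] A mA /=.
  rewrite big_ord0 diracE mem_set// => -[].
  by [].
rewrite big_ord_recl -(IH (fun i => A (lift ord0 i)))//.
rewrite /lebesgue_rV_step /pushforward.
rewrite [X in (_ \x _)%E X](_ : _ =
    A ord0 `*`
    [set x : 'rV[R]_d | forall i, A (lift ord0 i) (x ord0 i)]).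
  rewrite product_measure1E//; first exact: mA.
  rewrite [X in measurable X](_ : _ = \bigcap_(i in [set: 'I_d])
      ((fun x : 'rV[R]_d => x ord0 i) @^-1` A (lift ord0 i))); last first.
    by rewrite eqEsubset; split=> x /= h i *; exact: h.
  apply: fin_bigcap_measurable => // i _.
  by rewrite -[X in measurable X]setTI; exact: measurable_coord.
have r0 (p : R * 'rV[R]_d) : rV_cons p ord0 ord0 = p.1.
  have -> : (ord0 : 'I_d.+1) = lshift d (ord0 : 'I_1) by exact: val_inj.
  by apply: etrans (row_mxEl _ _ _ _) _; rewrite mxE.
have rS (p : R * 'rV[R]_d) i : rV_cons p ord0 (lift ord0 i) = p.2 ord0 i.
  have -> : lift ord0 i = rshift 1 i by exact: val_inj.
  exact: row_mxEr.
rewrite eqEsubset; split=> p /=.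
  by move=> h; split; [rewrite -r0; exact: h|move=> i; rewrite -rS; exact: h].
by move=> [h0 hS] i; case: (unliftP ord0 i) => [j|] ->; rewrite ?r0 ?rS.
Qed.

Definition dotv (R : realType) (d : nat) (x y : 'rV[R]_d) : R :=
  \sum_i x ord0 i * y ord0 i.

(* The library norm [`|x|] on ['rV[R]_d] is the sup norm, hence this one. *)
Definition enorm (R : realType) (d : nat) (x : 'rV[R]_d) : R :=
  Num.sqrt (dotv x x).

Definition usphere (R : realType) (d : nat) : set 'rV[R]_d :=
  [set x | enorm x = 1].

Section complex_integral.
Context (disp : measure_display) (T : measurableType disp) (R : realType).

Definition Cintegral (mu : {measure set T -> \bar R}) (D : set T)
    (f : T -> R[i]) : R[i] :=
  (Rintegral mu D (fun x => complex.Re (f x)) +i*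
   Rintegral mu D (fun x => complex.Im (f x)))%C.

Definition Cintegrable (mu : {measure set T -> \bar R}) (D : set T)
    (f : T -> R[i]) : Prop :=
  mu.-integrable D (fun x => (complex.Re (f x))%:E) /\
  mu.-integrable D (fun x => (complex.Im (f x))%:E).

End complex_integral.

Definition cis (R : realType) (t : R) : R[i] := (cos t +i* sin t)%C.

Definition fourier (R : realType) (d : nat) (f : 'rV[R]_d -> R[i])
    (x : 'rV[R]_d) : R[i] :=
  Cintegral (lebesgue_rV R d) setT
    (fun y => f y * cis (- (2 * pi * dotv x y))).

(* Multi-indices of derivation are represented by lists of directions. *)
Definition partials (R : realType) (d : nat) (s : seq 'I_d)
    (f : 'rV[R]_d -> R) : 'rV[R]_d -> R :=
  foldr (fun i g x => 'D_(delta_mx ord0 i) g x) f s.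

Definition schwartz_real (R : realType) (d : nat) (f : 'rV[R]_d -> R) : Prop :=
  forall s : seq 'I_d,
    [/\ continuous (partials s f),
        forall (i : 'I_d) x, derivable (partials s f) x (delta_mx ord0 i) &
        forall alpha : 'I_d -> nat, exists M : R, forall x : 'rV[R]_d,
          `|(\prod_i x ord0 i ^+ alpha i) * partials s f x| <= M].

Definition schwartz (R : realType) (d : nat) (f : 'rV[R]_d -> R[i]) : Prop :=
  schwartz_real (fun x => complex.Re (f x)) /\
  schwartz_real (fun x => complex.Im (f x)).

(* Infimum in the extended reals: it is +oo when no dilate of K contains x. *)
Definition minkowski_functional (R : realType) (d : nat) (K : set 'rV[R]_d)
    (x : 'rV[R]_d) : \bar R :=
  ereal_inf [set t%:E | t in [set t : R | 0 < t /\ [set t *: y | y in K] x]].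

Definition quasi_norm (R : realType) (d : nat) (N : 'rV[R]_d -> R) : Prop :=
  exists K : set 'rV[R]_d,
    [/\ compact K,
        [set - x | x in K] = K,
        forall t : R, 0 <= t <= 1 -> [set t *: x | x in K] `<=` K,
        forall x, minkowski_functional K x = (N x)%:E &
        continuous N].

(* A measure on the sphere is a Borel measure on R^d carried by the sphere.
   [x^-1] is 0 at 0, which only affects the first integral on a null set. *)
Definition embeds_in_Lneg (R : realType) (d : nat) (l : R)
    (N : 'rV[R]_d -> R) : Prop :=
  exists sigma : {finite_measure set 'rV[R]_d -> \bar R},
    sigma (~` @usphere R d) = 0%E /\
    forall psi : 'rV[R]_d -> R[i],
      schwartz psi -> (forall x, psi (- x) = psi x) ->
      Cintegral (lebesgue_rV R d) setT (fun x => ((N x `^ l)^-1)%:C%C * psi x) =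
      Cintegral (@lebesgue_measure R) `]0, +oo[ (fun t =>
        Cintegral sigma (@usphere R d) (fun theta =>
          (t `^ (l - 1))%:C%C * fourier psi (t *: theta))).

(* In \bar R, 0 * +oo = 0. *)
Definition log_convex_on (R : realType) (V : lmodType R) (C : set V)
    (f : V -> \bar R) : Prop :=
  (forall x, C x -> 0 <= f x)%E /\
  forall (x y : V) (lambda : R), C x -> C y -> 0 < lambda < 1 ->
    (f (lambda *: x + (1 - lambda) *: y)%R
       <= f x `^ lambda * f y `^ (1 - lambda))%E.

(* [r ^ (- l)] for r >= 0, with value +oo at 0 (whereas 0 `^ (- l) = 0). *)
Definition neg_powere (R : realType) (l r : R) : \bar R :=
  if r == 0 then +oo%E else (r `^ (- l))%:E.

Definition mutually_independent (disp disp' : measure_display)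
    (T : measurableType disp) (T' : measurableType disp') (R : realType)
    (P : probability T R) (I : finType) (X : I -> {RV P >-> T'}) : Prop :=
  forall (J : {set I}) (A : I -> set T'), (forall i, measurable (A i)) ->
    P (\bigcap_(i in [set` J]) (X i @^-1` A i)) =
    (\prod_(i in J) P (X i @^-1` A i))%E.

(* Main.v *)
Require Import Defs.
From HB Require Import structures.
From mathcomp Require Import all_boot all_order all_algebra.
From mathcomp Require Import all_classical all_reals all_analysis.
From mathcomp Require Import measurable_realfun complex.
From mathcomp Require Import ring lra.

(** The embedding says that the kernel rho(x) = N(x)^-l is, as a tempered
    distribution, the Fourier transform of a positive measure in polar
    coordinates.  Suppose for a moment that this holds pointwise, that is,
    rho(y) is the integral of cos(2 pi <y, xi>) against a positive measure
    nu(dxi).  By independence, and since the characteristic function of each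
    X_i is real, the expectation of cos(2 pi <S_a, xi>), where
    S_a = sum_i sqrt(a_i) X_i, is the product of the numbers
    phihat(sqrt(a_i) xi).  For fixed xi this product is log-convex in a by
    hypothesis, and by Hoelder's inequality a positive mixture of log-convex
    functions is log-convex.

    The measure nu is infinite and rho is unbounded at the origin, so the
    argument is run on the Gaussian averages
      gauss_avg rho e y = int rho(y + e v) exp(-|v|^2) dv,
    and then e tends to 0.

    - Testing the embedding against the symmetrised Gaussian centred at y and
      at -y (a Schwartz function, [schwartz_sym_gauss]) writes gauss_avg rho e
      as the cosine transform of a finite positive measure with density
      ([embedding_kernel]); positivity comes from that of the Fourier transform
      of a Gaussian ([ghat_ge0]).  Hence the expectation of
      gauss_avg rho e (S_a) is log-convex in a: [independent_cos_sum],
      [integral_positive_definite], [smoothed_logcvx].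

    - As e tends to 0, gauss_avg rho e y tends to Z rho(y) for y <> 0, Z being
      the mass of the Gaussian, and to +oo for y = 0 ([gauss_avg_cvg],
      [gauss_avg_cvg0]).  It is also dominated by D rho(y), uniformly in e
      ([gauss_avg_le]), because rho is homogeneous of degree -l and locally
      integrable ([pw_locally_integrable], where l < d is used).

    - Let z be a convex combination of x and y.  If the expectation is infinite
      at x or at y there is nothing to prove, as it never vanishes.  Otherwise
      dominated convergence gives the limit at x and at y, while Fatou's lemma
      bounds the value at z by the lower limit of the averages; the inequality
      between the averages passes to the limit. *)

Set Implicit Arguments.
Unset Strict Implicit.
Unset Printing Implicit Defensive.
Import Order.TTheory GRing.Theory Num.Theory.
Import numFieldNormedType.Exports.
Local Open Scope classical_set_scope.
Local Open Scope ring_scope.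

(** * Change of variables *)

(** Monotone convergence with the pointwise limit given explicitly. *)
Lemma ge0_nd_cvg_integral d (T : measurableType d) (R : realType)
    (mu : {measure set T -> \bar R}) (u : (T -> \bar R)^nat) (f : T -> \bar R) :
  (forall n, measurable_fun setT (u n)) -> (forall n x, 0 <= u n x)%E ->
  (forall x, nondecreasing_seq (u ^~ x)) -> (forall x, u ^~ x @ \oo --> f x) ->
  (\int[mu]_x u n x @[n --> \oo] --> \int[mu]_x f x)%E.
Proof.
move=> mu_ u0 ndu uf.
rewrite [X in _ --> X](_ : _ = (\int[mu]_x (limn (u ^~ x)))%E); last first.
  by apply: eq_integral => x _; apply/esym/cvg_lim => //; exact: uf.
by apply: cvg_monotone_convergence => // x _; exact: ndu.
Qed.

Section density.
Local Open Scope ereal_scope.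
Context d1 d2 (T1 : measurableType d1) (T2 : measurableType d2) (R : realType).
Variables (mu : {measure set T1 -> \bar R}) (nu : {measure set T2 -> \bar R}).
Variables (X : T1 -> T2) (G : T1 -> R) (H : T2 -> R).
Hypotheses (mX : measurable_fun setT X) (mG : measurable_fun setT G)
  (mH : measurable_fun setT H).
Hypotheses (G0 : forall x, (0 <= G x)%R) (H0 : forall y, (0 <= H y)%R).
Hypothesis GH : forall A, measurable A ->
  \int[mu]_(x in X @^-1` A) (G x)%:E = \int[nu]_(y in A) (H y)%:E.

Import HBNNSimple.

(** If [X] carries the measure [G mu] to the measure [H nu], then integrals
    transform accordingly.  With [G = 1] this is the formula for the expectation
    of a function of a random vector with density [H]. *)
Lemma ge0_integral_density (f : T2 -> \bar R) :
  measurable_fun setT f -> (forall y, 0 <= f y) ->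
  \int[mu]_x ((G x)%:E * f (X x)) = \int[nu]_y ((H y)%:E * f y).
Proof.
move=> mf f0.
pose h := nnsfun_approx measurableT mf.
have mEG : measurable_fun setT (EFin \o G) by exact/measurable_EFinP.
have mEH : measurable_fun setT (EFin \o H) by exact/measurable_EFinP.
have cvh y : (fun n => (h n y)%:E) @ \oo --> f y.
  exact: (@cvg_nnsfun_approx _ _ _ _ measurableT _ mf).
have ndh y : nondecreasing_seq (fun n => (h n y)%:E).
  by move=> m n mn; rewrite lee_fin; exact/lefP/nd_nnsfun_approx.
have hX n : measurable_fun setT (fun x => (h n (X x))%:E).
  by apply/measurable_EFinP; apply: measurableT_comp.
have mh n : measurable_fun setT (fun x => (h n x)%:E).
  exact/measurable_EFinP.
have L : (fun n => \int[mu]_x ((G x)%:E * (h n (X x))%:E)) @ \oo -->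
    \int[mu]_x ((G x)%:E * f (X x)).
  apply: ge0_nd_cvg_integral => [n|n x|x m n mn|x].
  - exact: emeasurable_funM.
  - by rewrite mule_ge0// lee_fin.
  - by rewrite lee_pmul// ?lee_fin//; exact: ndh.
  - by apply: cvgeZl.
have L' : (fun n => \int[nu]_x ((H x)%:E * (h n x)%:E)) @ \oo -->
    \int[nu]_x ((H x)%:E * f x).
  apply: ge0_nd_cvg_integral => [n|n x|x m n mn|x].
  - exact: emeasurable_funM.
  - by rewrite mule_ge0// lee_fin.
  - by rewrite lee_pmul// ?lee_fin//; exact: ndh.
  - by apply: cvgeZl.
apply: cvg_unique L _; first exact: ereal_hausdorff.
rewrite (_ : (fun n => _) = (fun n => \int[nu]_x ((H x)%:E * (h n x)%:E)))//.
apply/funext => n.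
have hE y : (h n y)%:E = \sum_(r \in range (h n)) (r%:E * (\1_(h n @^-1` [set r]) y)%:E).
  by rewrite {1}(fimfunE (h n) y) -fsumEFin.
under eq_integral => x _.
  rewrite hE ge0_mule_fsumr; last by move=> r; rewrite nnfun_muleindic_ge0.
  over.
under [RHS]eq_integral => x _.
  rewrite hE ge0_mule_fsumr; last by move=> r; rewrite nnfun_muleindic_ge0.
  over.
rewrite ge0_integral_fsum//; last 2 first.
- move=> r; apply: emeasurable_funM => //; apply/measurable_EFinP.
  apply: measurable_funM => //.
  exact: (measurableT_comp (measurable_indic (measurable_funPTI (h n) _))).
- by move=> r x _; apply: mule_ge0; [rewrite lee_fin|exact: nnfun_muleindic_ge0].
rewrite ge0_integral_fsum//; last 2 first.
- move=> r; apply: emeasurable_funM => //; apply/measurable_EFinP.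
  exact: measurable_funM.
- by move=> r x _; apply: mule_ge0; [rewrite lee_fin|exact: nnfun_muleindic_ge0].
apply: eq_fsbigr => r /[!inE] -[y _ yr].
have r0 : (0 <= r)%R by rewrite -yr.
under eq_integral do rewrite muleCA.
under [RHS]eq_integral do rewrite muleCA.
have mA : measurable (h n @^-1` [set r]) by exact: measurable_funPTI.
have mXA : measurable (X @^-1` (h n @^-1` [set r])).
  by rewrite -[X in measurable X]setTI; exact: mX.
rewrite ge0_integralZl//; last 2 first.
- apply: emeasurable_funM => //; apply/measurable_EFinP.
  exact: (measurableT_comp (measurable_indic mA)).
- by move=> x _; rewrite mule_ge0 ?lee_fin.
rewrite ge0_integralZl//; last 2 first.
- by apply: emeasurable_funM => //; exact/measurable_EFinP.
- by move=> x _; rewrite mule_ge0 ?lee_fin.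
congr (_ * _).
transitivity (\int[mu]_(x in X @^-1` (h n @^-1` [set r])) (G x)%:E).
  rewrite [RHS]integral_mkcond; apply: eq_integral => x _.
  by rewrite epatch_indic// indicE preimage_comp.
rewrite GH// [LHS]integral_mkcond; apply: eq_integral => x _.
by rewrite epatch_indic.
Qed.

End density.

Section affine_1d.
Local Open Scope ereal_scope.
Context (R : realType).
Notation leb := (@lebesgue_measure R).
Variables (c y : R).
Hypothesis c0 : (c != 0)%R.

Let phi : measurableTypeR R -> measurableTypeR R := fun s => (y + c * s)%R.

Let mphi : measurable_fun setT phi.
Proof. by apply: measurable_funD => //; exact: measurable_funM. Qed.

Let image_leb : {measure set (measurableTypeR R) -> \bar R} :=
  measure_function_pushforward__canonical__measure_function_Measure leb mphi.

Let leb_phi (A : set (measurableTypeR R)) : measurable A ->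
  leb A = mscale (NngNum (normr_ge0 c)) image_leb A.
Proof.
apply: lebesgue_measure_unique => /= _ [[a b] _ <-] /=.
rewrite /mscale/= /pushforward.
have [cgt0|cle0] := ltP 0%R c.
  rewrite [X in _ * leb X](_ : _ = `](a - y) / c, (b - y) / c]%classic)%R; last first.
    by apply/seteqP; split=> s /=; rewrite !in_itv/= /phi ltr_pdivrMr//
      ler_pdivlMr// [(s * c)%R]mulrC => /andP[? ?]; apply/andP; split; lra.
  rewrite !lebesgue_measure_itv/= !lte_fin ltr_pM2r ?invr_gt0// ltrBlDr subrK.
  case: ifPn => _; last by rewrite mule0.
  rewrite -!EFinB -EFinM gtr0_norm//; congr EFin.
  by field.
have clt0 : (c < 0)%R by rewrite lt_neqAle c0.
rewrite [X in _ * leb X](_ : _ = `[(b - y) / c, (a - y) / c[%classic)%R; last first.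
  by apply/seteqP; split=> s /=; rewrite !in_itv/= /phi ltr_ndivlMr//
    ler_ndivrMr// [(s * c)%R]mulrC => /andP[? ?]; apply/andP; split; lra.
rewrite !lebesgue_measure_itv/= !lte_fin ltr_nM2r ?invr_lt0// ltrBlDr subrK.
case: ifPn => _; last by rewrite mule0.
rewrite -!EFinB -EFinM ltr0_norm//; congr EFin.
by field.
Qed.

Lemma ge0_integral_lebesgue_affine (f : R -> \bar R) :
  measurable_fun setT f -> (forall x, 0 <= f x) ->
  `|c|%:E * \int[leb]_s f (y + c * s)%R = \int[leb]_s f s.
Proof.
move=> mf f0.
rewrite [RHS](eq_measure_integral
  (mscale (NngNum (normr_ge0 c)) image_leb)); last first.
  by move=> A mA _; exact: leb_phi.
by rewrite ge0_integral_mscale//= ge0_integral_pushforward.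
Qed.

End affine_1d.

Section integral_rV.
Local Open Scope ereal_scope.
Context (R : realType).
Notation leb d := (lebesgue_rV R d).

Lemma integral_rV0 (f : 'rV[R]_0 -> \bar R) :
  measurable_fun setT f -> \int[leb 0]_x f x = f 0%R.
Proof. by move=> mf; rewrite integral_dirac// diracT mul1e. Qed.

Lemma ge0_integral_rVS d (f : 'rV[R]_d.+1 -> \bar R) :
  measurable_fun setT f -> (forall x, 0 <= f x) ->
  \int[leb d.+1]_x f x =
  \int[@lebesgue_measure R]_s \int[leb d]_x f (rV_cons (s, x)).
Proof.
move=> mf f0.
transitivity (\int[pushforward (@lebesgue_measure R \x leb d)
    (@rV_cons R d)]_x f x); first by [].
rewrite ge0_integral_pushforward//; last exact: measurable_rV_cons.
rewrite preimage_setT fubini_tonelli1//; last by move=> p; exact: f0.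
by apply: measurableT_comp => //; exact: measurable_rV_cons.
Qed.

Lemma measurable_rV_affine d (c : R) (y : 'rV[R]_d) :
  measurable_fun setT (fun x : 'rV[R]_d => y + c *: x)%R.
Proof.
apply: measurable_fun_rV => i.
under eq_fun do rewrite !mxE.
apply: measurable_funD => //; apply: measurable_funM => //.
exact: measurable_coord.
Qed.

Lemma rV_cons_affine d (c : R) (y : 'rV[R]_d.+1) (p : R * 'rV[R]_d) :
  (y + c *: rV_cons p)%R =
  rV_cons (y ord0 ord0 + c * p.1, \row_i y ord0 (lift ord0 i) + c *: p.2)%R.
Proof.
apply/rowP => i; rewrite !mxE; case: fintype.splitP => j /= ij; rewrite !mxE.
  by congr (y _ _ + _)%R; apply: val_inj; rewrite /= ij ord1.
by congr (y _ _ + _)%R; apply: val_inj; rewrite /= ij.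
Qed.

Lemma ge0_integral_rV_affine d (c : R) (y : 'rV[R]_d) (f : 'rV[R]_d -> \bar R) :
  c != 0%R -> measurable_fun setT f -> (forall x, 0 <= f x) ->
  (`|c| ^+ d)%:E * \int[leb d]_x f (y + c *: x)%R = \int[leb d]_x f x.
Proof.
move=> c0; elim: d y f => [|d IH] y f mf f0.
  rewrite expr0 mul1e !integral_rV0//; first by congr f; apply/rowP => -[].
  by apply: measurableT_comp => //; exact: measurable_rV_affine.
have mfc s : measurable_fun setT (fun x => f (rV_cons (s, x))).
  apply: (measurableT_comp mf).
  apply: (measurableT_comp (@measurable_rV_cons R d)).
  exact: pair1_measurable.
rewrite !ge0_integral_rVS//; last first.
  by apply: measurableT_comp => //; exact: measurable_rV_affine.
under eq_integral => s _.
  under eq_integral => x _ do rewrite rV_cons_affine/=.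
  over.
have mI : measurable_fun setT (fun s => \int[leb d]_x f (rV_cons (s, x))).
  apply: (measurable_fun_fubini_tonelli_F (f \o @rV_cons R d)) => [|p]; last first.
    exact: f0.
  by apply: measurableT_comp => //; exact: measurable_rV_cons.
rewrite -(@ge0_integral_lebesgue_affine R c (y ord0 ord0) c0
    (fun s => \int[leb d]_x f (rV_cons (s, x)))) => [|//|s]; last exact: integral_ge0.
under [in RHS]eq_integral => s _.
  rewrite -(IH (\row_i y ord0 (lift ord0 i)))//; over.
rewrite ge0_integralZl_EFin ?exprn_ge0//; first 1 last.
- by move=> s _; exact: integral_ge0.
- have mF : measurable_fun setT (fun p : measurableTypeR R * 'rV[R]_d => f (rV_cons
      (y ord0 ord0 + c * p.1, \row_i y ord0 (lift ord0 i) + c *: p.2)))%R.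
    apply: (measurableT_comp mf).
    apply: (measurableT_comp (@measurable_rV_cons R d)).
    apply/measurable_fun_pairP; split => /=.
      by apply: measurable_funD => //; exact: measurable_funM.
    exact: (measurableT_comp (measurable_rV_affine _ _)).
  by apply: (measurable_fun_fubini_tonelli_F (m2 := leb d) _ mF).
by rewrite muleA -EFinM exprS.
Qed.

End integral_rV.

(** * Gaussians on R^d *)

Section gaussian.
Context (R : realType) (d : nat).
Notation leb := (lebesgue_rV R d).
Implicit Types (x y v : 'rV[R]_d) (c : R).

(** Invariance of Lebesgue measure under translations and point reflections. *)
Lemma integral_rV_isometry (c : R) y (f : 'rV[R]_d -> \bar R) :
  `|c| = 1 -> measurable_fun setT f ->
  (\int[leb]_x f (y + c *: x)%R = \int[leb]_x f x)%E.
Proof.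
move=> c1 mf.
have c0 : c != 0 by rewrite -normr_eq0 c1 oner_eq0.
rewrite [LHS]integralE [RHS]integralE.
have H (g : 'rV[R]_d -> \bar R) : measurable_fun setT g -> (forall x, 0 <= g x)%E ->
    (\int[leb]_x g (y + c *: x)%R = \int[leb]_x g x)%E.
  by move=> mg g0; rewrite -(ge0_integral_rV_affine y c0 mg g0) c1 expr1n mul1e.
congr (_ - _)%E.
  rewrite -(H (f^\+)%E)//; last exact: measurable_funepos.
  by apply: eq_integral => x _; rewrite funeposE funeposE.
rewrite -(H (f^\-)%E)//; last exact: measurable_funeneg.
by apply: eq_integral => x _; rewrite funenegE funenegE.
Qed.

Lemma continuous_measurable_rV (f : 'rV[R]_d -> R) :
  continuous f -> measurable_fun setT f.
Proof.
move=> cf; apply: (measurability _ (RGenOInfty.measurableE R)).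
move=> _ [_ [r ->] <-]; rewrite setTI; apply: open_measurable_rV.
by apply: open_comp => [x _|]; [exact: cf|exact: interval_open].
Qed.

Lemma measurable_norm_rV : measurable_fun setT (fun x => `|x|).
Proof. by apply: continuous_measurable_rV; exact: norm_continuous. Qed.

Lemma measurable_fun_dotv d' (T : measurableType d') (f g : T -> 'rV[R]_d) :
  measurable_fun setT f -> measurable_fun setT g ->
  measurable_fun setT (fun t => dotv (f t) (g t)).
Proof.
move=> mf mg; apply: measurable_sum => i.
by apply: measurable_funM; apply: (measurableT_comp (measurable_coord i)).
Qed.

Lemma dotvC x y : dotv x y = dotv y x.
Proof. by apply: eq_bigr => i _; rewrite mulrC. Qed.

Lemma dotvDl x y z : dotv (x + y) z = dotv x z + dotv y z.
Proof. by rewrite -big_split/=; apply: eq_bigr => i _; rewrite mxE mulrDl. Qed.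

Lemma dotvZl a x z : dotv (a *: x) z = a * dotv x z.
Proof. by rewrite mulr_sumr; apply: eq_bigr => i _; rewrite mxE mulrA. Qed.

Lemma dotvNl x z : dotv (- x) z = - dotv x z.
Proof. by rewrite -scaleN1r dotvZl mulN1r. Qed.

Lemma dotvDr x y z : dotv z (x + y) = dotv z x + dotv z y.
Proof. by rewrite dotvC dotvDl !(dotvC z). Qed.

Lemma dotvZr a x z : dotv z (a *: x) = a * dotv z x.
Proof. by rewrite dotvC dotvZl dotvC. Qed.

Lemma dotvNr x z : dotv z (- x) = - dotv z x.
Proof. by rewrite dotvC dotvNl dotvC. Qed.

Lemma dotv0l z : dotv (0 : 'rV[R]_d) z = 0.
Proof. by rewrite -(scale0r (0 : 'rV[R]_d)) dotvZl mul0r. Qed.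

Lemma dotv_ge0 x : 0 <= dotv x x.
Proof. by apply: sumr_ge0 => i _; rewrite -expr2 sqr_ge0. Qed.

Lemma sqr_coord_le_dotv x i : x ord0 i ^+ 2 <= dotv x x.
Proof.
rewrite /dotv (bigD1 i)//= -expr2 lerDl; apply: sumr_ge0 => j _.
by rewrite -expr2 sqr_ge0.
Qed.

Lemma coord_le_norm x i : `|x ord0 i| <= `|x|.
Proof.
rewrite {2}/Num.norm/= mx_normrE.
exact: (le_bigmax _ (fun j => `|x j.1 j.2|) (ord0, i)).
Qed.

Lemma norm_le_dotv x : `|x| <= 1 + dotv x x.
Proof.
rewrite {1}/Num.norm/= mx_normrE bigmax_le ?addr_ge0 ?dotv_ge0// => -[i j] _ /=.
rewrite ord1; have := sqr_coord_le_dotv x j; set t := x ord0 j.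
have := sqr_ge0 (`|t| - 1); rewrite sqrrB1 real_normK ?num_real//.
have := normr_ge0 t; nra.
Qed.

(** The Gaussian exp(- c |x|^2), with the Euclidean norm. *)
Definition gauss c x : R := expR (- (c * dotv x x)).

Lemma gauss_ge0 c x : 0 <= gauss c x. Proof. exact: expR_ge0. Qed.

Lemma gauss_le1 c x : 0 <= c -> gauss c x <= 1.
Proof. by move=> c0; rewrite -expR0 ler_expR oppr_le0 mulr_ge0// dotv_ge0. Qed.

Lemma gaussN c x : gauss c (- x) = gauss c x.
Proof. by rewrite /gauss dotvNl dotvNr opprK. Qed.

Lemma gaussZ c a x : gauss c (a *: x) = gauss (c * a ^+ 2) x.
Proof. by rewrite /gauss dotvZl dotvZr expr2 !mulrA. Qed.

Lemma measurable_fun_gauss c d' (T : measurableType d') (f : T -> 'rV[R]_d) :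
  measurable_fun setT f -> measurable_fun setT (fun t => gauss c (f t)).
Proof.
move=> mf; rewrite /gauss; under eq_fun do rewrite -mulNr.
apply: (measurableT_comp (@measurable_expR R)).
by apply: measurable_funM => //; exact: measurable_fun_dotv.
Qed.

Lemma measurable_gauss c : measurable_fun setT (gauss c).
Proof. exact: measurable_fun_gauss. Qed.

(** Half of the exponent of the Gaussian absorbs any power of the norm. *)
Lemma norm_pow_gauss c k : 0 < c ->
  exists2 C, 0 <= C & forall x, (1 + `|x|) ^+ k * gauss c x <= C * gauss (c / 2) x.
Proof.
(* K exp s bounds 1 + |x|, and k s is at most c <x, x> / 2. *)
move=> c0; pose K := 2 + 2 * k.+1%:R / c.
have k0 : 0 < k.+1%:R :> R by [].
have K0 : 0 <= K by rewrite addr_ge0// divr_ge0 ?mulr_ge0// ltW.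
exists (K ^+ k) => [|x]; first exact: exprn_ge0.
pose s := c * dotv x x / (2 * k.+1%:R).
have s0 : 0 <= s by rewrite divr_ge0 ?mulr_ge0 ?dotv_ge0// ltW.
have h : 1 + `|x| <= K * expR s.
  apply: (@le_trans _ _ (K * (1 + s))); last by rewrite ler_wpM2l// expR_ge1Dx.
  have -> : K * (1 + s) = 2 + 2 * k.+1%:R / c + 2 * s + dotv x x.
    by rewrite /K /s; field; rewrite gt_eqF//= gt_eqF.
  have := norm_le_dotv x.
  have : 0 <= 2 * k.+1%:R / c by rewrite divr_ge0 ?mulr_ge0// ltW.
  by lra.
have -> : gauss c x = expR (- (c / 2 * dotv x x)) * expR (- (c / 2 * dotv x x)).
  by rewrite -expRD; congr expR; field.
rewrite mulrA ler_wpM2r ?gauss_ge0//.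
apply: (@le_trans _ _ ((K * expR s) ^+ k * expR (- (c / 2 * dotv x x)))).
  by rewrite ler_wpM2r ?expR_ge0// lerXn2r// nnegrE ?addr_ge0 ?mulr_ge0 ?expR_ge0.
rewrite exprMn -(mulrA (K ^+ k)); apply: ler_piMr; first exact: exprn_ge0.
rewrite -expRM_natl -expRD -[leRHS]expR0 ler_expR subr_le0.
have -> : k%:R * s = (c / 2 * dotv x x) * (k%:R / k.+1%:R).
  rewrite /s; move: k0; set p : R := k%:R; set q : R := k.+1%:R => q0.
  by field; rewrite gt_eqF.
rewrite ler_piMr ?mulr_ge0 ?dotv_ge0 ?divr_ge0 ?(ltW c0)//.
by rewrite ler_pdivrMr// mul1r ler_nat.
Qed.

End gaussian.

Section gaussian_integral.
Context (R : realType).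

Lemma integral_gauss1_lty d : (\int[lebesgue_rV R d]_x (gauss 1 x)%:E < +oo)%E.
Proof.
elim: d => [|d IH].
  rewrite integral_rV0 ?ltry//.
  by apply/measurable_EFinP; exact: measurable_gauss.
rewrite ge0_integral_rVS; last 2 first.
- by apply/measurable_EFinP; exact: measurable_gauss.
- by move=> x; rewrite lee_fin gauss_ge0.
have gE s (x : 'rV[R]_d) : gauss 1 (rV_cons (s, x)) = gauss_fun s * gauss 1 x.
  rewrite /gauss /gauss_fun -expRD; congr expR.
  rewrite !mul1r -opprD; congr (- _).
  rewrite /dotv big_ord_recl expr2; congr (_ + _).
    by rewrite /rV_cons !mxE; case: fintype.splitP => j // _; rewrite !mxE.
  apply: eq_bigr => i _; rewrite /rV_cons !mxE.
  case: fintype.splitP => j /=; first by rewrite /bump/= ord1.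
  by rewrite /bump/= => -[ij]; rewrite (_ : i = j)//; exact: val_inj.
under eq_integral => s _.
  under eq_integral => x _ do rewrite gE EFinM.
  rewrite ge0_integralZl_EFin ?gauss_fun_ge0//; last 2 first.
  - by move=> x _; rewrite lee_fin gauss_ge0.
  - by apply/measurable_EFinP; exact: measurable_gauss.
  over.
rewrite ge0_integralZr//; last 3 first.
- by apply/measurable_EFinP; exact: measurable_gauss_fun.
- by move=> s _; rewrite lee_fin gauss_fun_ge0.
- by apply: integral_ge0 => x _; rewrite lee_fin gauss_ge0.
rewrite integralT_gauss.
by rewrite lte_mul_pinfty// ?lee_fin ?sqrtr_ge0//.
Qed.

Lemma integral_gauss_lty d c : 0 < c ->
  (\int[lebesgue_rV R d]_x (gauss c x)%:E < +oo)%E.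
Proof.
move=> c0; have sc0 : Num.sqrt c != 0 by rewrite gt_eqF// sqrtr_gt0.
have mg : measurable_fun setT (EFin \o @gauss R d 1).
  by apply/measurable_EFinP; exact: measurable_gauss.
have g0 (x : 'rV[R]_d) : (0 <= (EFin \o gauss 1) x)%E by rewrite lee_fin gauss_ge0.
have := ge0_integral_rV_affine 0 sc0 mg g0.
have := integral_gauss1_lty d; rewrite ltey => /eqP goo.
under eq_integral do rewrite /= add0r gaussZ mul1r sqr_sqrtr ?(ltW c0)//.
move=> H; rewrite ltey; apply/eqP => goo'; apply: goo; rewrite -H goo'.
by rewrite gt0_muley// lte_fin exprn_gt0// normr_gt0.
Qed.

Lemma integrable_gauss d c : 0 < c ->
  (lebesgue_rV R d).-integrable setT (EFin \o gauss c).
Proof.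
move=> c0; apply/integrableP; split.
  by apply/measurable_EFinP; exact: measurable_gauss.
under eq_integral do rewrite gee0_abs ?lee_fin ?gauss_ge0//.
exact: integral_gauss_lty.
Qed.

End gaussian_integral.

(** * Quasi-norms *)

Section quasi_norm_theory.
Context (R : realType) (d : nat) (N : 'rV[R]_d -> R).
Hypothesis qN : quasi_norm N.
Implicit Types x : 'rV[R]_d.

Lemma quasi_norm_continuous : continuous N.
Proof. by case: qN => K []. Qed.

(** The star body unfolded: the last two clauses say that [N x] is the infimum
    of the [t > 0] with [x] in [t K]. *)
Lemma quasi_norm_gauge : exists K : set 'rV[R]_d,
  [/\ compact K, K 0, forall y, K y -> K (- y),
      forall t x y, 0 < t -> K y -> x = t *: y -> N x <= t &
      forall x b, (forall t y, 0 < t -> K y -> x = t *: y -> b <= t) -> b <= N x].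
Proof.
case: qN => K [cK symK starK mK _]; exists K; split => //.
- have [y Ky] : exists y, K y.
    apply: contrapT => /forallNP K0; have := mK 0.
    rewrite /minkowski_functional (_ : [set t%:E | t in _] = set0) ?ereal_inf0//.
    by rewrite -subset0 => e [t [t0 [y Ky ty]] te]; exact: (K0 y).
  have := starK 0; rewrite lexx ler01 => /(_ isT); apply.
  by exists y => //; rewrite scale0r.
- by move=> y Ky; rewrite -symK; exists y.
- move=> t x y t0 Ky ->; rewrite -lee_fin -mK; apply: ereal_inf_lbound.
  by exists t => //; split=> //; exists y.
- move=> x b H; rewrite -lee_fin -mK; apply: le_ereal_inf_tmp => _ [t [t0 [y Ky yx]] <-].
  by rewrite lee_fin; exact: (H t y).
Qed.

Lemma quasi_norm_ge0 x : 0 <= N x.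
Proof. by have [K [_ _ _ _]] := quasi_norm_gauge; apply => t y /ltW. Qed.

Lemma quasi_norm0 : N 0 = 0.
Proof.
have [K [_ K0 _ ub _]] := quasi_norm_gauge.
apply/eqP; rewrite eq_le quasi_norm_ge0 andbT; apply/ler_addgt0Pl => e e0.
by rewrite addr0; apply: (ub _ _ 0) => //; rewrite scaler0.
Qed.

Let quasi_normZ_le t x : 0 < t -> N (t *: x) <= t * N x.
Proof.
have [K [_ _ _ ub lb]] := quasi_norm_gauge => t0.
rewrite mulrC -ler_pdivrMr//; apply: lb => s y s0 Ky ->.
rewrite ler_pdivrMr//; apply: (ub _ _ y) => //; first exact: mulr_gt0.
by rewrite scalerA mulrC.
Qed.

Lemma quasi_normZ t x : 0 < t -> N (t *: x) = t * N x.
Proof.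
move=> t0; apply/eqP; rewrite eq_le quasi_normZ_le//=.
have ti0 : 0 < t^-1 by rewrite invr_gt0.
have := quasi_normZ_le (t *: x) ti0.
by rewrite scalerA mulVf ?gt_eqF// scale1r mulrC ler_pdivlMr// mulrC.
Qed.

Lemma quasi_normN x : N (- x) = N x.
Proof.
have [K [_ _ sym ub lb]] := quasi_norm_gauge.
have H z : N (- z) <= N z.
  apply: lb => t y t0 Ky ->; apply: (ub _ _ (- y)) => //; first exact: sym.
  by rewrite scalerN.
by apply/eqP; rewrite eq_le H/= -{1}(opprK x) H.
Qed.

Lemma quasi_norm_lower : exists2 c, 0 < c & forall x, c * `|x| <= N x.
Proof.
have [K [cK _ _ _ lb]] := quasi_norm_gauge.
have [M [_ HM]] := compact_bounded cK.
pose c := `|M| + 1; have c0 : 0 < c by rewrite ltr_pwDr.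
have Kc y : K y -> `|y| <= c.
  by apply: HM; rewrite (le_lt_trans (ler_norm M))// ltrDl.
exists c^-1 => [|x]; first by rewrite invr_gt0.
apply: lb => t y t0 Ky ->; rewrite normrZ gtr0_norm// mulrC ler_pdivrMr//.
by rewrite ler_wpM2l ?(ltW t0)// Kc.
Qed.

Lemma quasi_norm_upper : exists2 c, 0 < c & forall x, N x <= c * `|x|.
Proof.
have /cvgrPdist_lt/(_ 1 ltr01) := @quasi_norm_continuous (0 : 'rV[R]_d).
rewrite quasi_norm0 => /nbhs_ballP[e /= e0 He].
exists (2 / e) => [|x]; first by rewrite divr_gt0.
have [->|x0] := eqVneq x 0; first by rewrite quasi_norm0 normr0 mulr0.
have [a a0 ax] : exists2 a : R, 0 < a & `|x| = a.
  by exists `|x| => //; rewrite normr_gt0.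
rewrite ax; pose t := e / (2 * a); have t0 : 0 < t by rewrite divr_gt0// mulr_gt0.
have : N (t *: x) <= 1.
  have /= := He (t *: x); rewrite sub0r normrN ger0_norm ?quasi_norm_ge0//.
  move=> H; apply/ltW/H; rewrite -ball_normE/= sub0r normrN normrZ gtr0_norm// ax.
  rewrite /t (_ : e / (2 * a) * a = e / 2); last by field; rewrite gt_eqF.
  by rewrite ltr_pdivrMr// ltr_pMr// ltr1n.
rewrite quasi_normZ// -ler_pdivlMl// mulr1 /t invf_div.
by rewrite (_ : 2 / e * a = 2 * a / e)//; field; rewrite gt_eqF.
Qed.

End quasi_norm_theory.

(** * Lower bounds for integrals over a unit box *)

Section unit_box.
Context (R : realType) (d : nat).
Notation leb := (lebesgue_rV R d).

Lemma dotv_le_norm (x : 'rV[R]_d) : dotv x x <= d%:R * `|x| ^+ 2.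
Proof.
apply: (@le_trans _ _ (\sum_(i < d) `|x| ^+ 2)).
  apply: ler_sum => i _; rewrite -expr2 -real_normK ?num_real//.
  by rewrite lerXn2r ?nnegrE// coord_le_norm.
by rewrite sumr_const card_ord mulr_natl.
Qed.

(** The box [1, 2]^d has volume 1 and avoids the origin. *)
Lemma box_le_integral (f : 'rV[R]_d -> R) (e : R) : 0 <= e ->
  measurable_fun setT f -> (forall x, 0 <= f x) ->
  (forall x : 'rV[R]_d, (forall i, 1 <= x ord0 i <= 2) -> e <= f x) ->
  (e%:E <= \int[leb]_x (f x)%:E)%E.
Proof.
move=> e0 mf f0 fe.
pose B := [set x : 'rV[R]_d | forall i, `[1%R, 2%R]%classic (x ord0 i)].
have mB : measurable B.
  rewrite [X in measurable X](_ : _ = \bigcap_(i in [set: 'I_d])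
      ((fun x : 'rV[R]_d => x ord0 i) @^-1` `[1%R, 2%R]%classic)); last first.
    by rewrite eqEsubset; split=> x /= h i *; exact: h.
  apply: fin_bigcap_measurable => // i _.
  by rewrite -[X in measurable X]setTI; exact: measurable_coord.
have B1 : leb B = 1%E.
  apply: etrans (lebesgue_rV_box (A := fun=> `[1%R, 2%R]%classic) _) _ => //.
  rewrite big1// => i _.
  by rewrite lebesgue_measure_itv/= lte_fin ltr1n -EFinB; congr EFin; lra.
have mEf : measurable_fun setT (EFin \o f) by exact/measurable_EFinP.
apply: (@le_trans _ _ (\int[leb]_(x in B) (f x)%:E)%E); last first.
  by apply: ge0_subset_integral => // x _; rewrite lee_fin.
apply: (@le_trans _ _ (\int[leb]_(x in B) e%:E)%E).
  by rewrite integral_cst// [X in (_ * X)%E]B1 mule1.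
apply: ge0_le_integral => //.
exact: measurable_funTS.
Qed.

Lemma box_norm_le2 (x : 'rV[R]_d) : (forall i, 1 <= x ord0 i <= 2) -> `|x| <= 2.
Proof.
move=> Hx; rewrite {1}/Num.norm/= mx_normrE bigmax_le// => -[i j] _ /=; rewrite ord1.
by have /andP[? ?] := Hx j; rewrite ger0_norm// (le_trans ler01).
Qed.

Lemma gauss_mass_gt0 (c Z : R) : 0 < c -> (\int[leb]_x (gauss c x)%:E = Z%:E)%E -> 0 < Z.
Proof.
move=> c0 HZ; have e0 : 0 < expR (- (c * (d%:R * 2 ^+ 2))) :> R by exact: expR_gt0.
rewrite -lte_fin -HZ; apply: (@lt_le_trans _ _ (expR (- (c * (d%:R * 2 ^+ 2))))%:E).
  by rewrite lte_fin.
apply: box_le_integral (ltW e0) _ _ _ => [|x|x Hx].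
- exact: measurable_gauss.
- exact: gauss_ge0.
rewrite /gauss ler_expR lerN2 ler_wpM2l ?(ltW c0)//.
by rewrite (le_trans (dotv_le_norm _))// ler_wpM2l// lerXn2r ?nnegrE// box_norm_le2.
Qed.

End unit_box.

(** * Gaussian averages of kernels of degree -l *)

Section power_kernel.
Context (R : realType) (d : nat) (l : R).
Hypotheses (l0 : 0 < l) (ld : l < d%:R).
Notation leb := (lebesgue_rV R d).
Implicit Types x y v z : 'rV[R]_d.

(** The model kernel |x|^-l, for the sup norm; it is 0 at the origin. *)
Definition pw x : R := (`|x| `^ l)^-1.

Lemma pw_ge0 x : 0 <= pw x. Proof. by rewrite invr_ge0 powR_ge0. Qed.

Lemma measurable_pw : measurable_fun setT pw.
Proof.
rewrite (_ : pw = fun x => `|x| `^ (- l)); last by apply/funext => x; rewrite powRN.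
by have := measurableT_comp (measurable_powR (- l)) (@measurable_norm_rV R d); apply.
Qed.

Lemma pwZ t x : 0 < t -> pw (t *: x) = (t `^ l)^-1 * pw x.
Proof. by move=> t0; rewrite /pw normrZ gtr0_norm// powRM ?(ltW t0)// invfM. Qed.

Lemma pw_le z x a : 0 < a -> z != 0 -> a * `|z| <= `|x| -> pw x <= (a `^ l)^-1 * pw z.
Proof.
move=> a0 z0 zx; rewrite /pw -invfM -powRM ?(ltW a0)//.
have az : 0 < a * `|z| by rewrite mulr_gt0// normr_gt0.
rewrite lef_pV2 ?posrE ?powR_gt0//; last exact: lt_le_trans zx.
by rewrite ge0_ler_powR ?nnegrE ?(ltW l0) ?(ltW az)// .
Qed.

Lemma pw_ge1 z : z != 0 -> `|z| <= 1 -> 1 <= pw z.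
Proof.
move=> z0 z1; rewrite /pw -[leLHS]invr1 lef_pV2 ?posrE ?powR_gt0 ?normr_gt0//.
have -> : 1 = 1 `^ l by rewrite powR1.
by rewrite ge0_ler_powR ?nnegrE ?(ltW l0).
Qed.

(** Here [l < d]: away from the unit ball, |z|^-d is below |z|^-l. *)
Lemma exprNd_le_pw z : 1 <= `|z| -> (`|z| ^+ d)^-1 <= pw z.
Proof.
move=> z1; have z0 : 0 < `|z| by exact: lt_le_trans z1.
rewrite /pw lef_pV2 ?posrE ?powR_gt0 ?exprn_gt0// -powR_mulrn//.
by rewrite ler_powR// ltW.
Qed.

Lemma gauss_ge_ball x : `|x| <= 1 -> 1 <= expR d%:R * gauss 1 x.
Proof.
move=> x1; rewrite /gauss mul1r -expRD -[leLHS]expR0 ler_expR subr_ge0.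
rewrite (le_trans (dotv_le_norm _))// ler_piMr//.
by rewrite -(expr1n _ 2) lerXn2r ?nnegrE.
Qed.

(** Indicator function of the closed unit ball of the sup norm. *)
Definition unit_ball_ind x : R := if `|x| <= 1 then 1 else 0.

Lemma measurable_unit_ball_ind : measurable_fun setT unit_ball_ind.
Proof.
apply: measurable_fun_ifT => //.
by apply: measurable_fun_ler => //; exact: measurable_norm_rV.
Qed.

Lemma unit_ball_ind_ge0 x : 0 <= unit_ball_ind x.
Proof. by rewrite /unit_ball_ind; case: ifP. Qed.

Lemma gauss_mass_fin c : 0 < c -> exists2 Z : R, 0 <= Z &
  (\int[leb]_x (gauss c x)%:E = Z%:E)%E.
Proof.
move=> c0; have I0 : (0 <= \int[leb]_x (gauss c x)%:E)%E.
  by apply: integral_ge0 => x _; rewrite lee_fin gauss_ge0.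
exists (fine (\int[leb]_x (gauss c x)%:E)%E); first exact: fine_ge0.
by rewrite fineK// ge0_fin_numE// integral_gauss_lty.
Qed.

(** Scaling argument: the kernel truncated at height [M] has an integral [J] over
    the unit ball such that [J <= const + (2^l / 2^d) J], which bounds [J]
    independently of [M] because [l < d]. *)
Lemma pw_locally_integrable : exists2 K : R, 0 <= K &
  (\int[leb]_x (pw x * unit_ball_ind x)%:E <= K%:E)%E.
Proof.
pose g (M : R) x := Num.min (pw x) M * unit_ball_ind x.
have mg M : measurable_fun setT (EFin \o g M).
  apply/measurable_EFinP; apply: measurable_funM; last exact: measurable_unit_ball_ind.
  by apply: measurable_minr => //; exact: measurable_pw.
have g0 M x : 0 <= M -> 0 <= g M x.
  by move=> M0; rewrite mulr_ge0 ?unit_ball_ind_ge0// le_min pw_ge0.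
have two0 : 0 < 2 `^ l by rewrite powR_gt0.
have two1 : 1 <= 2 `^ l.
  by rewrite -[leLHS](powRr0 2) ler_powR ?ler1n ?(ltW l0).
pose C := expR d%:R : R.
have C0 : 0 <= C by exact: expR_ge0.
(* On the unit ball, either 2 x is still in the ball, and the homogeneity of
   the kernel applies, or |x| > 1/2 and the kernel is at most 2^l. *)
have step M x : 0 <= M -> g M x <= 2 `^ l * (C * gauss 1 x) + 2 `^ l * g M (2 *: x).
  move=> M0; rewrite {1}/g {1}/unit_ball_ind.
  have Cg0 : 0 <= C * gauss 1 x by rewrite mulr_ge0 ?gauss_ge0.
  have [x1|x1] := leP `|x| 1; last first.
    by rewrite mulr0 addr_ge0// mulr_ge0 ?g0// ltW.
  rewrite mulr1; have [x2|x2] := leP `|2 *: x| 1.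
    apply: (@le_trans _ _ (2 `^ l * g M (2 *: x))); last first.
      by rewrite lerDr mulr_ge0// ltW.
    rewrite /g /unit_ball_ind x2 mulr1 pwZ// minr_pMr ?(ltW two0)//.
    rewrite mulrA divff ?gt_eqF// mul1r.
    by rewrite le_min ge_min lexx/= ge_min ler_peMl// orbT.
  apply: (@le_trans _ _ (2 `^ l * (C * gauss 1 x))); last first.
    by rewrite lerDl mulr_ge0 ?g0// ltW.
  apply: (@le_trans _ _ (2 `^ l)); last by rewrite ler_peMr ?(ltW two0)// gauss_ge_ball.
  rewrite ge_min; apply/orP; left.
  move: x2; rewrite normrZ ger0_norm// => x2.
  have x0 : 0 < `|x| by lra.
  rewrite /pw -div1r ler_pdivrMr ?powR_gt0// -powRM//.
  rewrite -[leLHS](congr1 (fun f : R -> R => f l) (powR1 R)); apply: ge0_ler_powR; rewrite ?nnegrE ?(ltW l0)//; exact: ltW.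
have [Z Z0 Zfin] := gauss_mass_fin ltr01.
have mgs : measurable_fun setT (EFin \o (@gauss R d 1)).
  by apply/measurable_EFinP; exact: measurable_gauss.
pose K := 2 ^+ d * 2 `^ l * C * Z / (2 ^+ d - 2 `^ l).
have den : 0 < 2 ^+ d - 2 `^ l :> R.
  rewrite subr_gt0 -powR_mulrn// /powR gt_eqF//.
  by rewrite ltr_expR ltr_pM2r// ln_gt0// ltr1n.
have K0 : 0 <= K by rewrite divr_ge0 ?mulr_ge0// ltW.
have gK M : 0 <= M -> (\int[leb]_x (g M x)%:E <= K%:E)%E.
  move=> M0.
  have Jfin : (\int[leb]_x (g M x)%:E)%E \is a fin_num.
    rewrite ge0_fin_numE; last by apply: integral_ge0 => x _; rewrite lee_fin g0.
    apply: (@le_lt_trans _ _ (\int[leb]_x (M * C * gauss 1 x)%:E)%E).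
      apply: ge0_le_integral => //=; first by move=> x _; rewrite lee_fin g0.
          exact: mg.
        by apply/measurable_EFinP; apply: measurable_funM => //; exact: measurable_gauss.
      move=> x _; rewrite lee_fin /g /unit_ball_ind -mulrA; have [x1|x1] := leP `|x| 1; last first.
        by rewrite mulr0 !mulr_ge0// gauss_ge0.
      rewrite mulr1 ge_min; apply/orP; right.
      by rewrite ler_peMr// gauss_ge_ball.
    under eq_integral do rewrite EFinM.
    rewrite ge0_integralZl_EFin ?mulr_ge0//; last by move=> x _; rewrite lee_fin gauss_ge0.
    by rewrite Zfin -EFinM ltry.
  have [J JE] : exists J, (\int[leb]_x (g M x)%:E)%E = J%:E.
    by exists (fine (\int[leb]_x (g M x)%:E)%E); rewrite fineK.
  have mg2 : measurable_fun setT (fun x => (g M (2 *: x))%:E).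
    apply: (measurableT_comp (mg M)).
    by have := @measurable_rV_affine R d 2 0; under eq_fun do rewrite add0r.
  have g2 : ((2 ^+ d)%:E * \int[leb]_x (g M (2 *: x))%:E = J%:E)%E.
    have := @ge0_integral_rV_affine R d 2 0 (EFin \o g M).
    rewrite ger0_norm//= JE => <-//; last 2 first.
    - by congr (_ * _)%E; apply: eq_integral => x _; rewrite add0r.
    - by move=> x; rewrite lee_fin g0.
  have : (\int[leb]_x (g M x)%:E <= \int[leb]_x ((2 `^ l * C)%:E * (gauss 1 x)%:E +
      (2 `^ l)%:E * (g M (2 *: x))%:E))%E.
    apply: ge0_le_integral => //=.
    - by move=> x _; rewrite lee_fin g0.
    - exact: mg.
    - by apply: emeasurable_funD; apply: emeasurable_funM.
    - by move=> x _; rewrite -!EFinM -EFinD lee_fin -mulrA step.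
  rewrite ge0_integralD//; last 4 first.
  - by move=> x _; rewrite -EFinM lee_fin !mulr_ge0 ?gauss_ge0 ?(ltW two0).
  - exact: emeasurable_funM.
  - by move=> x _; rewrite -EFinM lee_fin mulr_ge0 ?g0 ?(ltW two0).
  - exact: emeasurable_funM.
  rewrite ge0_integralZl_EFin//; last 2 first.
  - by move=> x _; rewrite lee_fin gauss_ge0.
  - by rewrite mulr_ge0// ltW.
  rewrite ge0_integralZl_EFin//; last by move=> x _; rewrite lee_fin g0.
  have d20 : 0 < 2 ^+ d :> R by rewrite exprn_gt0.
  have -> : (\int[leb]_x (g M (2 *: x))%:E = (J / 2 ^+ d)%:E)%E.
    have : (\int[leb]_x (g M (2 *: x))%:E)%E \is a fin_num.
      rewrite ge0_fin_numE; last by apply: integral_ge0 => x _; rewrite lee_fin g0.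
      rewrite ltey; apply/eqP => H; move: g2; rewrite H gt0_muley ?lte_fin//.
    move=> /fineK H; move: g2; rewrite -H -EFinM => -[<-].
    by congr EFin; field; rewrite gt_eqF.
  rewrite JE Zfin -!EFinM -EFinD !lee_fin => H.
  rewrite /K ler_pdivlMr// mulrBr.
  have : J * 2 ^+ d <= (2 `^ l * C * Z + 2 `^ l * (J / 2 ^+ d)) * 2 ^+ d.
    by rewrite ler_wpM2r// ltW.
  rewrite (mulrDl _ _ (2 ^+ d)) -(mulrA (2 `^ l) (J / _)) divfK ?gt_eqF//.
  by lra.
exists K => //.
have L : (\int[leb]_x (g n%:R x)%:E @[n --> \oo] -->
    \int[leb]_x (pw x * unit_ball_ind x)%:E)%E.
  apply: ge0_nd_cvg_integral => [n|n x|x m n mn|x].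
  - exact: mg.
  - by rewrite lee_fin g0.
  - rewrite lee_fin ler_wpM2r ?unit_ball_ind_ge0// le_min ge_min lexx/= ge_min ler_nat mn orbT//.
  - apply: cvg_near_cst; near=> n.
    by rewrite /g min_l//; near: n; exact: nbhs_infty_ger.
rewrite -(cvg_lim _ L)//; apply: lime_le; first by apply/cvg_ex; eexists; exact: L.
by apply: nearW => n; exact: gK.
Unshelve. all: by end_near. Qed.

(** The convolution of the kernel with a Gaussian is bounded: split the kernel
    into its restriction to the unit ball, integrable, and the rest, at most 1. *)
Lemma pw_convolution_bounded c a : 0 < c -> 0 <= a -> exists2 B : R, 0 <= B &
  forall y, (\int[leb]_v (pw (y + v)%R * (a * gauss c v))%:E <= B%:E)%E.
Proof.
move=> c0 a0; have [K K0 HK] := pw_locally_integrable.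
have [Z Z0 HZ] := gauss_mass_fin c0.
exists (a * K + a * Z) => [|y]; first by rewrite addr_ge0// mulr_ge0.
have mu1 : measurable_fun setT (fun x => (pw x * unit_ball_ind x)%:E).
  apply/measurable_EFinP; apply: measurable_funM; first exact: measurable_pw.
  exact: measurable_unit_ball_ind.
have mt : measurable_fun setT (fun v => y + v).
  by have := @measurable_rV_affine R d 1 y; under eq_fun do rewrite scale1r.
have mg : measurable_fun setT (EFin \o @gauss R d c).
  by apply/measurable_EFinP; exact: measurable_gauss.
have m1 := measurableT_comp mu1 mt.
have m2 : measurable_fun setT (fun v => pw (y + v)).
  by have := measurableT_comp measurable_pw mt; apply.
apply: (@le_trans _ _ (\int[leb]_v (a%:E * (pw (y + v)%R * unit_ball_ind (y + v)%R)%:E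
   + a%:E * (gauss c v)%:E))%E).
  apply: ge0_le_integral => //.
  - by move=> v _; rewrite lee_fin !mulr_ge0 ?pw_ge0 ?gauss_ge0.
  - apply/measurable_EFinP; apply: measurable_funM => //; apply: measurable_funM => //.
    exact: measurable_gauss.
  - by apply: emeasurable_funD; apply: emeasurable_funM.
  - move=> v _; rewrite -!EFinM -EFinD lee_fin mulrCA -mulrDr ler_wpM2l//.
    rewrite /unit_ball_ind; have [h|h] := leP `|y + v| 1.
      rewrite mulr1 (@le_trans _ _ (pw (y + v)))// ?lerDl ?gauss_ge0//.
      by rewrite ler_piMr ?pw_ge0// gauss_le1// ltW.
    rewrite mulr0 add0r ler_piMl ?gauss_ge0//.
    rewrite /pw invf_le1 ?powR_gt0 ?(lt_trans _ h)//.
    rewrite -[leLHS](congr1 (fun f : R -> R => f l) (powR1 R)).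
    by apply: ge0_ler_powR; rewrite ?nnegrE ?(ltW l0)//; exact: ltW.
rewrite ge0_integralD//; last 4 first.
- by move=> v _; rewrite -EFinM lee_fin !mulr_ge0 ?pw_ge0 ?unit_ball_ind_ge0.
- exact: emeasurable_funM.
- by move=> v _; rewrite -EFinM lee_fin mulr_ge0 ?gauss_ge0.
- exact: emeasurable_funM.
rewrite ge0_integralZl_EFin//; last first.
- by move=> v _; rewrite lee_fin mulr_ge0 ?pw_ge0 ?unit_ball_ind_ge0.
rewrite ge0_integralZl_EFin//; last first.
- by move=> v _; rewrite lee_fin gauss_ge0.
rewrite HZ EFinD !EFinM leeD2r// lee_wpmul2l ?lee_fin//.
apply: le_trans HK; have := @integral_rV_isometry R d 1 y _ (normr1 _) mu1.
by move=> <-; under [leRHS]eq_integral do rewrite scale1r.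
Qed.

Variable rho : 'rV[R]_d -> R.
Hypothesis mrho : measurable_fun setT rho.
Hypothesis rho_ge0 : forall x, 0 <= rho x.
Hypothesis rhoZ : forall t x, 0 < t -> rho (t *: x) = (t `^ l)^-1 * rho x.
Variables (K0 K1 : R).
Hypotheses (K0_gt0 : 0 < K0) (K1_gt0 : 0 < K1).
Hypothesis rho_le : forall x, rho x <= K1 * pw x.
Hypothesis pw_le_rho : forall x, pw x <= K0 * rho x.
Hypothesis rho_cont : forall x, x != 0 -> {for x, continuous rho}.

(** The average of [rho] over a Gaussian cloud of size [e] around [y]. *)
Definition gauss_avg e y : \bar R := (\int[leb]_v (rho (y + e *: v)%R * gauss 1 v)%:E)%E.

Let maff e y : measurable_fun setT (fun v => y + e *: v).
Proof. exact: measurable_rV_affine. Qed.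

Let mrho_aff e y : measurable_fun setT (fun v => rho (y + e *: v)).
Proof. by have := measurableT_comp mrho (maff e y); apply. Qed.

Let mpw_aff e y : measurable_fun setT (fun v => pw (y + e *: v)).
Proof. by have := measurableT_comp measurable_pw (maff e y); apply. Qed.

Let mga c : measurable_fun setT (@gauss R d c).
Proof. exact: measurable_gauss. Qed.

Lemma gauss_avg_ge0 e y : (0 <= gauss_avg e y)%E.
Proof. by apply: integral_ge0 => v _; rewrite lee_fin mulr_ge0// gauss_ge0. Qed.

Let scale_in e y v : e != 0 -> y + e *: v = e *: (e^-1 *: y + v).
Proof. by move=> e0; rewrite scalerDr scalerA mulfV// scale1r. Qed.

Lemma gauss_avgZ e y : 0 < e ->
  gauss_avg e y = ((e `^ l)^-1%:E * gauss_avg 1 (e^-1 *: y)%R)%E.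
Proof.
move=> e0; rewrite /gauss_avg -ge0_integralZl_EFin//; last 3 first.
- by move=> v _; rewrite lee_fin mulr_ge0// gauss_ge0.
- apply/measurable_EFinP; exact: measurable_funM.
- by rewrite invr_ge0 powR_ge0.
apply: eq_integral => v _; rewrite -EFinM; congr EFin.
by rewrite scale1r scale_in ?gt_eqF// rhoZ// mulrA.
Qed.

(** On the far region |e v| > |z| / 2 the Gaussian is at most (e / |z|)^d times
    a wider Gaussian. *)
Let far_near : exists2 h : R, 0 <= h & forall z e v, z != 0 -> 0 < e ->
  `|z| / 2 < `|e *: v| -> gauss 1 v <= (e / `|z|) ^+ d * (h * gauss (1/2) v).
Proof.
have [C C0 HC] := @norm_pow_gauss R d 1 d ltr01.
exists (2 ^+ d * C) => [|z e v z0 e0]; first by rewrite mulr_ge0// exprn_ge0.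
rewrite normrZ gtr0_norm// => far.
have nz0 : 0 < `|z| by rewrite normr_gt0.
apply: (@le_trans _ _ ((e / `|z|) ^+ d * (2 ^+ d * ((1 + `|v|) ^+ d * gauss 1 v)))); last first.
  rewrite ler_wpM2l ?exprn_ge0 ?divr_ge0// ?(ltW e0)//.
  by rewrite -mulrA ler_wpM2l ?exprn_ge0.
rewrite 2!mulrA -!exprMn ler_peMl ?gauss_ge0// exprn_ege1//.
rewrite mulrAC ler_pdivlMr// mul1r.
by rewrite (_ : e * _ = 2 * e + 2 * (e * `|v|)); [lra|ring].
Qed.

Let near_le z v : z != 0 -> `|v| <= `|z| / 2 -> rho (z + v) <= K1 * 2 `^ l * pw z.
Proof.
move=> z0 near; apply: (le_trans (rho_le _)); rewrite -mulrA ler_wpM2l ?(ltW K1_gt0)//.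
have -> : 2 `^ l = (2^-1 `^ l)^-1 by rewrite -[2^-1]powR_inv1// -powRrM mulN1r powRN invrK.
apply: pw_le => //; have := lerB_normD z v; lra.
Qed.

(** The far region contributes at most a multiple of e^-l (e / |y|)^d, which
    tends to 0 with [e] since [l < d]. *)
Let far_bound : exists2 B : R, 0 <= B & forall e y, 0 < e -> y != 0 ->
  (\int[leb]_v (rho (y + e *: v)%R * (if `|y| / 2 < `|e *: v| then gauss 1 v else 0)%R)%:E
   <= (B * ((e `^ l)^-1 * (e / `|y|) ^+ d))%:E)%E.
Proof.
have [h h0 far] := far_near.
have [B B0 HB] := pw_convolution_bounded (divr_gt0 ltr01 (ltr0Sn R 1)) h0.
exists (K1 * B) => [|e y e0 y0]; first by rewrite mulr_ge0// ltW.
pose b : R := K1 * ((e `^ l)^-1 * (e / `|y|) ^+ d).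
have b0 : 0 <= b.
  by rewrite !mulr_ge0 ?invr_ge0 ?powR_ge0 ?exprn_ge0 ?mulr_ge0 ?invr_ge0 ?(ltW e0) ?(ltW K1_gt0).
have m1 : measurable_fun setT (fun v => pw (e^-1 *: y + v)).
  by have := mpw_aff 1 (e^-1 *: y); under eq_fun do rewrite scale1r.
apply: (@le_trans _ _ (\int[leb]_v (b%:E * (pw (e^-1 *: y + v)%R * (h * gauss (1/2) v))%:E))%E).
  apply: ge0_le_integral => //.
  - move=> v _; rewrite lee_fin mulr_ge0//; case: ifP => // _; exact: gauss_ge0.
  - apply/measurable_EFinP; apply: measurable_funM => //; apply: measurable_fun_ifT => //.
    apply: measurable_fun_ltr => //.
    have := measurableT_comp (@measurable_norm_rV R d) (maff e 0); apply: eq_measurable_fun.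
    by move=> v _ /=; rewrite add0r.
  - apply/measurable_EFinP; apply: measurable_funM => //; apply: measurable_funM => //.
    exact: measurable_funM.
  move=> v _; rewrite -EFinM lee_fin.
  have pg0 : 0 <= pw (e^-1 *: y + v) * (h * gauss (1/2) v).
    by rewrite !mulr_ge0 ?pw_ge0 ?gauss_ge0.
  case: ifP => [fr|_]; last by rewrite mulr0 mulr_ge0.
  rewrite scale_in ?gt_eqF// rhoZ//.
  apply: (@le_trans _ _ ((e `^ l)^-1 * (K1 * pw (e^-1 *: y + v)) *
      ((e / `|y|) ^+ d * (h * gauss (1/2) v)))); last by rewrite /b le_eqVlt; apply/orP; left; apply/eqP; ring.
  apply: ler_pM; rewrite ?mulr_ge0 ?invr_ge0 ?powR_ge0 ?gauss_ge0//.
  - by rewrite ler_wpM2l ?invr_ge0 ?powR_ge0.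
  - exact: far.
rewrite ge0_integralZl_EFin//; last 2 first.
- by move=> v _; rewrite lee_fin !mulr_ge0 ?pw_ge0 ?gauss_ge0.
- apply/measurable_EFinP; apply: measurable_funM => //; exact: measurable_funM.
apply: (@le_trans _ _ (b%:E * B%:E)%E); first by rewrite lee_wpmul2l ?lee_fin.
by rewrite -EFinM lee_fin /b le_eqVlt; apply/orP; left; apply/eqP; ring.
Qed.

Let gauss_avg_split e y : gauss_avg e y =
  (\int[leb]_v (rho (y + e *: v)%R * (if `|y| / 2 < `|e *: v| then 0 else gauss 1 v)%R)%:E +
   \int[leb]_v (rho (y + e *: v)%R * (if `|y| / 2 < `|e *: v| then gauss 1 v else 0)%R)%:E)%E.
Proof.
have mfar : measurable_fun setT (fun v => `|y| / 2 < `|e *: v|).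
  apply: measurable_fun_ltr => //.
  have := measurableT_comp (@measurable_norm_rV R d) (maff e 0); apply: eq_measurable_fun.
  by move=> v _ /=; rewrite add0r.
rewrite -ge0_integralD//; first last.
- by apply/measurable_EFinP; apply: measurable_funM => //; exact: measurable_fun_ifT.
- by move=> v _; rewrite lee_fin mulr_ge0//; case: ifP => // _; exact: gauss_ge0.
- by apply/measurable_EFinP; apply: measurable_funM => //; exact: measurable_fun_ifT.
- by move=> v _; rewrite lee_fin mulr_ge0//; case: ifP => // _; exact: gauss_ge0.
apply: eq_integral => v _; rewrite -EFinD -mulrDr.
by case: ifP => _; rewrite ?add0r ?addr0.
Qed.

Let near_if e y v : y != 0 ->
  rho (y + e *: v) * (if `|y| / 2 < `|e *: v| then 0 else gauss 1 v) <=
  K1 * 2 `^ l * pw y * gauss 1 v.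
Proof.
move=> y0; case: ifPn => [_|]; first by rewrite mulr0 !mulr_ge0 ?pw_ge0 ?powR_ge0 ?gauss_ge0// ltW.
by rewrite -leNgt => near; rewrite ler_wpM2r ?gauss_ge0// near_le.
Qed.

Let mnear e y : measurable_fun setT (fun v => (rho (y + e *: v) *
  (if `|y| / 2 < `|e *: v| then 0 else gauss 1 v))%:E).
Proof.
apply/measurable_EFinP; apply: measurable_funM => //; apply: measurable_fun_ifT => //.
apply: measurable_fun_ltr => //.
have := measurableT_comp (@measurable_norm_rV R d) (maff e 0); apply: eq_measurable_fun.
by move=> v _ /=; rewrite add0r.
Qed.

(** Uniform domination.  By homogeneity only [e = 1] matters; for |z| >= 1 the
    average is split into near and far regions, and for |z| < 1 it is bounded
    while the kernel is at least 1. *)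
Lemma gauss_avg_le : exists2 D : R, 0 <= D & forall e y, 0 < e -> y != 0 ->
  (gauss_avg e y <= (D * rho y)%:E)%E.
Proof.
have [Z Z0 HZ] := gauss_mass_fin ltr01.
have [B B0 HB] := far_bound.
have [B' B'0 HB'] := pw_convolution_bounded ltr01 ler01.
pose D := K1 * 2 `^ l * Z + B + K1 * B'.
have t0 : 0 <= K1 * 2 `^ l * Z by rewrite !mulr_ge0 ?powR_ge0// ltW.
have t1 : 0 <= K1 * B' by rewrite mulr_ge0// ltW.
have D0 : 0 <= D by rewrite !addr_ge0.
have H z : z != 0 -> (gauss_avg 1 z <= (D * pw z)%:E)%E.
  move=> z0; have [z1|z1] := leP 1 `|z|.
    rewrite gauss_avg_split /D.
    apply: (@le_trans _ _ ((K1 * 2 `^ l * Z * pw z)%:E + (B * pw z)%:E)%E); last first.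
      by rewrite -EFinD lee_fin !mulrDl lerDl mulr_ge0 ?pw_ge0.
    apply: leeD.
      apply: (@le_trans _ _ (\int[leb]_v ((K1 * 2 `^ l * pw z)%:E * (gauss 1 v)%:E))%E).
        apply: ge0_le_integral => //.
        - by move=> v _; rewrite lee_fin mulr_ge0//; case: ifP => // _; exact: gauss_ge0.
        - by apply/measurable_EFinP; exact: measurable_funM.
        - by move=> v _; rewrite -EFinM lee_fin near_if.
      rewrite ge0_integralZl_EFin//; last 3 first.
      - by move=> v _; rewrite lee_fin gauss_ge0.
      - exact/measurable_EFinP.
      - by rewrite !mulr_ge0 ?powR_ge0 ?pw_ge0// ltW.
      by rewrite HZ -EFinM lee_fin -!mulrA [Z * _]mulrC.
    apply: le_trans (HB _ _ ltr01 z0) _; rewrite lee_fin ler_wpM2l//.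
    by rewrite powR1 invr1 mul1r div1r exprVn; exact: exprNd_le_pw.
  apply: (@le_trans _ _ (K1%:E * B'%:E)%E); last first.
    rewrite -EFinM lee_fin (@le_trans _ _ (K1 * B' * pw z))//.
      by rewrite ler_peMr// pw_ge1// ltW.
    by rewrite ler_wpM2r ?pw_ge0// /D lerDr addr_ge0.
  have m1 : measurable_fun setT (fun v => pw (z + v)).
    by have := mpw_aff 1 z; under eq_fun do rewrite scale1r.
  apply: (@le_trans _ _ (K1%:E * \int[leb]_v (pw (z + v)%R * (1 * gauss 1 v))%:E)%E); last first.
    by rewrite lee_wpmul2l ?lee_fin// ltW.
  rewrite -ge0_integralZl_EFin ?(ltW K1_gt0)//; last 2 first.
  - by move=> v _; rewrite lee_fin !mulr_ge0 ?pw_ge0 ?gauss_ge0.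
  - by apply/measurable_EFinP; apply: measurable_funM => //; exact: measurable_funM.
  apply: ge0_le_integral => //.
  - by move=> v _; rewrite lee_fin mulr_ge0// gauss_ge0.
  - by apply/measurable_EFinP; exact: measurable_funM.
  - apply/measurable_EFinP; apply: measurable_funM => //; apply: measurable_funM => //.
    exact: measurable_funM.
  - move=> v _; rewrite -EFinM lee_fin scale1r mul1r mulrA ler_wpM2r ?gauss_ge0//.
exists (D * K0) => [|e y e0 y0]; first by rewrite mulr_ge0// ltW.
rewrite gauss_avgZ//.
have ei0 : 0 < e^-1 by rewrite invr_gt0.
have ey0 : e^-1 *: y != 0 by rewrite scaler_eq0 negb_or y0 gt_eqF.
apply: (@le_trans _ _ ((e `^ l)^-1%:E * (D * pw (e^-1 *: y))%:E)%E).
  by rewrite lee_wpmul2l ?lee_fin ?invr_ge0 ?powR_ge0// H.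
rewrite -EFinM lee_fin pwZ// mulrCA -mulrA ler_wpM2l// mulrA -invfM -powRM ?(ltW e0) ?(ltW ei0)//.
by rewrite mulfV ?gt_eqF// powR1 invr1 mul1r.
Qed.

Let eps (k : nat) : R := k.+1%:R^-1.

Let eps_gt0 k : 0 < eps k. Proof. by rewrite invr_gt0. Qed.

Let eps0 : eps @ \oo --> 0.
Proof. exact: cvg_harmonic. Qed.

Let eps_powR a : 0 < a -> eps k `^ a @[k --> \oo] --> 0.
Proof.
move=> a0; have H : eps @ \oo --> 0^'+.
  move=> A; rewrite /at_right /within/= => HA; have := eps0 HA.
  apply: (@filterS nat \oo _ (fun k => 0 < eps k -> A (eps k))) => k; apply.
  exact: eps_gt0.
exact: cvg_comp H (powR_cvg0 a0).
Qed.

(** Dominated convergence on the near region; the far region is negligible by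
    [far_bound]. *)
Lemma gauss_avg_cvg Z y : (\int[leb]_v (gauss 1 v)%:E = Z%:E)%E -> y != 0 ->
  (gauss_avg (k.+1%:R^-1) y @[k --> \oo] --> (Z * rho y)%:E)%E.
Proof.
move=> HZ y0; have ny0 : 0 < `|y| by rewrite normr_gt0.
have near : (\int[leb]_v (rho (y + k.+1%:R^-1 *: v)%R *
    (if `|y| / 2 < `|k.+1%:R^-1 *: v| then 0 else gauss 1 v)%R)%:E
    @[k --> \oo] --> (Z * rho y)%:E)%E.
  have ig : leb.-integrable setT (fun v => ((K1 * 2 `^ l * pw y)%:E * (gauss 1 v)%:E)%E).
    by apply: integrableZl => //; exact: integrable_gauss.
  have mlim : measurable_fun setT (fun v => (rho y * gauss 1 v)%:E).
    by apply/measurable_EFinP; exact: measurable_funM.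
  have [] := @dominated_convergence _ _ _ leb setT measurableT
    (fun k v => (rho (y + eps k *: v) *
       (if `|y| / 2 < `|eps k *: v| then 0 else gauss 1 v))%:E)
    (fun v => (rho y * gauss 1 v)%:E) (fun v => ((K1 * 2 `^ l * pw y)%:E * (gauss 1 v)%:E)%E).
  - by move=> k; exact: mnear.
  - exact: mlim.
  - apply: aeW => v _.
    have ev : eps k *: v @[k --> \oo] --> (0 : 'rV[R]_d).
      by rewrite -(scale0r v); apply: cvgZr_tmp; exact: eps0.
    apply: cvg_EFin; first exact: nearW.
    have -> : rho y * gauss 1 v = rho (y + 0) * gauss 1 v by rewrite addr0.
    have : rho (y + eps k *: v) * gauss 1 v @[k --> \oo] --> rho (y + 0) * gauss 1 v.
      apply: cvgMr_tmp.
      have yev : y + eps k *: v @[k --> \oo] --> y + 0 by apply: cvgD ev; exact: cvg_cst.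
      apply: (cvg_comp _ _ yev); rewrite addr0; exact: rho_cont.
    apply: cvg_trans; apply: near_eq_cvg.
    have : \forall k \near \oo, `|eps k *: v| < `|y| / 2.
      have /cvgrPdist_lt/(_ (`|y| / 2)) := ev.
      rewrite divr_gt0// => /(_ isT); apply: filterS => k; by rewrite sub0r normrN.
    apply: filterS => k /= h; rewrite ltNge (ltW h)//.
  - exact: ig.
  - apply: aeW => v k _; rewrite gee0_abs; first by rewrite -EFinM lee_fin near_if.
    by rewrite lee_fin mulr_ge0//; case: ifP => // _; exact: gauss_ge0.
  suff -> : (Z * rho y)%:E = (\int[leb]_v (rho y * gauss 1 v)%:E)%E by [].
  under eq_integral do rewrite EFinM.
  rewrite ge0_integralZl_EFin//; last 2 first.
  - by move=> v _; rewrite lee_fin gauss_ge0.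
  - exact/measurable_EFinP.
  by rewrite HZ -EFinM mulrC.
have [B B0 HB] := far_bound.
have far : (\int[leb]_v (rho (y + k.+1%:R^-1 *: v)%R *
    (if `|y| / 2 < `|k.+1%:R^-1 *: v| then gauss 1 v else 0)%R)%:E
    @[k --> \oo] --> 0)%E; last first.
  have ok : ((Z * rho y)%:E +? 0)%E by [].
  have := cvgeD ok near far; rewrite adde0.
  by rewrite (eq_cvg _ _ (fun k => gauss_avg_split k.+1%:R^-1 y)); apply.
have : \forall k \near \oo, (0 <= \int[leb]_v (rho (y + k.+1%:R^-1 *: v)%R *
    (if `|y| / 2 < `|k.+1%:R^-1 *: v| then gauss 1 v else 0)%R)%:E <=
    (B * ((eps k `^ l)^-1 * (eps k / `|y|) ^+ d))%:E)%E.
  apply: nearW => k; rewrite HB ?eps_gt0// andbT; apply: integral_ge0 => v _.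
  by rewrite lee_fin mulr_ge0//; case: ifP => // _; exact: gauss_ge0.
move/squeeze_cvge; apply.
- exact: cvg_cst.
apply: cvg_EFin; first exact: nearW.
rewrite [X in X @ _](_ : _ = fun k => B / `|y| ^+ d * eps k `^ (d%:R - l)).
  rewrite -[X in _ --> X](mulr0 (B / `|y| ^+ d)); apply: cvgMl_tmp.
  by apply: eps_powR; rewrite subr_gt0.
apply/funext => k /=; rewrite powRB; last by rewrite gt_eqF ?implybT.
rewrite powR_mulrn ?(ltW (eps_gt0 k))// expr_div_n; field.
by rewrite gt_eqF ?expf_neq0 ?gt_eqF ?powR_gt0.
Qed.

Lemma gauss_avg1_gt0 : exists2 D : R, 0 < D & (D%:E <= gauss_avg 1 0)%E.
Proof.
pose D : R := (K0 * 2 `^ l)^-1 * expR (- (d%:R * 2 ^+ 2)).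
have D0 : 0 < D by rewrite mulr_gt0 ?invr_gt0 ?mulr_gt0 ?powR_gt0 ?expR_gt0.
exists D => //.
apply: box_le_integral (ltW D0) _ _ _ => [|v|v Hv].
- exact: measurable_funM.
- by rewrite mulr_ge0// gauss_ge0.
rewrite add0r scale1r.
have v2 := box_norm_le2 Hv.
have d0 : (0 < d)%N by rewrite -(ltr_nat R) (lt_trans l0).
have v1 : 0 < `|v|.
  apply: (@lt_le_trans _ _ `|v ord0 (Ordinal d0)|); last exact: coord_le_norm.
  have /andP[h _] := Hv (Ordinal d0).
  by rewrite normr_gt0 gt_eqF// (lt_le_trans ltr01).
apply: ler_pM.
- by rewrite invr_ge0 mulr_ge0 ?powR_ge0// ltW.
- exact: expR_ge0.
- rewrite invfM -ler_pdivlMl ?invr_gt0// invrK; apply: le_trans (pw_le_rho v).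
  rewrite /pw lef_pV2 ?posrE ?powR_gt0// ge0_ler_powR ?nnegrE ?(ltW l0)//.
- rewrite /gauss mul1r ler_expR lerN2 (le_trans (dotv_le_norm _))//.
  by rewrite ler_wpM2l// lerXn2r ?nnegrE.
Qed.

(** At the origin the average is exactly e^-l times its value for [e = 1]. *)
Lemma gauss_avg_cvg0 : (gauss_avg (k.+1%:R^-1) 0 @[k --> \oo] --> +oo)%E.
Proof.
have [D D0 HD] := gauss_avg1_gt0.
apply/cvgeyPge => A; near=> k.
have kA : (`|A| / D) `^ l^-1 <= k.+1%:R.
  near: k; have := nbhs_infty_ger ((`|A| / D) `^ l^-1); apply: filterS => k h.
  by rewrite (le_trans h)// ler_nat.
rewrite gauss_avgZ ?invr_gt0// scaler0.
apply: (@le_trans _ _ (((k.+1%:R^-1 `^ l)^-1)%:E * D%:E)%E); last first.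
  by rewrite lee_wpmul2l// lee_fin invr_ge0 powR_ge0.
rewrite -EFinM lee_fin -ler_pdivrMr//.
apply: (@le_trans _ _ (`|A| / D)); first by rewrite ler_wpM2r ?invr_ge0 ?(ltW D0)// ler_norm.
have -> : (k.+1%:R^-1 `^ l)^-1 = k.+1%:R `^ l :> R.
  by rewrite -[k.+1%:R^-1]powR_inv1// -powRrM mulN1r powRN invrK.
have AD0 : 0 <= `|A| / D by rewrite divr_ge0// ltW.
have -> : `|A| / D = ((`|A| / D) `^ l^-1) `^ l.
  by rewrite -powRrM mulVf ?gt_eqF// powRr1.
by apply: ge0_ler_powR; rewrite ?nnegrE ?powR_ge0// ltW.
Unshelve. all: by end_near. Qed.
End power_kernel.

(** * Symmetrised Gaussians are Schwartz functions *)

Section directional.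
Context (R : realType) (d : nat).
Implicit Types (x v : 'rV[R]_d) (f : 'rV[R]_d -> R).

(** Directional derivatives are derivatives along lines, so that the chain rule
    of one real variable applies. *)
Lemma is_derive_along_line f x v df :
  is_derive (0 : R) 1 (fun h : R => f (h *: v + x)) df -> is_derive x v f df.
Proof.
have E : (fun h : R => h^-1 *: ((f \o shift x) (h *: v) - f x)) =
    (fun h : R => h^-1 *: (((fun h : R => f (h *: v + x)) \o shift 0) (h *: 1) -
       (fun h : R => f (h *: v + x)) 0)).
  by apply/funext => h /=; rewrite scale0r add0r addr0 /GRing.scale/= mulr1.
by move=> [H1 H2]; split; [rewrite /derivable E|rewrite /derive E].
Qed.

Lemma is_derive_on_line f x v df :
  is_derive x v f df -> is_derive (0 : R) 1 (fun h : R => f (h *: v + x)) df.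
Proof.
have E : (fun h : R => h^-1 *: ((f \o shift x) (h *: v) - f x)) =
    (fun h : R => h^-1 *: (((fun h : R => f (h *: v + x)) \o shift 0) (h *: 1) -
       (fun h : R => f (h *: v + x)) 0)).
  by apply/funext => h /=; rewrite scale0r add0r addr0 /GRing.scale/= mulr1.
by move=> [H1 H2]; split; [rewrite /derivable -E|rewrite /derive -E].
Qed.

Lemma is_derive_coord x v i : is_derive x v (fun x => x ord0 i) (v ord0 i).
Proof.
apply: is_derive_along_line.
rewrite (_ : (fun h : R => _) = (fun h => h * v ord0 i + x ord0 i)); last first.
  by apply/funext => h; rewrite !mxE.
by apply: is_derive_eq; rewrite /GRing.scale/=; ring.
Qed.

Lemma is_derive_expR_comp f x v df :
  is_derive x v f df -> is_derive x v (fun x => expR (f x)) (df * expR (f x)).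
Proof.
move=> /is_derive_on_line H; apply: is_derive_along_line.
have := @is_derive1_comp R expR (fun h : R => f (h *: v + x)) 0
  (expR (f (0 *: v + x))) df (is_derive_expR _) H.
by rewrite scale0r add0r mulrC; apply.
Qed.

(** Polynomial functions on R^d, as the least class containing constants and
    coordinates and closed under sums and products. *)
Inductive polyfun : ('rV[R]_d -> R) -> Prop :=
| polyfun_cst a : polyfun (fun=> a)
| polyfun_coord i : polyfun (fun x => x ord0 i)
| polyfunD p q : polyfun p -> polyfun q -> polyfun (fun x => p x + q x)
| polyfunM p q : polyfun p -> polyfun q -> polyfun (fun x => p x * q x).

Lemma polyfun_derive p v : polyfun p ->
  exists2 q, polyfun q & forall x, is_derive x v p (q x).
Proof.
elim=> [a|i|{}p q _ [p' pp' dp] _ [q' pq' dq]|{}p q pp [p' pp' dp] pq [q' pq' dq]].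
- exists (fun=> 0) => [|x]; [exact: polyfun_cst|exact: is_derive_cst].
- exists (fun=> v ord0 i) => [|x]; [exact: polyfun_cst|exact: is_derive_coord].
- exists (fun x => p' x + q' x) => [|x]; first exact: polyfunD.
  exact: is_deriveD.
- exists (fun x => p x * q' x + q x * p' x) => [|x].
    by apply: polyfunD; exact: polyfunM.
  exact: is_deriveM.
Qed.

Lemma polyfun_continuous p : polyfun p -> continuous p.
Proof.
elim=> [a|i|{}p q _ cp _ cq|{}p q _ cp _ cq] x.
- exact: cst_continuous.
- exact: (@coord_continuous R 1 d ord0 i x).
- by apply: continuousD; [exact: cp|exact: cq].
- by apply: continuousM; [exact: cp|exact: cq].
Qed.

Lemma polyfun_prod (r : seq 'I_d) (F : 'I_d -> 'rV[R]_d -> R) :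
  (forall i, polyfun (F i)) -> polyfun (fun x => \prod_(i <- r) F i x).
Proof.
move=> pF; elim: r => [|i r IH].
  by under eq_fun do rewrite big_nil; exact: polyfun_cst.
by under eq_fun do rewrite big_cons; exact: polyfunM.
Qed.

Lemma polyfun_sum (r : seq 'I_d) (F : 'I_d -> 'rV[R]_d -> R) :
  (forall i, polyfun (F i)) -> polyfun (fun x => \sum_(i <- r) F i x).
Proof.
move=> pF; elim: r => [|i r IH].
  by under eq_fun do rewrite big_nil; exact: polyfun_cst.
by under eq_fun do rewrite big_cons; exact: polyfunD.
Qed.

Lemma polyfunX p k : polyfun p -> polyfun (fun x => p x ^+ k).
Proof.
move=> pp; elim: k => [|k IH].
  by under eq_fun do rewrite expr0; exact: polyfun_cst.
by under eq_fun do rewrite exprS; exact: polyfunM.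
Qed.

Lemma polyfun_growth p : polyfun p ->
  exists C k, 0 <= C /\ forall x, `|p x| <= C * (1 + `|x|) ^+ k.
Proof.
have one x k : 1 <= (1 + `|x|) ^+ k by rewrite exprn_ege1// lerDl.
elim=> [a|i|{}p q _ [C [k [C0 Cp]]] _ [D [m [D0 Dq]]]|
    {}p q _ [C [k [C0 Cp]]] _ [D [m [D0 Dq]]]].
- by exists `|a|, 0%N; split => // x; rewrite expr0 mulr1.
- exists 1, 1%N; split => // x; rewrite mul1r expr1.
  by rewrite (le_trans (coord_le_norm _ _))// lerDr.
- exists (C + D), (k + m)%N; split => [|x]; first exact: addr_ge0.
  rewrite (le_trans (ler_normD _ _))// mulrDl exprD lerD//.
    by rewrite (le_trans (Cp x))// mulrA ler_peMr// mulr_ge0// exprn_ge0// addr_ge0.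
  by rewrite (le_trans (Dq x))// mulrCA ler_peMl// mulr_ge0// exprn_ge0// addr_ge0.
- exists (C * D), (k + m)%N; split => [|x]; first exact: mulr_ge0.
  by rewrite normrM exprD mulrACA ler_pM.
Qed.

Lemma polyfun_gauss_bounded p c y : 0 < c -> polyfun p ->
  exists M, forall x, `|p x * gauss c (x - y)| <= M.
Proof.
move=> c0 /polyfun_growth[C [k [C0 HC]]].
have [B B0 HB] := @norm_pow_gauss R d c k c0.
exists (C * ((1 + `|y|) ^+ k * B)) => x.
rewrite normrM [X in _ * X <= _]ger0_norm ?gauss_ge0//.
apply: (@le_trans _ _ (C * ((1 + `|y|) ^+ k * ((1 + `|x - y|) ^+ k * gauss c (x - y))))).
  rewrite !mulrA ler_wpM2r ?gauss_ge0// (le_trans (HC x))// -mulrA ler_wpM2l//.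
  rewrite -exprMn lerXn2r ?nnegrE ?mulr_ge0 ?addr_ge0//.
  have : `|x| <= `|x - y| + `|y| by rewrite -{1}(subrK y x) ler_normD.
  have := mulr_ge0 (normr_ge0 y) (normr_ge0 (x - y)).
  by rewrite mulrDl !mulrDr !mul1r !mulr1; lra.
rewrite ler_wpM2l// ler_wpM2l ?exprn_ge0 ?addr_ge0//.
rewrite (le_trans (HB _))// ler_piMr// gauss_le1//.
by rewrite divr_ge0// ltW.
Qed.

Lemma polyfun_gauss_exponent c y : polyfun (fun x => - (c * dotv (x - y) (x - y))).
Proof.
rewrite (_ : (fun x => _) = fun x => (- c) * dotv (x - y) (x - y)); last first.
  by apply/funext => x; rewrite mulNr.
apply: polyfunM; first exact: polyfun_cst.
apply: (@polyfun_sum _ (fun i x => (x - y) ord0 i * (x - y) ord0 i)) => i.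
have H : polyfun (fun x => (x - y) ord0 i).
  rewrite (_ : (fun x => _) = fun x => x ord0 i + - y ord0 i); last first.
    by apply/funext => x; rewrite !mxE.
  by apply: polyfunD; [exact: polyfun_coord|exact: polyfun_cst].
exact: polyfunM.
Qed.

(** Sums of two products (polynomial) * (translated Gaussian) form a class
    stable under partial derivatives, all of whose members decay rapidly. *)
Lemma schwartz_poly_gauss2 c (y1 y2 : 'rV[R]_d) p1 p2 : 0 < c ->
  polyfun p1 -> polyfun p2 ->
  schwartz_real (fun x => p1 x * gauss c (x - y1) + p2 x * gauss c (x - y2)).
Proof.
move=> c0 pp1 pp2.
pose cls f := exists p1 p2, [/\ polyfun p1, polyfun p2 &
  f = fun x => p1 x * gauss c (x - y1) + p2 x * gauss c (x - y2)].
have dg p y v : polyfun p -> exists2 q, polyfun q & forall x,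
    is_derive x v (fun x => p x * gauss c (x - y)) (q x * gauss c (x - y)).
  move=> pp; have [p' pp' dp] := polyfun_derive v pp.
  have [e' pe' de] := polyfun_derive v (polyfun_gauss_exponent c y).
  exists (fun x => p x * e' x + p' x) => [|x].
    by apply: polyfunD => //; exact: polyfunM.
  rewrite (_ : _ * gauss _ _ = p x * (e' x * gauss c (x - y)) + gauss c (x - y) * p' x).
    exact: is_deriveM (dp x) (is_derive_expR_comp (de x)).
  by ring.
have dcls f v : cls f -> exists2 g, cls g & forall x, is_derive x v f (g x).
  move=> [q1 [q2 [pq1 pq2 ->]]].
  have [r1 pr1 d1] := dg q1 y1 v pq1.
  have [r2 pr2 d2] := dg q2 y2 v pq2.
  exists (fun x => r1 x * gauss c (x - y1) + r2 x * gauss c (x - y2)).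
    by exists r1, r2.
  by move=> x; exact: is_deriveD.
have cg y : continuous (fun x => gauss c (x - y)).
  move=> x; apply: (@continuous_comp _ _ _ (fun x => - (c * dotv (x - y) (x - y))) expR).
    exact: polyfun_continuous (polyfun_gauss_exponent c y) x.
  exact: continuous_expR.
move=> s.
have [q1 [q2 [pq1 pq2 ->]]] : cls (partials s
    (fun x => p1 x * gauss c (x - y1) + p2 x * gauss c (x - y2))).
  elim: s => [|i s IH]; first by exists p1, p2.
  have [g cg' Hg] := dcls _ (delta_mx ord0 i) IH.
  rewrite (_ : partials _ _ = g)//; apply/funext => x /=.
  by have [] := Hg x.
split.
- have C q y : polyfun q -> continuous (fun x : 'rV[R]_d => q x * gauss c (x - y)).
    move=> pq x; apply: (@continuousM _ _ q (fun x => gauss c (x - y)) x).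
      exact: polyfun_continuous.
    exact: cg.
  move=> x; exact: (@continuousD _ _ _ (fun x => q1 x * gauss c (x - y1))
     (fun x => q2 x * gauss c (x - y2)) x (C _ _ pq1 x) (C _ _ pq2 x)).
- move=> i x; have cq : cls (fun x => q1 x * gauss c (x - y1) + q2 x * gauss c (x - y2)).
    by exists q1, q2.
  by have [g _ /(_ x)[]] := dcls _ (delta_mx ord0 i) cq.
- move=> alpha.
  have pm : polyfun (fun x => \prod_i x ord0 i ^+ alpha i).
    by apply: (@polyfun_prod _ (fun i x => x ord0 i ^+ alpha i)) => i; apply/polyfunX/polyfun_coord.
  have [M1 H1] := polyfun_gauss_bounded y1 c0 (polyfunM pm pq1).
  have [M2 H2] := polyfun_gauss_bounded y2 c0 (polyfunM pm pq2).
  exists (M1 + M2) => x; rewrite mulrDr !mulrA (le_trans (ler_normD _ _))//.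
  by rewrite lerD.
Qed.

(** The even function averaging the Gaussians centred at [y] and at [- y]. *)
Definition sym_gauss c y x : R := (gauss c (x - y) + gauss c (x + y)) / 2.

Lemma schwartz_sym_gauss c y : 0 < c -> schwartz (fun x => (sym_gauss c y x)%:C%C).
Proof.
move=> c0; split.
  have := @schwartz_poly_gauss2 c y (- y) _ _ c0 (polyfun_cst 2^-1) (polyfun_cst 2^-1).
  rewrite (_ : (fun x => _) = fun x => complex.Re (sym_gauss c y x)%:C%C)//.
  by apply/funext => x /=; rewrite /sym_gauss opprK; field.
have := @schwartz_poly_gauss2 c y (- y) _ _ c0 (polyfun_cst 0) (polyfun_cst 0).
rewrite (_ : (fun x => _) = fun x => complex.Im (sym_gauss c y x)%:C%C)//.
by apply/funext => x /=; rewrite !mul0r addr0.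
Qed.

Lemma sym_gauss_even c y x : sym_gauss c y (- x) = sym_gauss c y x.
Proof.
rewrite /sym_gauss -[- x + y]opprK opprD opprK -opprD !gaussN.
by rewrite addrC.
Qed.

End directional.

(** * The kernel attached to a quasi-norm *)

Section quasi_norm_kernel.
Context (R : realType) (d : nat) (N : 'rV[R]_d -> R) (l : R).
Hypotheses (qN : quasi_norm N) (l0 : 0 < l).

(** The kernel N(x)^-l; it is 0 at the origin. *)
Definition kern (x : 'rV[R]_d) : R := (N x `^ l)^-1.

Lemma kern_ge0 x : 0 <= kern x. Proof. by rewrite invr_ge0 powR_ge0. Qed.

Lemma measurable_kern : measurable_fun setT kern.
Proof.
rewrite (_ : kern = fun x => N x `^ (- l)); last by apply/funext => x; rewrite powRN.
have mN : measurable_fun setT N.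
  exact: continuous_measurable_rV (quasi_norm_continuous qN).
by have := measurableT_comp (measurable_powR (- l)) mN; apply.
Qed.

Lemma kernZ t x : 0 < t -> kern (t *: x) = (t `^ l)^-1 * kern x.
Proof.
move=> t0; rewrite /kern (quasi_normZ qN)// powRM ?(ltW t0) ?quasi_norm_ge0//.
by rewrite invfM.
Qed.

Lemma kernN x : kern (- x) = kern x.
Proof. by rewrite /kern quasi_normN. Qed.

Lemma quasi_norm_gt0 x : x != 0 -> 0 < N x.
Proof.
move=> x0; have [c c0 Hc] := quasi_norm_lower qN.
by apply: lt_le_trans (Hc x); rewrite mulr_gt0// normr_gt0.
Qed.

Lemma kern_le : exists2 K : R, 0 < K & forall x, kern x <= K * pw l x.
Proof.
have [c c0 Hc] := quasi_norm_lower qN.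
exists (c `^ l)^-1 => [|x]; first by rewrite invr_gt0 powR_gt0.
have [->|x0] := eqVneq x 0.
  by rewrite /kern (quasi_norm0 qN) powR0 ?gt_eqF// invr0 mulr_ge0 ?invr_ge0 ?powR_ge0.
have nx0 : 0 < `|x| by rewrite normr_gt0.
rewrite /kern /pw -invfM -powRM ?(ltW c0)// lef_pV2 ?posrE ?powR_gt0 ?mulr_gt0//.
  by rewrite ge0_ler_powR ?nnegrE ?(ltW l0) ?mulr_ge0 ?(ltW c0) ?(quasi_norm_ge0 qN).
exact: quasi_norm_gt0.
Qed.

Lemma kern_ge : exists2 K : R, 0 < K & forall x, pw l x <= K * kern x.
Proof.
have [c c0 Hc] := quasi_norm_upper qN.
exists (c `^ l) => [|x]; first by rewrite powR_gt0.
have [->|x0] := eqVneq x 0.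
  by rewrite /pw normr0 powR0 ?gt_eqF// invr0 mulr_ge0 ?kern_ge0 ?powR_ge0.
have nx0 : 0 < `|x| by rewrite normr_gt0.
have Nx0 := quasi_norm_gt0 x0.
rewrite /kern /pw ler_pdivlMr ?powR_gt0// mulrC ler_pdivrMr ?powR_gt0//.
rewrite -powRM ?(ltW c0)//.
by rewrite ge0_ler_powR ?nnegrE ?(ltW l0) ?mulr_ge0 ?(ltW c0) ?(ltW Nx0).
Qed.

Lemma kern_continuous x : x != 0 -> {for x, continuous kern}.
Proof.
move=> x0; apply: continuousV; first by rewrite gt_eqF//; apply: powR_gt0; exact: quasi_norm_gt0.
apply: (@continuous_comp _ _ _ N (fun r : R => r `^ l) x).
  exact: quasi_norm_continuous.
apply/differentiable_continuous/derivable1_diffP.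
by apply: derivable_powR; rewrite in_itv/= quasi_norm_gt0.
Qed.

End quasi_norm_kernel.

(** * Fourier transform of a Gaussian *)

Lemma measurable_fun_cos disp (T : measurableType disp) (R : realType) (f : T -> R) :
  measurable_fun setT f -> measurable_fun setT (fun t => cos (f t)).
Proof.
move=> mf; have mc : measurable_fun [set: R] (@cos R).
  by apply: continuous_measurable_fun; exact: continuous_cos.
by have := measurableT_comp mc mf; apply.
Qed.

Lemma measurable_fun_sin disp (T : measurableType disp) (R : realType) (f : T -> R) :
  measurable_fun setT f -> measurable_fun setT (fun t => sin (f t)).
Proof.
move=> mf; have mc : measurable_fun [set: R] (@sin R).
  by apply: continuous_measurable_fun; exact: continuous_sin.
by have := measurableT_comp mc mf; apply.
Qed.

Section gauss_fourier.
Context (R : realType) (d : nat).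
Notation leb := (lebesgue_rV R d).
Implicit Types (x y v xi : 'rV[R]_d) (c : R).

(** The Fourier transform of the Gaussian, which is real since the Gaussian is
    even. *)
Definition ghat c xi : R := Rintegral leb setT (fun x => gauss c x * cos (2 * pi * dotv x xi)).

Let mcos a xi : measurable_fun setT (fun x => cos (2 * pi * dotv x xi + a)).
Proof.
apply: measurable_fun_cos; apply: measurable_funD => //.
by apply: measurable_funM => //; exact: measurable_fun_dotv.
Qed.

Let mga c : measurable_fun setT (@gauss R d c).
Proof. exact: measurable_gauss. Qed.

Lemma integrable_gauss_bounded c (g : 'rV[R]_d -> R) : 0 < c ->
  measurable_fun setT g -> (forall x, `|g x| <= 1) ->
  leb.-integrable setT (fun x => (gauss c x * g x)%:E).
Proof.
move=> c0 mg g1; apply: (le_integrable _ _ _ (integrable_gauss d c0)) => //.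
  by apply/measurable_EFinP; exact: measurable_funM.
move=> x _; rewrite lee_fin normrM [leRHS]ger0_norm ?gauss_ge0//.
by rewrite ger0_norm ?gauss_ge0// ler_piMr// gauss_ge0.
Qed.

Lemma norm_cos_le1 (a : R) : `|cos a| <= 1.
Proof. by rewrite ler_norml cos_geN1 cos_le1. Qed.

Lemma norm_sin_le1 (a : R) : `|sin a| <= 1.
Proof. by rewrite ler_norml sin_geN1 sin_le1. Qed.

Let msin xi : measurable_fun setT (fun x => sin (2 * pi * dotv x xi)).
Proof.
apply: measurable_fun_sin.
by apply: measurable_funM => //; exact: measurable_fun_dotv.
Qed.

Let mcos0 xi : measurable_fun setT (fun x => cos (2 * pi * dotv x xi)).
Proof. by have := mcos 0 xi; under eq_fun do rewrite addr0. Qed.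

Let integral_gauss_sin c xi : 0 < c ->
  (\int[leb]_x (gauss c x * sin (2 * pi * dotv x xi))%:E = 0)%E.
Proof.
move=> c0; have isin := integrable_gauss_bounded c0 (msin xi) (fun x => norm_sin_le1 _).
have m : measurable_fun setT (fun x => (gauss c x * sin (2 * pi * dotv x xi))%:E).
  by apply/measurable_EFinP; exact: measurable_funM.
have := integral_rV_isometry 0 (normrN1 R) m.
have /fineK := integrable_fin_num measurableT isin.
set I := (\int[leb]_x (gauss c x * sin (2 * pi * dotv x xi))%:E)%E => II.
under eq_integral do rewrite add0r scaleN1r gaussN dotvNl mulrN sinN mulrN EFinN.
rewrite (@integralN _ _ _ _ _ _)/=; last first.
  by apply: integrable_add_def.
rewrite -/I -II -EFinN => -[h]; congr EFin; lra.
Qed.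

Lemma integral_gauss_cosD c xi a : 0 < c ->
  (\int[leb]_x (gauss c x * cos (2 * pi * dotv x xi + a))%:E = (cos a * ghat c xi)%:E)%E.
Proof.
move=> c0; have isin := integrable_gauss_bounded c0 (msin xi) (fun x => norm_sin_le1 _).
have icos := integrable_gauss_bounded c0 (mcos0 xi) (fun x => norm_cos_le1 _).
transitivity (\int[leb]_x ((cos a)%:E * (gauss c x * cos (2 * pi * dotv x xi))%:E
    - (sin a)%:E * (gauss c x * sin (2 * pi * dotv x xi))%:E))%E.
  apply: eq_integral => x _; rewrite -!EFinM -EFinB cosD; congr EFin; ring.
rewrite integralB//; last 2 first.
- exact: integrableZl.
- exact: integrableZl.
rewrite !integralZl// integral_gauss_sin// mule0 sube0 EFinM /ghat /Rintegral fineK//.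
exact: integrable_fin_num.
Qed.

Lemma ghatE c xi : 0 < c ->
  (\int[leb]_x (gauss c x * cos (2 * pi * dotv x xi))%:E = (ghat c xi)%:E)%E.
Proof.
move=> c0; have := integral_gauss_cosD xi 0 c0; rewrite cos0 mul1r => <-.
by apply: eq_integral => x _; rewrite addr0.
Qed.

(** Completing the square: the Gaussian of parameter [c] is, up to a constant,
    the convolution of that of parameter [2 c] with itself. *)
Let gauss_conv c u x : gauss (2 * c) u * gauss (2 * c) (x - u) =
  gauss c x * gauss (4 * c) (u - 2^-1 *: x).
Proof.
rewrite /gauss -!expRD; congr expR.
rewrite !(dotvDl, dotvDr, dotvNl, dotvNr, dotvZl, dotvZr) (dotvC x u); by field.
Qed.

(** By [gauss_conv], a positive multiple of [ghat c xi] is the square of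
    [ghat (2 * c) xi].  The closed form of the transform is not needed. *)
Lemma ghat_ge0 c xi : 0 < c -> 0 <= ghat c xi.
Proof.
move=> c0; have c20 : 0 < 2 * c by rewrite mulr_gt0.
have c40 : 0 < 4 * c by rewrite mulr_gt0.
have [Z Z0 HZ] := gauss_mass_fin d c40.
have [Z2 Z20 HZ2] := gauss_mass_fin d c20.
pose F (p : 'rV[R]_d * 'rV[R]_d) : \bar R :=
  (gauss (2 * c) p.1 * gauss (2 * c) (p.2 - p.1) * cos (2 * pi * dotv p.2 xi))%:E.
have m21 : measurable_fun setT (fun p : 'rV[R]_d * 'rV[R]_d => p.2 - p.1).
  apply: measurable_fun_rV => i; under eq_fun do rewrite !mxE.
  by apply: measurable_funB; apply: (measurableT_comp (measurable_coord i)).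
have mgg : measurable_fun setT (fun p : 'rV[R]_d * 'rV[R]_d =>
    gauss (2 * c) p.1 * gauss (2 * c) (p.2 - p.1)).
  by apply: measurable_funM; apply: measurable_fun_gauss.
have mF : measurable_fun setT F.
  apply/measurable_EFinP; apply: measurable_funM => //.
  by have := measurableT_comp (mcos0 xi) (@measurable_snd _ _ 'rV[R]_d 'rV[R]_d); apply.
have shift u (g : 'rV[R]_d -> \bar R) : measurable_fun setT g ->
    (\int[leb]_x g (x - u)%R = \int[leb]_x g x)%E.
  move=> mg; rewrite -(integral_rV_isometry (- u) (normr1 R) mg).
  by apply: eq_integral => x _; rewrite scale1r addrC.
have iF : (leb \x leb)%E.-integrable setT F.
  apply/integrable12ltyP => //.
  apply: (@le_lt_trans _ _ (\int[leb]_u ((gauss (2 * c) u)%:E * Z2%:E))%E).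
    apply: ge0_le_integral => //.
    - by move=> u _; exact: integral_ge0.
    - apply: (measurable_fun_fubini_tonelli_F (fun p => `|F p|%E)) => //.
      exact: measurableT_comp.
    - by apply: emeasurable_funM => //; exact/measurable_EFinP.
    move=> u _; rewrite -HZ2 -(shift u (fun x => (gauss (2 * c) x)%:E)); last exact/measurable_EFinP.
    have mgu : measurable_fun setT (fun x => (gauss (2 * c) (x - u))%:E).
      apply/measurable_EFinP; apply: measurable_fun_gauss.
      by have := @measurable_rV_affine R d 1 (- u); under eq_fun do rewrite scale1r addrC.
    rewrite -ge0_integralZl_EFin ?gauss_ge0//; last first.
      by move=> x _; rewrite lee_fin gauss_ge0.
    apply: ge0_le_integral => //.
    - apply: measurableT_comp => //; exact: (measurableT_comp mF (pair1_measurable u)).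
    - exact: emeasurable_funM.
    - move=> x _; rewrite lee_fin normrM ger0_norm ?mulr_ge0 ?gauss_ge0//.
      by rewrite ler_piMr ?mulr_ge0 ?gauss_ge0// norm_cos_le1.
  rewrite ge0_integralZr//; last 2 first.
  - exact/measurable_EFinP.
  - by move=> x _; rewrite lee_fin gauss_ge0.
  by rewrite HZ2 -EFinM ltry.
(* Integrating in the two orders gives ghat (2 c) xi ^ 2 on one side and
   Z * ghat c xi on the other. *)
have := Fubini iF.
under eq_integral => u _.
  rewrite (_ : (\int[leb]_y F (u, y) = (ghat (2 * c) xi)%:E *
      (gauss (2 * c) u * cos (2 * pi * dotv u xi))%:E)%E); last first.
    pose G y : \bar R := ((gauss (2 * c) u)%:E *
      (gauss (2 * c) y * cos (2 * pi * dotv y xi + 2 * pi * dotv u xi))%:E)%E.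
    rewrite (_ : (fun y => F (u, y)) = (fun y => G (y - u))); last first.
      apply/funext => y; rewrite /F /G /= -EFinM mulrA; congr (_ * cos _)%:E.
      by rewrite dotvDl dotvNl; ring.
    have mG : measurable_fun setT G.
      by apply: emeasurable_funM => //; apply/measurable_EFinP; exact: measurable_funM.
    rewrite shift// integralZl//; last first.
      by apply: integrable_gauss_bounded => // x; exact: norm_cos_le1.
    by rewrite integral_gauss_cosD// -!EFinM; congr EFin; ring.
  over.
rewrite integralZl//; last first.
  by apply: integrable_gauss_bounded => // x; exact: norm_cos_le1.
rewrite ghatE//.
under [RHS]eq_integral => x _.
  rewrite (_ : (\int[leb]_y F (y, x) = Z%:E *
     (gauss c x * cos (2 * pi * dotv x xi))%:E)%E); last first.
    rewrite /F/=; under eq_integral do rewrite gauss_conv mulrAC EFinM.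
    rewrite integralZl//; last first.
      apply/integrableP; split.
        apply/measurable_EFinP; apply: measurable_fun_gauss.
        have := @measurable_rV_affine R d 1 (- (2^-1 *: x)).
        by under eq_fun do rewrite scale1r addrC.
      under eq_integral do rewrite gee0_abs ?lee_fin ?gauss_ge0//.
      rewrite (shift _ (fun x => (gauss (4 * c) x)%:E)); last exact/measurable_EFinP.
      by rewrite HZ ltry.
    rewrite (shift _ (fun x => (gauss (4 * c) x)%:E)); last exact/measurable_EFinP.
    by rewrite HZ muleC.
  over.
rewrite integralZl//; last first.
  by apply: integrable_gauss_bounded => // x; exact: norm_cos_le1.
rewrite ghatE// -!EFinM => -[h].
have : 0 <= Z * ghat c xi by rewrite -h -expr2 sqr_ge0.
have Zgt0 := gauss_mass_gt0 c40 HZ.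
by rewrite pmulr_rge0.
Qed.

Lemma ghat_le c : 0 < c -> exists2 Z : R, 0 <= Z & forall xi, ghat c xi <= Z.
Proof.
move=> c0; have [Z Z0 HZ] := gauss_mass_fin d c0; exists Z => // xi.
rewrite -lee_fin -ghatE// -HZ; apply: le_integral => //.
- by apply: integrable_gauss_bounded => // x; exact: norm_cos_le1.
- exact: integrable_gauss.
- by move=> x _; rewrite lee_fin ler_piMr ?gauss_ge0// cos_le1.
Qed.

(** Tonelli's theorem for the nonnegative factor 1 + cos. *)
Lemma measurable_ghat c : 0 < c -> measurable_fun setT (ghat c).
Proof.
move=> c0; have [Z Z0 HZ] := gauss_mass_fin d c0.
pose f (p : 'rV[R]_d * 'rV[R]_d) := (gauss c p.2 * (1 + cos (2 * pi * dotv p.2 p.1)))%:E.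
have mf : measurable_fun setT f.
  apply/measurable_EFinP; apply: measurable_funM; first exact: measurable_fun_gauss.
  apply: measurable_funD => //; apply: measurable_fun_cos.
  by apply: measurable_funM => //; exact: measurable_fun_dotv.
have f0 p : (0 <= f p)%E.
  by rewrite lee_fin mulr_ge0 ?gauss_ge0// -lerBlDl sub0r cos_geN1.
have := measurable_fun_fubini_tonelli_F (m2 := leb) f mf f0.
rewrite (_ : fubini_F _ _ = fun xi => (Z + ghat c xi)%:E); last first.
  apply/funext => xi; rewrite /fubini_F /f/=.
  under eq_integral do rewrite mulrDr mulr1 EFinD.
  rewrite integralD//; last 2 first.
  - exact: integrable_gauss.
  - by apply: integrable_gauss_bounded => // x; exact: norm_cos_le1.
  by rewrite ghatE// HZ.
move=> /measurable_EFinP m; rewrite (_ : ghat c = fun xi => (Z + ghat c xi) - Z).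
  exact: measurable_funB.
by apply/funext => xi; rewrite addrC addKr.
Qed.

(** Only the real part is computed; it is all that the embedding identity needs. *)
Lemma fourier_sym_gauss c y xi : 0 < c ->
  complex.Re (fourier (fun x => (sym_gauss c y x)%:C%C) xi) =
  cos (2 * pi * dotv y xi) * ghat c xi.
Proof.
move=> c0; rewrite /fourier /Cintegral/= /Rintegral.
have maff z : measurable_fun setT (fun x : 'rV[R]_d => x + z).
  by have := @measurable_rV_affine R d 1 z; under eq_fun do rewrite scale1r addrC.
have H z : (\int[leb]_x (gauss c (x + z) * cos (2 * pi * dotv x xi))%:E =
    (cos (2 * pi * dotv z xi) * ghat c xi)%:E)%E.
  pose G x : \bar R := (gauss c x * cos (2 * pi * dotv x xi + - (2 * pi * dotv z xi)))%:E.
  have mG : measurable_fun setT G by apply/measurable_EFinP; exact: measurable_funM.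
  rewrite -[cos (_ * dotv z _)]cosN -integral_gauss_cosD//.
  rewrite -(integral_rV_isometry z (normr1 R) mG); apply: eq_integral => x _.
  rewrite /G scale1r addrC; congr (_ * cos _)%:E.
  by rewrite dotvDl; ring.
have ig z : leb.-integrable setT (fun x => (gauss c (x + z) * cos (2 * pi * dotv x xi))%:E).
  have mg : measurable_fun setT (fun x => gauss c (x + z)) by exact: measurable_fun_gauss.
  have ig0 : leb.-integrable setT (fun x => (gauss c (x + z))%:E).
    apply/integrableP; split; first exact/measurable_EFinP.
    under eq_integral do rewrite gee0_abs ?lee_fin ?gauss_ge0//.
    have mE : measurable_fun setT (fun x => (@gauss R d c x)%:E) by exact/measurable_EFinP.
    rewrite (_ : integral _ _ _ = (\int[leb]_x (gauss c x)%:E)%E) ?integral_gauss_lty//.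
    rewrite -(integral_rV_isometry z (normr1 R) mE).
    by apply: eq_integral => x _; rewrite scale1r addrC.
  apply: (le_integrable _ _ _ ig0) => //.
    by apply/measurable_EFinP; exact: measurable_funM.
  move=> x _; rewrite lee_fin normrM [leRHS]ger0_norm ?gauss_ge0//.
  by rewrite ger0_norm ?gauss_ge0// ler_piMr ?gauss_ge0// norm_cos_le1.
rewrite (_ : integral _ _ _ = (cos (2 * pi * dotv y xi) * ghat c xi)%:E)//.
transitivity (\int[leb]_x ((2^-1)%:E * ((gauss c (x + - y) * cos (2 * pi * dotv x xi))%:E
    + (gauss c (x + y) * cos (2 * pi * dotv x xi))%:E)))%E.
  apply: eq_integral => x _; rewrite -EFinD -EFinM; congr EFin.
  by rewrite /sym_gauss/= mul0r subr0 cosN dotvC; field.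
rewrite integralZl//; last exact: integrableD.
rewrite integralD// !H -EFinD -EFinM; congr EFin.
by rewrite dotvNl mulrN cosN; field.
Qed.

End gauss_fourier.

(** * The positive-definite kernel given by the embedding *)

Lemma Re_realM (R : rcfType) (a : R) (z : R[i]) :
  complex.Re (a%:C%C * z) = a * complex.Re z.
Proof. by case: z => u v /=; rewrite mul0r subr0. Qed.

Lemma Re_Cintegral disp (T : measurableType disp) (R : realType)
    (mu : {measure set T -> \bar R}) (D : set T) (f : T -> R[i]) :
  complex.Re (Cintegral mu D f) = Rintegral mu D (fun x => complex.Re (f x)).
Proof. by []. Qed.

Section embedding.
Context (R : realType) (d : nat) (N : 'rV[R]_d -> R) (l : R).
Hypotheses (qN : quasi_norm N) (l0 : 0 < l) (ld : l < d%:R).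
Notation leb := (lebesgue_rV R d).
Notation rho := (kern N l).
Notation leb1 := (@lebesgue_measure R).

Let mrho : measurable_fun setT rho. Proof. exact: measurable_kern. Qed.

Lemma gauss_avg_fin e y : 0 < e -> exists2 B : R, 0 <= B & gauss_avg rho e y = B%:E.
Proof.
move=> e0.
have B0 := gauss_avg_ge0 (kern_ge0 N l) e y.
exists (fine (gauss_avg rho e y)); first exact: fine_ge0.
rewrite fineK// ge0_fin_numE//.
have [K K0 HK] := kern_le qN l0.
have [B Bge0 HB] := @pw_convolution_bounded R d l l0 ld 1 K ltr01 (ltW K0).
rewrite (gauss_avgZ mrho (kern_ge0 N l) (fun t x t0 => kernZ l qN x t0))//.
rewrite lte_mul_pinfty ?lee_fin ?invr_ge0 ?powR_ge0//.
apply: le_lt_trans (ltry B); apply: le_trans (HB (e^-1 *: y)).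
have mp : measurable_fun setT (fun v : 'rV[R]_d => e^-1 *: y + v).
  by have := @measurable_rV_affine R d 1 (e^-1 *: y); under eq_fun do rewrite scale1r.
apply: ge0_le_integral => //.
- by move=> v _; rewrite lee_fin mulr_ge0 ?kern_ge0 ?gauss_ge0.
- apply/measurable_EFinP; apply: measurable_funM; last exact: measurable_gauss.
  by have := measurableT_comp mrho (@measurable_rV_affine R d 1 (e^-1 *: y)); apply.
- apply/measurable_EFinP; apply: measurable_funM.
    by have := measurableT_comp (@measurable_pw R d l) mp; apply.
  by apply: measurable_funM => //; exact: measurable_gauss.
- move=> v _; rewrite lee_fin scale1r mulrA ler_wpM2r ?gauss_ge0// mulrC.
  exact: HK.
Qed.

(** The left-hand side of the embedding identity for a symmetrised Gaussian:
    both halves agree because the kernel is even. *)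
Lemma integral_kern_sym_gauss e y : 0 < e ->
  Rintegral leb setT (fun x => rho x * sym_gauss ((e^-1) ^+ 2) y x) =
  e ^+ d * fine (gauss_avg rho e y).
Proof.
move=> e0; set c := e^-1 ^+ 2.
have [B B0 HB] := gauss_avg_fin y e0.
have mg : measurable_fun setT (@gauss R d c) by exact: measurable_gauss.
have mshift (z : 'rV[R]_d) (f : 'rV[R]_d -> R) : measurable_fun setT f -> measurable_fun setT (fun x : 'rV[R]_d => f (x + z)).
  move=> mf; have := @measurable_rV_affine R d 1 z; under eq_fun do rewrite scale1r addrC.
  by move=> ma; have := measurableT_comp mf ma; apply.
have mf z : measurable_fun setT (fun x => (rho x * gauss c (x + z))%:E).
  by apply/measurable_EFinP; apply: measurable_funM => //; exact: mshift.
have key : (\int[leb]_x (rho (y + x)%R * gauss c x)%:E = (e ^+ d * B)%:E)%E.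
  have m2 : measurable_fun setT (fun x => (rho (y + x)%R * gauss c x)%:E).
    apply/measurable_EFinP; apply: measurable_funM => //.
    by have := mshift y _ mrho; under eq_fun do rewrite addrC.
  have f0 x : (0 <= (rho (y + x)%R * gauss c x)%:E)%E.
    by rewrite lee_fin mulr_ge0 ?kern_ge0 ?gauss_ge0.
  have := ge0_integral_rV_affine 0 (lt0r_neq0 e0) m2 f0.
  rewrite EFinM -HB gtr0_norm// => <-; congr (_ * _)%E; apply: eq_integral => x _.
  by rewrite add0r gaussZ /c exprVn mulVf// expf_neq0// gt_eqF.
have H1 : (\int[leb]_x (rho x * gauss c (x + - y))%:E = (e ^+ d * B)%:E)%E.
  rewrite -key -(integral_rV_isometry y (normr1 R) (mf (- y))).
  by apply: eq_integral => x _; rewrite scale1r addrAC subrr add0r.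
have H2 : (\int[leb]_x (rho x * gauss c (x + y))%:E = (e ^+ d * B)%:E)%E.
  rewrite -key -(integral_rV_isometry (- y) (normrN1 R) (mf y)).
  apply: eq_integral => x _; rewrite scaleN1r.
  rewrite addrAC addNr add0r gaussN -opprD (kernN l qN)//.
rewrite HB/= /Rintegral (_ : integral _ _ _ = (e ^+ d * B)%:E)//.
transitivity (\int[leb]_x ((2^-1)%:E * ((rho x * gauss c (x + - y))%:E
    + (rho x * gauss c (x + y))%:E)))%E.
  by apply: eq_integral => x _; rewrite -EFinD -EFinM /sym_gauss; congr EFin; field.
have f0 z x : (0 <= (rho x * gauss c (x + z))%:E)%E.
  by rewrite lee_fin mulr_ge0 ?kern_ge0 ?gauss_ge0.
rewrite ge0_integralZl_EFin//; last 2 first.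
- by move=> x _; rewrite adde_ge0.
- exact: emeasurable_funD.
rewrite ge0_integralD// H1 H2 -EFinD -EFinM; congr EFin; by field.
Qed.

(** Each Gaussian average is the cosine transform of a positive function [W],
    integrable for the product of Lebesgue measure on R and the spherical
    measure, the point (t, theta) carrying the frequency t theta. *)
Lemma embedding_kernel : embeds_in_Lneg l N ->
  exists sigma : {finite_measure set 'rV[R]_d -> \bar R},
  forall e, 0 < e -> exists W : measurableTypeR R * 'rV[R]_d -> R,
  [/\ measurable_fun setT W, forall p, 0 <= W p,
      (leb1 \x sigma)%E.-integrable setT (EFin \o W) &
      forall y, (gauss_avg rho e y =
        \int[leb1 \x sigma]_p (W p * cos (2 * pi * dotv y (p.1 *: p.2)))%:E)%E].
Proof.
move=> [sigma [_ emb]]; exists sigma => e e0.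
pose c := e^-1 ^+ 2.
have c0 : 0 < c by rewrite exprn_gt0// invr_gt0.
pose S := @usphere R d.
have mS : measurable S.
  have -> : S = (fun x => dotv x x) @^-1` [set 1].
    apply/seteqP; split => x; rewrite /S /usphere/= /enorm => h.
      by rewrite -(sqr_sqrtr (dotv_ge0 x)) h expr1n.
    by rewrite h sqrtr1.
  have md : measurable_fun setT (fun x : 'rV[R]_d => dotv x x) by exact: measurable_fun_dotv.
  by have := md measurableT [set 1] (measurable_set1 _); rewrite setTI; apply.
have ed0 : 0 < e ^+ d by rewrite exprn_gt0.
pose w (p : measurableTypeR R * 'rV[R]_d) : R :=
  \1_(`]0, +oo[ : set R) p.1 * (\1_S p.2 * (p.1 `^ (l - 1) * ghat c (p.1 *: p.2))).
have mdil : measurable_fun setT (fun p : measurableTypeR R * 'rV[R]_d => p.1 *: p.2).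
  apply: measurable_fun_rV => i; under eq_fun do rewrite mxE.
  by apply: measurable_funM => //; exact: (measurableT_comp (measurable_coord i)).
have mw : measurable_fun setT w.
  apply: measurable_funM.
    by have := measurableT_comp (measurable_indic (measurable_itv `]0, +oo[)) (@measurable_fst _ _ (measurableTypeR R) 'rV[R]_d); apply.
  apply: measurable_funM.
    by have := measurableT_comp (measurable_indic mS) (@measurable_snd _ _ (measurableTypeR R) 'rV[R]_d); apply.
  apply: measurable_funM.
    by have := measurableT_comp (measurable_powR (l - 1)) (@measurable_fst _ _ (measurableTypeR R) 'rV[R]_d); apply.
  by have := measurableT_comp (measurable_ghat c0) mdil; apply.
have w0 p : 0 <= w p.
  by rewrite /w !mulr_ge0 ?powR_ge0 ?ghat_ge0// indicE.
have mcosy y : measurable_fun setT (fun p : measurableTypeR R * 'rV[R]_d =>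
    cos (2 * pi * dotv y (p.1 *: p.2))).
  apply: measurable_fun_cos; apply: measurable_funM => //.
  exact: measurable_fun_dotv.
have mwc y : measurable_fun setT (fun p => (w p * cos (2 * pi * dotv y (p.1 *: p.2)))%:E).
  by apply/measurable_EFinP; exact: measurable_funM.
(* The embedding identity for the symmetrised Gaussian centred at y. *)
have idy y : e ^+ d * fine (gauss_avg rho e y) =
   Rintegral leb1 setT (fun t => fine (\int[sigma]_th
     (w (t, th) * cos (2 * pi * dotv y (t *: th)))%:E)%E).
  have even x : (sym_gauss c y (- x))%:C%C = (sym_gauss c y x)%:C%C.
    by rewrite sym_gauss_even.
  have /(congr1 (@complex.Re R)) := emb _ (schwartz_sym_gauss y c0) even.
  rewrite !Re_Cintegral.
  rewrite (_ : Rintegral leb _ _ = Rintegral leb setT (fun x => rho x * sym_gauss c y x)); last first.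
    by apply: eq_Rintegral => x _; rewrite Re_realM.
  rewrite integral_kern_sym_gauss// => ->.
  rewrite Rintegral_mkcond; apply: eq_Rintegral => t _; rewrite patchE.
  case: ifPn => [t0|t0]; last first.
    rewrite [X in fine X](_ : _ = 0%E)//; apply: integral0_eq => th _.
    by rewrite /w/= indicE (negbTE t0) !mul0r.
  rewrite Re_Cintegral Rintegral_mkcond /Rintegral; congr fine; apply: eq_integral => th _.
  rewrite patchE /w !indicE t0 mul1r; congr EFin; case: ifPn => [thS|thS].
    by rewrite mul1r Re_realM fourier_sym_gauss// [_ * ghat _ _]mulrC mulrA.
  by rewrite !mul0r.
have [Z Z0 HZ] := ghat_le d c0.
have isec t : sigma.-integrable setT (fun th => (w (t, th))%:E).
  have mwt : measurable_fun setT (fun th => w (t, th)).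
    by have := measurableT_comp mw (pair1_measurable t); apply.
  have ic : sigma.-integrable setT (EFin \o cst (t `^ (l - 1) * Z)).
    exact: finite_measure_integrable_cst.
  apply: (le_integrable _ _ _ ic) => //; first exact/measurable_EFinP.
  move=> th _; rewrite lee_fin ger0_norm// ger0_norm; last by rewrite mulr_ge0 ?powR_ge0.
  have g0 : 0 <= t `^ (l - 1) * ghat c (t *: th) by rewrite mulr_ge0 ?powR_ge0 ?ghat_ge0.
  have gZ : t `^ (l - 1) * ghat c (t *: th) <= t `^ (l - 1) * Z by rewrite ler_wpM2l ?powR_ge0.
  rewrite /w/= !indicE; apply: le_trans gZ.
  by case: (_ \in _); case: (_ \in _); rewrite ?mul1r ?mul0r//.
have isecc y t : sigma.-integrable setT (fun th => (w (t, th) * cos (2 * pi * dotv y (t *: th)))%:E).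
  apply: (le_integrable _ _ _ (isec t)) => //.
    by have := measurableT_comp (mwc y) (pair1_measurable t); apply.
  move=> th _; rewrite lee_fin normrM ler_piMr//; exact: norm_cos_le1.
have RE y : Rintegral leb1 setT (fun t => fine (\int[sigma]_th
     (w (t, th) * cos (2 * pi * dotv y (t *: th)))%:E)%E) =
   fine (\int[leb1]_t \int[sigma]_th (w (t, th) * cos (2 * pi * dotv y (t *: th)))%:E)%E.
  rewrite /Rintegral; congr fine; apply: eq_integral => t _.
  by rewrite fineK//; exact: integrable_fin_num (isecc y t).
have avg0 : 0 < fine (gauss_avg rho e 0).
  have [K K0 HK] := kern_ge qN l0.
  have [D D0 HD] := gauss_avg1_gt0 l0 ld mrho (kern_ge0 N l) K0 HK.
  have [B _ HB] := gauss_avg_fin 0 e0.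
  rewrite -lte_fin fineK ?HB// -HB.
  rewrite (gauss_avgZ mrho (kern_ge0 N l) (fun t x t0 => kernZ l qN x t0))// scaler0.
  rewrite mule_gt0 ?lte_fin ?invr_gt0 ?powR_gt0//.
  by apply: lt_le_trans HD; rewrite lte_fin.
(* If w had infinite integral, the real-valued integral in [idy 0] would be 0 by
   convention, whereas the average at the origin is positive. *)
have iw : (leb1 \x sigma)%E.-integrable setT (EFin \o w).
  apply/integrableP; split; first exact/measurable_EFinP.
  under eq_integral do rewrite gee0_abs ?lee_fin ?w0//.
  have := idy 0; rewrite RE.
  rewrite (_ : (\int[leb1]_t \int[sigma]_th (w (t, th) * cos (2 * pi * dotv 0 (t *: th)))%:E)%E =
    (\int[leb1 \x sigma]_p (w p)%:E)%E); last first.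
    rewrite fubini_tonelli1//; last exact/measurable_EFinP.
    apply: eq_integral => t _; apply: eq_integral => th _.
    by rewrite dotv0l mulr0 cos0 mulr1.
  move=> H; rewrite ltey; apply/eqP => oo; move: H; rewrite oo/= => /eqP.
  by rewrite mulf_eq0 (gt_eqF ed0) (gt_eqF avg0).
have iwc y : (leb1 \x sigma)%E.-integrable setT
    (fun p => (w p * cos (2 * pi * dotv y (p.1 *: p.2)))%:E).
  apply: (le_integrable _ _ _ iw) => //.
  move=> p _; rewrite lee_fin normrM ler_piMr//; exact: norm_cos_le1.
exists (fun p => (e ^+ d)^-1 * w p); split => [|p||y].
- exact: measurable_funM.
- by rewrite mulr_ge0// invr_ge0 ltW.
- rewrite (_ : EFin \o _ = fun p => ((e ^+ d)^-1%:E * (w p)%:E)%E); last by apply/funext => p /=; rewrite EFinM.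
  exact: integrableZl.
have [B _ HB] := gauss_avg_fin y e0.
under eq_integral => p _ do rewrite -(mulrA _ (w p)) EFinM.
rewrite integralZl//.
have := idy y; rewrite RE HB/=.
have <- := integral12_prod_meas1 (iwc y).
rewrite /fubini_F/= => H.
have fi : (\int[leb1]_t \int[sigma]_th (w (t, th) * cos (2 * pi * dotv y (t *: th)))%:E)%E \is a fin_num.
  have := integral12_prod_meas1 (iwc y); rewrite /fubini_F/= => ->.
  exact: integrable_fin_num.
by rewrite -(fineK fi) -H -EFinM mulKf// gt_eqF.
Qed.
End embedding.

(** * Expectations of products of independent variables *)

Section independent_product.
Context (disp disp' : measure_display) (T : measurableType disp)
  (T' : measurableType disp') (R : realType) (P : probability T R) (I : finType)
  (X : I -> {RV P >-> T'}).
Hypothesis indep : mutually_independent X.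

(** Expectation of a real random variable. *)
Definition Ex (h : T -> R) : R := Rintegral P setT h.

Let bounded_integrable (h : T -> R) : measurable_fun setT h ->
  (forall w, `|h w| <= 1) -> P.-integrable setT (EFin \o h).
Proof.
move=> mh h1; have ic : P.-integrable setT (EFin \o cst 1%R).
  exact: finite_measure_integrable_cst.
apply: (le_integrable _ _ _ ic) => //; first exact/measurable_EFinP.
by move=> w _; rewrite lee_fin/= normr1.
Qed.

Let ExE (h : T -> R) : measurable_fun setT h -> (forall w, `|h w| <= 1) ->
  (\int[P]_w (h w)%:E = (Ex h)%:E)%E.
Proof.
move=> mh h1; rewrite /Ex /Rintegral fineK//.
exact: integrable_fin_num (bounded_integrable mh h1).
Qed.

Let mcomp (i : I) (f : T' -> R) : measurable_fun setT f ->
  measurable_fun setT (fun w => f (X i w)).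
Proof.
move=> mf; have mX : measurable_fun setT (X i) by [].
by have := measurableT_comp mf mX; apply.
Qed.

Let mprod (Q : pred I) (f : I -> T' -> R) : (forall i, measurable_fun setT (f i)) ->
  measurable_fun setT (fun w => \prod_(i | Q i) f i (X i w)).
Proof.
move=> mf; rewrite (_ : (fun w => _) = fun w =>
    \prod_(i <- index_enum I) (if Q i then f i (X i w) else 1)).
  apply: measurable_prod => i _; case: (Q i) => //; exact: mcomp.
by apply/funext => w; rewrite big_mkcond.
Qed.

Let prod_le1 (Q : pred I) (f : I -> T' -> R) w : (forall i x, `|f i x| <= 1) ->
  `|\prod_(i | Q i) f i (X i w)| <= 1.
Proof.
move=> f1; rewrite normr_prod;
suff /andP[] : 0 <= \prod_(i | Q i) `|f i (X i w)| <= 1 by [].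
apply: (big_ind (fun z : R => 0 <= z <= 1)) => [|a b /andP[a0 a1] /andP[b0 b1]|i _].
- by rewrite ler01 lexx.
- by rewrite mulr_ge0//= mulr_ile1.
- by rewrite normr_ge0/=.
Qed.

(** Factors with values in [0, 1], all of them indicator functions outside [r].
    When [r] is empty this is the definition of independence.  For the induction
    step, the claim with the factor [k] replaced by an indicator identifies the
    image under [X k] of the measure with density the product of the other
    factors, and [ge0_integral_density] applies. *)
Let indep_prod_unit (r : seq I) (f : I -> T' -> R) :
  (forall i, measurable_fun setT (f i)) -> (forall i x, 0 <= f i x <= 1) ->
  (forall i, i \notin r -> exists2 A, measurable A & f i = \1_A) ->
  Ex (fun w => \prod_i f i (X i w)) = \prod_i Ex (fun w => f i (X i w)).
Proof.
elim: r f => [|k r IH] f mf f01 fr.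
  have /choice[A HA] : forall i, exists A, measurable A /\ f i = \1_A.
    by move=> i; have [A mA fA] := fr i isT; exists A.
  have E : (fun w => \prod_i f i (X i w)) =
      \1_(\bigcap_(i in [set` [set: I]%SET]) (X i @^-1` A i)).
    apply/funext => w; rewrite indicE.
    under eq_bigr do rewrite (proj2 (HA _)) indicE.
    have [wA|wA] := boolP (w \in _).
      rewrite big1// => i _; rewrite mem_set//.
      by move: wA; rewrite inE => /(_ i); apply; rewrite /= inE.
    have [i /negP Hi] : exists i, ~~ `[< A i (X i w) >].
      apply: contrapT => H; move/negP: wA; apply; rewrite inE => i _ /=.
      apply: contrapT => h; apply: H; exists i; apply/negP => /asboolP; exact: h.
    rewrite (bigD1 i)//= memNset ?mul0r// => h; apply: Hi; exact/asboolP.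
  have Ef i : Ex (fun w => f i (X i w)) = fine (P (X i @^-1` A i)).
    rewrite /Ex /Rintegral (proj2 (HA i)).
    have mA : measurable (X i @^-1` A i).
      by have := measurable_funPTI (X i) (proj1 (HA i)).
    rewrite -[in RHS](setIT (_ @^-1` _)) -integral_indic//.
  rewrite E {1}/Ex /Rintegral integral_indic//; last first.
    apply: fin_bigcap_measurable => // i _.
    exact: (measurable_funPTI (X i) (proj1 (HA i))).
  rewrite setIT [X in fine X](indep [set: I]%SET (fun i => proj1 (HA i))).
  under [RHS]eq_bigr do rewrite Ef.
  rewrite (_ : (\prod_(i in [set: I]%SET) P (X i @^-1` A i))%E =
     (\prod_i fine (P (X i @^-1` A i)))%:E)//.
  rewrite -prodEFin; apply: eq_big => [i|i _]; first by rewrite inE.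
  by rewrite fineK// fin_num_measure//; exact: (measurable_funPTI (X i) (proj1 (HA i))).
pose G w := \prod_(i | i != k) f i (X i w).
pose c := \prod_(i | i != k) Ex (fun w => f i (X i w)).
have mG : measurable_fun setT G by exact: mprod.
have G0 w : 0 <= G w.
  by apply: prodr_ge0 => i _; have /andP[] := f01 i (X i w).
have f1 i x : `|f i x| <= 1 by have /andP[? ?] := f01 i x; rewrite ger0_norm.
have c0 : 0 <= c.
  apply: prodr_ge0 => i _; apply: Rintegral_ge0 => w _.
  by have /andP[] := f01 i (X i w).
have GH A : measurable A ->
    (\int[P]_(w in X k @^-1` A) (G w)%:E = \int[distribution P (X k)]_(x in A) c%:E)%E.
  move=> mA; pose g i := if i == k then \1_A else f i.
  have mXA : measurable (X k @^-1` A) by exact: (measurable_funPTI (X k) mA).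
  have mg i : measurable_fun setT (g i).
    by rewrite /g; case: ifP => // _; exact: measurable_indic.
  have g01 i x : 0 <= g i x <= 1.
    by rewrite /g; case: ifP => // _; rewrite indicE; case: (_ \in _); rewrite /= ?ler01 ?lexx.
  have gE i : i != k -> g i = f i by rewrite /g => /negbTE ->.
  have gk : g k = \1_A by rewrite /g eqxx.
  have gr i : i \notin r -> exists2 A, measurable A & g i = \1_A.
    move=> ir; rewrite /g; case: ifPn => [_|ik]; first by exists A.
    by apply: fr; rewrite inE negb_or ik.
  have := IH g mg g01 gr.
  rewrite [in X in _ = X -> _](bigD1 k)//= gk.
  under [X in _ = _ * X -> _]eq_bigr => i ik do rewrite (gE i ik).
  rewrite -/c => H.
  rewrite integral_cst//= [X in (_ * X)%E](_ : _ = P (X k @^-1` A))//.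
  rewrite integral_mkcond.
  transitivity (\int[P]_w (\prod_i g i (X i w))%:E)%E.
    apply: eq_integral => w _; rewrite epatch_indic// (bigD1 k)//= gk muleC EFinM.
    by congr (_ * _%:E)%E; apply: eq_bigr => i ik; rewrite gE.
  rewrite ExE; last 2 first.
  - exact: mprod.
  - by move=> w; apply: prod_le1 => i x; have /andP[? ?] := g01 i x; rewrite ger0_norm.
  rewrite H EFinM muleC; congr (_ * _)%E.
  rewrite -(_ : \int[P]_w (\1_A (X k w))%:E = (Ex (fun w => \1_A (X k w)))%:E)%E.
    by rewrite (integral_indic _ _ mXA) ?setIT.
  apply: ExE; first exact: (mcomp _ (measurable_indic mA)).
  by move=> w; rewrite indicE; case: (_ \in _); rewrite ?normr1 ?normr0.
have mX : measurable_fun setT (X k) by [].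
have := @ge0_integral_density _ _ _ _ _ P (distribution P (X k)) (X k) G (cst c) mX
  mG (measurable_cst c) G0 (fun=> c0) GH (EFin \o f k) _ _.
have mfk : measurable_fun setT (EFin \o f k) by exact/measurable_EFinP.
have fk0 x : (0 <= (EFin \o f k) x)%E by rewrite lee_fin; have /andP[] := f01 k x.
move=> /(_ mfk fk0).
rewrite ge0_integralZl_EFin//.
rewrite ge0_integral_distribution//.
rewrite [X in (_ = _ * X)%E]ExE; last 2 first.
- exact: mcomp.
- by move=> w; exact: f1.
move=> H; apply: EFin_inj; rewrite -ExE; last 2 first.
- exact: mprod.
- by move=> w; exact: prod_le1.
rewrite (bigD1 k)//= -/c mulrC EFinM -H; apply: eq_integral => w _.
by rewrite (bigD1 k)//= mulrC EFinM.
Qed.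

(** Signed factors are reduced one at a time to nonnegative ones by writing
    f = 2 ((1 + f) / 2) - 1. *)
Lemma independent_prod (f : I -> T' -> R) :
  (forall i, measurable_fun setT (f i)) -> (forall i x, `|f i x| <= 1) ->
  Ex (fun w => \prod_i f i (X i w)) = \prod_i Ex (fun w => f i (X i w)).
Proof.
suff H (r : seq I) : forall (f : I -> T' -> R),
  (forall i, measurable_fun setT (f i)) -> (forall i x, `|f i x| <= 1) ->
  (forall i, i \notin r -> forall x, 0 <= f i x) ->
  Ex (fun w => \prod_i f i (X i w)) = \prod_i Ex (fun w => f i (X i w)).
  move=> mf f1; apply: (H (index_enum I)) => // i; by rewrite mem_index_enum.
elim: r => [|k r IH] {}f mf f1 fr.
  apply: (indep_prod_unit (r := index_enum I)) => // i.
    by move=> x; rewrite fr//= (le_trans (ler_norm _)).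
  by rewrite mem_index_enum.
pose g i := if i == k then (fun x => 2^-1 * (1 + f k x)) else f i.
pose h i := if i == k then (fun x : T' => 1 : R) else f i.
have gE i : i != k -> g i = f i by rewrite /g => /negbTE ->.
have hE i : i != k -> h i = f i by rewrite /h => /negbTE ->.
have gk : g k = fun x => 2^-1 * (1 + f k x) by rewrite /g eqxx.
have hk : h k = fun=> 1 by rewrite /h eqxx.
have mg i : measurable_fun setT (g i).
  rewrite /g; case: ifP => // _; apply: measurable_funM => //.
  exact: measurable_funD.
have mh i : measurable_fun setT (h i) by rewrite /h; case: ifP.
have g1 i x : `|g i x| <= 1.
  rewrite /g; case: ifP => // _; have := f1 k x.
  rewrite !ler_norml => /andP[? ?]; apply/andP; split; lra.
have h1 i x : `|h i x| <= 1 by rewrite /h; case: ifP => // _; rewrite normr1.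
have Hg := IH g mg g1 _.
have Hh := IH h mh h1 _.
have gr i : i \notin r -> forall x, 0 <= g i x.
  move=> ir x; rewrite /g; case: ifPn => [_|ik].
    by have := f1 k x; rewrite ler_norml => /andP[? ?]; lra.
  by apply: fr; rewrite inE negb_or ik.
have hr i : i \notin r -> forall x, 0 <= h i x.
  move=> ir x; rewrite /h; case: ifPn => [//|ik].
  by apply: fr; rewrite inE negb_or ik.
move/(_ gr) in Hg; move/(_ hr) in Hh.
have Ex_lin (u v : T -> R) : measurable_fun setT u -> measurable_fun setT v ->
    (forall w, `|u w| <= 1) -> (forall w, `|v w| <= 1) ->
    Ex (fun w => 2 * u w - v w) = 2 * Ex u - Ex v.
  move=> mu mv u1 v1; rewrite /Ex RintegralB//; last 2 first.
  - rewrite (_ : EFin \o _ = fun w => (2%:E * (u w)%:E)%E).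
      by apply: integrableZl => //; exact: bounded_integrable.
    by apply/funext => w /=; rewrite EFinM.
  - exact: bounded_integrable.
  by rewrite RintegralZl//; exact: bounded_integrable.
have -> : (fun w => \prod_i f i (X i w)) =
    (fun w => 2 * (\prod_i g i (X i w)) - \prod_i h i (X i w)).
  apply/funext => w; rewrite (bigD1 k)//= [in RHS](bigD1 k)//= [X in _ - X](bigD1 k)//= gk hk.
  under [X in 2 * (_ * X)]eq_bigr => i ik do rewrite (gE i ik).
  under [X in _ - _ * X]eq_bigr => i ik do rewrite (hE i ik).
  by field.
rewrite Ex_lin; last 4 first.
- exact: mprod.
- exact: mprod.
- by move=> w; exact: prod_le1.
- by move=> w; exact: prod_le1.
rewrite Hg Hh (bigD1 k)//= [X in _ - X](bigD1 k)//= [RHS](bigD1 k)//= gk hk.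
under [X in 2 * (_ * X)]eq_bigr => i ik do rewrite (gE i ik).
under [X in _ - _ * X]eq_bigr => i ik do rewrite (hE i ik).
rewrite mulrA -mulrBl; congr (_ * _).
rewrite -Ex_lin.
- by congr Ex; apply/funext => w; field.
- by have := mcomp k (mg k); rewrite gk.
- exact: measurable_cst.
- by move=> w; have := g1 k (X k w); rewrite gk.
- by move=> w; rewrite normr1.
Qed.

(** The characteristic function of a sum of independent variables, in real
    terms, when the individual characteristic functions are real. *)
Lemma independent_cos_sum (theta : I -> T' -> R) :
  (forall i, measurable_fun setT (theta i)) ->
  (forall i, Ex (fun w => sin (theta i (X i w))) = 0) ->
  Ex (fun w => cos (\sum_i theta i (X i w))) =
  \prod_i Ex (fun w => cos (theta i (X i w))).
Proof.
move=> mth Esin0.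
have mX i : measurable_fun setT (X i) by [].
have mcos i : measurable_fun setT (fun x => cos (theta i x)) by exact: measurable_fun_cos.
have msin i : measurable_fun setT (fun x => sin (theta i x)) by exact: measurable_fun_sin.
have Ex_lin (u v : T -> R) : measurable_fun setT u -> measurable_fun setT v ->
    (forall w, `|u w| <= 1) -> (forall w, `|v w| <= 1) ->
    Ex (fun w => u w - v w) = Ex u - Ex v /\ Ex (fun w => u w + v w) = Ex u + Ex v.
  move=> mu mv u1 v1; rewrite /Ex RintegralB ?RintegralD//; exact: bounded_integrable.
(* Addition formulas along a list of indices; the remaining factors f are what
   the formulas leave behind once an index has been treated. *)
have H (r : seq I) : uniq r -> forall (f : I -> T' -> R),
  (forall i, measurable_fun setT (f i)) -> (forall i x, `|f i x| <= 1) ->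
  Ex (fun w => cos (\sum_(i <- r) theta i (X i w)) * \prod_(i | i \notin r) f i (X i w)) =
    \prod_(i <- r) Ex (fun w => cos (theta i (X i w))) *
    \prod_(i | i \notin r) Ex (fun w => f i (X i w)) /\
  Ex (fun w => sin (\sum_(i <- r) theta i (X i w)) * \prod_(i | i \notin r) f i (X i w)) = 0.
  elim: r => [_|k r IH /= /andP[kr ur]] f mf f1.
    split.
      rewrite big_nil mul1r -independent_prod//; congr Ex; apply/funext => w.
      by rewrite big_nil cos0 mul1r.
    rewrite (_ : (fun w => _) = cst 0).
      by rewrite /Ex /Rintegral integral0.
    by apply/funext => w; rewrite big_nil sin0 mul0r.
  have mS : measurable_fun setT (fun w => \sum_(i <- r) theta i (X i w)).
    by apply: measurable_sum => i; have := measurableT_comp (mth i) (mX i); apply.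
  pose fc i := if i == k then (fun x => cos (theta k x)) else f i.
  pose fs i := if i == k then (fun x => sin (theta k x)) else f i.
  have mfc i : measurable_fun setT (fc i) by rewrite /fc; case: ifP.
  have mfs i : measurable_fun setT (fs i) by rewrite /fs; case: ifP.
  have fc1 i x : `|fc i x| <= 1 by rewrite /fc; case: ifP => // _; exact: norm_cos_le1.
  have fs1 i x : `|fs i x| <= 1 by rewrite /fs; case: ifP => // _; exact: norm_sin_le1.
  have fcE i : i != k -> fc i = f i by rewrite /fc => /negbTE ->.
  have fsE i : i != k -> fs i = f i by rewrite /fs => /negbTE ->.
  have fck : fc k = fun x => cos (theta k x) by rewrite /fc eqxx.
  have fsk : fs k = fun x => sin (theta k x) by rewrite /fs eqxx.
  have split_prod (F : I -> R) : \prod_(i | i \notin r) F i =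
      F k * \prod_(i | i \notin k :: r) F i.
    rewrite (bigD1 k)//=; congr (_ * _); apply: eq_bigl => i.
    by rewrite inE negb_or andbC.
  have pc w : \prod_(i | i \notin r) fc i (X i w) =
      cos (theta k (X k w)) * \prod_(i | i \notin k :: r) f i (X i w).
    rewrite split_prod fck; congr (_ * _); apply: eq_bigr => i.
    by rewrite inE negb_or => /andP[ik _]; rewrite fcE.
  have ps w : \prod_(i | i \notin r) fs i (X i w) =
      sin (theta k (X k w)) * \prod_(i | i \notin k :: r) f i (X i w).
    rewrite split_prod fsk; congr (_ * _); apply: eq_bigr => i.
    by rewrite inE negb_or => /andP[ik _]; rewrite fsE.
  have [cc sc] := IH ur fc mfc fc1.
  have [cs ss] := IH ur fs mfs fs1.
  have bd (a : T -> R) (g : I -> T' -> R) : (forall w, `|a w| <= 1) ->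
      (forall i x, `|g i x| <= 1) -> forall w,
      `|a w * \prod_(i | i \notin r) g i (X i w)| <= 1.
    by move=> a1 g1 w; rewrite normrM mulr_ile1// prod_le1.
  have ms (a : T -> R) (g : I -> T' -> R) : measurable_fun setT a ->
      (forall i, measurable_fun setT (g i)) ->
      measurable_fun setT (fun w => a w * \prod_(i | i \notin r) g i (X i w)).
    by move=> ma mg; apply: measurable_funM => //; exact: mprod.
  have mcS := measurable_fun_cos mS.
  have msS := measurable_fun_sin mS.
  have c1 w := norm_cos_le1 (\sum_(i <- r) theta i (X i w)).
  have s1 w := norm_sin_le1 (\sum_(i <- r) theta i (X i w)).
  split.
    rewrite (_ : (fun w => _) = fun w =>
      cos (\sum_(i <- r) theta i (X i w)) * \prod_(i | i \notin r) fc i (X i w) -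
      sin (\sum_(i <- r) theta i (X i w)) * \prod_(i | i \notin r) fs i (X i w)); last first.
      by apply/funext => w; rewrite big_cons cosD pc ps; ring.
    have [-> _] := Ex_lin _ _ (ms _ _ mcS mfc) (ms _ _ msS mfs) (bd _ _ c1 fc1) (bd _ _ s1 fs1).
    rewrite cc ss subr0 big_cons split_prod fck mulrCA -mulrA; congr (_ * (_ * _)).
    apply: eq_bigr => i; by rewrite inE negb_or => /andP[ik _]; rewrite fcE.
  rewrite (_ : (fun w => _) = fun w =>
      cos (\sum_(i <- r) theta i (X i w)) * \prod_(i | i \notin r) fs i (X i w) +
      sin (\sum_(i <- r) theta i (X i w)) * \prod_(i | i \notin r) fc i (X i w)); last first.
    by apply/funext => w; rewrite big_cons sinD pc ps; ring.
  have [_ ->] := Ex_lin _ _ (ms _ _ mcS mfs) (ms _ _ msS mfc) (bd _ _ c1 fs1) (bd _ _ s1 fc1).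
  by rewrite cs sc addr0 split_prod fsk Esin0 mul0r mulr0.
have n1 (i : I) (x : T') : `|1 : R| <= 1 by rewrite normr1.
have [+ _] := H _ (index_enum_uniq I) (fun _ _ => 1) (fun i => measurable_cst _) n1.
have none (F : I -> R) : \prod_(i | i \notin index_enum I) F i = 1.
  by rewrite big_pred0// => i; rewrite mem_index_enum.
rewrite [X in _ = _ * X -> _]none mulr1 => <-; congr Ex; apply/funext => w.
by rewrite none mulr1.
Qed.

End independent_product.

(** * Log-convexity of the smoothed expectation *)

(** Hoelder's inequality for geometric means of nonnegative functions, with
    exponents 1/a and 1/(1 - a). *)
Lemma ge0_hoelder_powR disp (T : measurableType disp) (R : realType)
    (mu : {measure set T -> \bar R}) (f g : T -> R) (a : R) :
  measurable_fun setT f -> measurable_fun setT g ->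
  (forall x, 0 <= f x) -> (forall x, 0 <= g x) -> 0 < a < 1 ->
  (\int[mu]_x (f x `^ a * g x `^ (1 - a))%:E <=
   (\int[mu]_x (f x)%:E) `^ a * (\int[mu]_x (g x)%:E) `^ (1 - a))%E.
Proof.
move=> mf mg f0 g0 /andP[a0 a1].
have b0 : 0 < 1 - a by rewrite subr_gt0.
have mfa : measurable_fun setT (fun x => f x `^ a).
  by have := measurableT_comp (measurable_powR a) mf; apply.
have mgb : measurable_fun setT (fun x => g x `^ (1 - a)).
  by have := measurableT_comp (measurable_powR (1 - a)) mg; apply.
have pq : a^-1^-1 + (1 - a)^-1^-1 = 1 by rewrite !invrK addrC subrK.
have ai0 : 0 < a^-1 by rewrite invr_gt0.
have bi0 : 0 < (1 - a)^-1 by rewrite invr_gt0.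
have := hoelder mu mfa mgb ai0 bi0 pq.
rewrite Lnorm1 unlock !invrK.
have E1 x : (`|(EFin \o ((fun x => f x `^ a)%R \* (fun x => g x `^ (1 - a))%R)%R) x| =
    (f x `^ a * g x `^ (1 - a))%:E)%E.
  by rewrite /= ger0_norm// mulr_ge0 ?powR_ge0.
have E2 x : (`|(EFin \o (fun x => f x `^ a)%R) x| `^ a^-1 = (f x)%:E)%E.
  rewrite /= ger0_norm ?powR_ge0// -powRrM.
  by rewrite mulfV ?gt_eqF// powRr1.
have E3 x : (`|(EFin \o (fun x => g x `^ (1 - a))%R) x| `^ (1 - a)^-1 = (g x)%:E)%E.
  rewrite /= ger0_norm ?powR_ge0// -powRrM.
  by rewrite mulfV ?gt_eqF// powRr1.
have I1 : (\int[mu]_x (f x `^ a * g x `^ (1 - a))%:E = \int[mu]_x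
    `|(EFin \o ((fun x => f x `^ a)%R \* (fun x => g x `^ (1 - a))%R)%R) x|)%E.
  by apply: eq_integral => x _; rewrite E1.
have I2 : (\int[mu]_x (f x)%:E =
    \int[mu]_x (`|(EFin \o (fun x => f x `^ a)%R) x| `^ a^-1))%E.
  by apply: eq_integral => x _; rewrite E2.
have I3 : (\int[mu]_x (g x)%:E =
    \int[mu]_x (`|(EFin \o (fun x => g x `^ (1 - a))%R) x| `^ (1 - a)^-1))%E.
  by apply: eq_integral => x _; rewrite E3.
by rewrite I1 I2 I3.
Qed.

Lemma powR_prod (R : realType) (I : Type) (r : seq I) (F : I -> R) (a : R) :
  (forall i, 0 <= F i) -> (\prod_(i <- r) F i) `^ a = \prod_(i <- r) F i `^ a.
Proof.
move=> F0; elim: r => [|i r IH]; first by rewrite !big_nil powR1.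
by rewrite !big_cons powRM ?IH// prodr_ge0.
Qed.

Section characteristic_function.
Context (R : realType) (d : nat) (disp : measure_display) (T : measurableType disp)
  (P : probability T R) (Y : {RV P >-> 'rV[R]_d}) (phi : 'rV[R]_d -> R).
Hypotheses (phi_ge0 : forall x, 0 <= phi x) (phi_meas : measurable_fun setT phi).
Hypothesis law : forall A : set 'rV[R]_d, measurable A ->
  distribution P Y A = (\int[lebesgue_rV R d]_(x in A) (phi x)%:E)%E.
Notation leb := (lebesgue_rV R d).

Lemma ge0_integral_law (f : 'rV[R]_d -> \bar R) :
  measurable_fun setT f -> (forall x, 0 <= f x)%E ->
  (\int[P]_w f (Y w) = \int[leb]_x ((phi x)%:E * f x))%E.
Proof.
move=> mf f0; have mY : measurable_fun setT Y by [].
have H A : measurable A -> (\int[P]_(w in Y @^-1` A) 1%:E =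
    \int[leb]_(x in A) (phi x)%:E)%E.
  move=> mA; have mYA : measurable (Y @^-1` A) by exact: (measurable_funPTI Y mA).
  by rewrite -law// integral_cst// mul1e.
rewrite -(@ge0_integral_density _ _ _ _ _ P leb Y (fun=> 1) phi mY (measurable_cst _)
  phi_meas (fun=> ler01) phi_ge0 H f mf f0).
by apply: eq_integral => w _; rewrite mul1e.
Qed.

Lemma integral_law1 : (\int[leb]_x (phi x)%:E = 1)%E.
Proof.
rewrite -law// /distribution /pushforward preimage_setT; exact: probability_setT.
Qed.

(** The change-of-variables formula for [1 + g >= 0], minus total masses. *)
Lemma Ex_law (g : 'rV[R]_d -> R) : measurable_fun setT g -> (forall x, `|g x| <= 1) ->
  Ex P (fun w => g (Y w)) = Rintegral leb setT (fun x => phi x * g x).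
Proof.
move=> mg g1.
have iphi : leb.-integrable setT (EFin \o phi).
  apply/integrableP; split; first exact/measurable_EFinP.
  under eq_integral do rewrite gee0_abs ?lee_fin//.
  by rewrite integral_law1 ltry.
have ipg : leb.-integrable setT (EFin \o (fun x => phi x * g x)).
  apply: (le_integrable _ _ _ iphi) => //.
    by apply/measurable_EFinP; exact: measurable_funM.
  by move=> x _; rewrite lee_fin normrM ler_piMr.
have mgY : measurable_fun setT (fun w => g (Y w)).
  have mY : measurable_fun setT Y by [].
  by have := measurableT_comp mg mY; apply.
have ic : P.-integrable setT (EFin \o cst 1%R).
  exact: finite_measure_integrable_cst.
have ig : P.-integrable setT (EFin \o (fun w => g (Y w))).
  apply: (le_integrable _ _ _ ic) => //; first exact/measurable_EFinP.
  by move=> w _; rewrite lee_fin/= normr1.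
have m1g : measurable_fun setT (fun x => (1 + g x)%:E).
  by apply/measurable_EFinP; exact: measurable_funD.
have := ge0_integral_law m1g _.
have g0 x : (0 <= (1 + g x)%:E)%E.
  by rewrite lee_fin -lerBlDl sub0r; have := g1 x; rewrite ler_norml => /andP[].
move=> /(_ g0).
under eq_integral do rewrite EFinD.
rewrite integralD//=.
under [RHS]eq_integral do rewrite -EFinM mulrDr mulr1 EFinD.
rewrite integralD//= integral_law1 [X in (X + _)%E](_ : _ = 1%E); last first.
  by rewrite integral_cst// mul1e; exact: probability_setT.
rewrite /Ex /Rintegral.
have /fineK <- := integrable_fin_num measurableT ig.
have /fineK <- := integrable_fin_num measurableT ipg.
by rewrite -!EFinD => -[] /addrI.
Qed.

Lemma Ex_cos_law xi :
  Ex P (fun w => cos (2 * pi * dotv (Y w) xi)) =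
  complex.Re (fourier (fun y => (phi y)%:C%C) xi).
Proof.
have mc : measurable_fun setT (fun x : 'rV[R]_d => cos (2 * pi * dotv x xi)).
  by apply: measurable_fun_cos; apply: measurable_funM => //; exact: measurable_fun_dotv.
rewrite (Ex_law mc) => [|x]; last exact: norm_cos_le1.
rewrite /fourier Re_Cintegral; apply: eq_Rintegral => x _.
by rewrite Re_realM /cis/= cosN dotvC.
Qed.

Lemma Ex_sin_law xi :
  Ex P (fun w => sin (2 * pi * dotv (Y w) xi)) =
  - complex.Im (fourier (fun y => (phi y)%:C%C) xi).
Proof.
have ms : measurable_fun setT (fun x : 'rV[R]_d => sin (2 * pi * dotv x xi)).
  by apply: measurable_fun_sin; apply: measurable_funM => //; exact: measurable_fun_dotv.
have ms' : measurable_fun setT (fun x : 'rV[R]_d => - sin (2 * pi * dotv x xi)).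
  exact: measurable_funN.
have s1 (x : 'rV[R]_d) : `|- sin (2 * pi * dotv x xi)| <= 1 by rewrite normrN norm_sin_le1.
rewrite (_ : complex.Im _ = Ex P (fun w => - sin (2 * pi * dotv (Y w) xi))).
  have E : Ex P (fun w => - sin (2 * pi * dotv (Y w) xi)) =
     - Ex P (fun w => sin (2 * pi * dotv (Y w) xi)).
    have mY : measurable_fun setT Y by [].
    have msY : measurable_fun setT (fun w => sin (2 * pi * dotv (Y w) xi)).
      by have := measurableT_comp ms mY; apply.
    have ic : P.-integrable setT (EFin \o cst 1%R).
      exact: finite_measure_integrable_cst.
    have isin : P.-integrable setT (EFin \o (fun w => sin (2 * pi * dotv (Y w) xi))).
      apply: (le_integrable _ _ _ ic) => //; first exact/measurable_EFinP.
      by move=> w _; rewrite lee_fin/= normr1 norm_sin_le1.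
    rewrite -[RHS]mulN1r /Ex -RintegralZl//; apply: eq_Rintegral => w _.
    by rewrite mulN1r.
  by rewrite E opprK.
rewrite (Ex_law ms' s1).
rewrite /fourier /Cintegral/=; apply: eq_Rintegral => x _.
by rewrite mul0r addr0 sinN dotvC.
Qed.

End characteristic_function.

Section sigma_finite_product.
Context (d1 d2 : measure_display) (T1 : measurableType d1) (T2 : measurableType d2)
  (R : realType) (m1 : {sigma_finite_measure set T1 -> \bar R})
  (m2 : {sigma_finite_measure set T2 -> \bar R}).

Lemma sigma_finite_product_measure : sigma_finite setT (m1 \x m2)%E.
Proof.
have /sigma_finiteP[F [TF ndF Foo]] := sigma_finiteT m1.
have /sigma_finiteP[G [TG ndG Goo]] := sigma_finiteT m2.
exists (fun n => F n `*` G n).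
  apply/esym; rewrite -subTset => -[x y] _.
  have : (\bigcup_n F n) x by rewrite -TF.
  have : (\bigcup_n G n) y by rewrite -TG.
  move=> [m _ Gm] [n _ Fn]; exists (maxn n m) => //; split => /=.
    by move: Fn; exact/subsetPset/ndF/leq_maxl.
  by move: Gm; exact/subsetPset/ndG/leq_maxr.
move=> n; have [mF Fn] := Foo n; have [mG Gn] := Goo n; split.
  exact: measurableX.
by rewrite product_measure1E// lte_mul_pinfty// ge0_fin_numE.
Qed.

(** The product of two sigma-finite measures, as a sigma-finite measure. *)
Definition sigma_finite_product : {sigma_finite_measure set (T1 * T2)%type -> \bar R} :=
  HB.pack (product_measure1 m1 m2)
    (Measure_isSigmaFinite.Build _ _ _ (m1 \x m2)%E sigma_finite_product_measure).

End sigma_finite_product.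

Section weighted_sum.
Context (R : realType) (d n : nat) (disp : measure_display) (T : measurableType disp)
  (P : probability T R) (X : 'I_n.+1 -> {RV P >-> 'rV[R]_d}) (phi : 'rV[R]_d -> R).
Hypotheses (phi_ge0 : forall x, 0 <= phi x) (phi_meas : measurable_fun setT phi).
Hypothesis X_indep : mutually_independent X.
Hypothesis X_law : forall (i : 'I_n.+1) (A : set 'rV[R]_d), measurable A ->
  distribution P (X i) A = (\int[lebesgue_rV R d]_(x in A) (phi x)%:E)%E.
Hypothesis phihat_ge0 : forall x, 0 <= fourier (fun y => (phi y)%:C%C) x.

(** The random vector sum_i sqrt(a_i) X_i. *)
Definition wsum (a : 'rV[R]_n.+1) w : 'rV[R]_d :=
  \sum_(i < n.+1) Num.sqrt (a ord0 i) *: X i w.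

(** The Fourier transform of the density, as a real number. *)
Definition phihat xi : R := complex.Re (fourier (fun y => (phi y)%:C%C) xi).

(** Tonelli's theorem for the nonnegative function 1 + cos, the Fourier transform
    being the expectation of a cosine. *)
Lemma measurable_phihat : measurable_fun setT phihat.
Proof.
have mX : measurable_fun setT (X ord0) by [].
pose f (p : 'rV[R]_d * T) := (1 + cos (2 * pi * dotv (X ord0 p.2) p.1))%:E.
have mf : measurable_fun setT f.
  apply/measurable_EFinP; apply: measurable_funD => //; apply: measurable_fun_cos.
  apply: measurable_funM => //; apply: measurable_fun_dotv => //.
  by have := measurableT_comp mX (@measurable_snd _ _ 'rV[R]_d T); apply.
have f0 p : (0 <= f p)%E by rewrite lee_fin -lerBlDl sub0r cos_geN1.
have := measurable_fun_fubini_tonelli_F (m2 := P) f mf f0.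
rewrite (_ : fubini_F _ _ = fun xi => (1 + phihat xi)%:E).
  move=> /measurable_EFinP m; rewrite (_ : phihat = fun xi => (1 + phihat xi) - 1).
    exact: measurable_funB.
  by apply/funext => xi; rewrite addrC addKr.
apply/funext => xi; rewrite /fubini_F /f/= /phihat -(Ex_cos_law phi_ge0 phi_meas (X_law ord0)).
have ic : P.-integrable setT (EFin \o cst 1%R).
  exact: finite_measure_integrable_cst.
have icos : P.-integrable setT (fun w => (cos (2 * pi * dotv (X ord0 w) xi))%:E).
  apply: (le_integrable _ _ _ ic) => //.
    apply/measurable_EFinP; apply: measurable_fun_cos; apply: measurable_funM => //.
    exact: measurable_fun_dotv.
  by move=> w _; rewrite lee_fin/= normr1 norm_cos_le1.
under eq_integral do rewrite EFinD.
rewrite integralD// [X in (X + _)%E](_ : _ = 1%E); last first.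
  by rewrite integral_cst// mul1e; exact: probability_setT.
by rewrite EFinD /Ex /Rintegral fineK//; exact: integrable_fin_num icos.
Qed.

Lemma phihat_ge0r xi : 0 <= phihat xi.
Proof. by have := phihat_ge0 xi; rewrite lecE => /andP[]. Qed.

Lemma measurable_wsum a : measurable_fun setT (wsum a).
Proof.
apply: measurable_fun_rV => i; rewrite /wsum.
under eq_fun do rewrite summxE.
apply: measurable_sum => j; under eq_fun do rewrite mxE.
apply: measurable_funM => //.
have mX : measurable_fun setT (X j) by [].
by have := measurableT_comp (measurable_coord i) mX; apply.
Qed.

Lemma Ex_cos_wsum a xi :
  Ex P (fun w => cos (2 * pi * dotv (wsum a w) xi)) =
  \prod_i phihat (Num.sqrt (a ord0 i) *: xi).
Proof.
pose theta i (x : 'rV[R]_d) := 2 * pi * dotv x (Num.sqrt (a ord0 i) *: xi).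
have mth i : measurable_fun setT (theta i).
  by apply: measurable_funM => //; exact: measurable_fun_dotv.
have th0 i : Ex P (fun w => sin (theta i (X i w))) = 0.
  rewrite /theta (Ex_sin_law phi_ge0 phi_meas (X_law i)).
  have := phihat_ge0 (Num.sqrt (a ord0 i) *: xi); rewrite lecE => /andP[/eqP -> _].
  by rewrite oppr0.
have -> : (fun w => cos (2 * pi * dotv (wsum a w) xi)) =
    (fun w => cos (\sum_i theta i (X i w))).
  apply/funext => w; congr cos; rewrite /theta -mulr_sumr; congr (_ * _).
  rewrite /wsum; elim/big_ind2 : _ => [|u s v t <- <-|i _]; first exact: dotv0l.
  - by rewrite dotvDl.
  - by rewrite dotvZl dotvZr.
rewrite (independent_cos_sum X_indep mth th0); apply: eq_bigr => i _.
by rewrite /theta (Ex_cos_law phi_ge0 phi_meas (X_law i)).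
Qed.

(** Expectation of a kernel that is the cosine transform of an integrable
    function: Fubini's theorem reduces it to characteristic functions. *)
Lemma integral_positive_definite (disp' : measure_display) (S : measurableType disp')
    (m : {sigma_finite_measure set S -> \bar R}) (W : S -> R) (q : S -> 'rV[R]_d) 
    (V : 'rV[R]_d -> \bar R) a :
  measurable_fun setT W -> measurable_fun setT q -> (forall p, 0 <= W p) ->
  m.-integrable setT (EFin \o W) ->
  (forall y, V y = \int[m]_p (W p * cos (2 * pi * dotv y (q p)))%:E)%E ->
  (\int[P]_w V (wsum a w) =
   \int[m]_p (W p * \prod_i phihat (Num.sqrt (a ord0 i) *: q p))%:E)%E.
Proof.
move=> mW mq W0 iW VE.
pose F (z : T * S) : \bar R := (W z.2 * cos (2 * pi * dotv (wsum a z.1) (q z.2)))%:E.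
have m1 : measurable_fun setT (fun z : T * S => wsum a z.1).
  by have := measurableT_comp (measurable_wsum a) (@measurable_fst _ _ T S); apply.
have m2 : measurable_fun setT (fun z : T * S => q z.2).
  by have := measurableT_comp mq (@measurable_snd _ _ T S); apply.
have m3 : measurable_fun setT (fun z : T * S => W z.2).
  by have := measurableT_comp mW (@measurable_snd _ _ T S); apply.
have mF : measurable_fun setT F.
  apply/measurable_EFinP; apply: measurable_funM => //; apply: measurable_fun_cos.
  by apply: measurable_funM => //; exact: measurable_fun_dotv.
have iF : (P \x m)%E.-integrable setT F.
  apply/integrable12ltyP => //.
  apply: (@le_lt_trans _ _ (\int[P]_w \int[m]_p (W p)%:E)%E).
    apply: ge0_le_integral => //.
    - by move=> w _; exact: integral_ge0.
    - apply: (measurable_fun_fubini_tonelli_F (fun p => `|F p|%E)) => //.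
      exact: measurableT_comp.
    move=> w _; apply: ge0_le_integral => //.
    - apply: measurableT_comp => //; exact: (measurableT_comp mF (pair1_measurable w)).
    - exact/measurable_EFinP.
    - move=> p _; rewrite lee_fin normrM ger0_norm//.
      by rewrite ler_piMr// norm_cos_le1.
  rewrite integral_cst// [X in (_ * X)%E](_ : _ = 1%E) ?mule1; last exact: probability_setT.
  have /integrableP[_] := iW.
  by under eq_integral do rewrite gee0_abs ?lee_fin ?W0//.
have := Fubini iF.
rewrite (_ : (\int[P]_x \int[m]_y F (x, y) = \int[P]_w V (wsum a w))%E); last first.
  by apply: eq_integral => w _; rewrite VE.
move=> ->; apply: eq_integral => p _; rewrite /F/= -Ex_cos_wsum.
have mc : measurable_fun setT (fun w => cos (2 * pi * dotv (wsum a w) (q p))).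
  apply: measurable_fun_cos; apply: measurable_funM => //.
  by apply: measurable_fun_dotv => //; exact: measurable_wsum.
have ic : P.-integrable setT (EFin \o cst 1%R).
  exact: finite_measure_integrable_cst.
have icos : P.-integrable setT (fun w => (cos (2 * pi * dotv (wsum a w) (q p)))%:E).
  apply: (le_integrable _ _ _ ic) => //; first exact/measurable_EFinP.
  by move=> w _; rewrite lee_fin/= normr1 norm_cos_le1.
under eq_integral do rewrite EFinM.
rewrite integralZl// EFinM; congr (_ * _)%E.
by rewrite /Ex /Rintegral fineK//; exact: integrable_fin_num icos.
Qed.

Hypothesis phihat_logcvx : forall t : 'rV[R]_d,
  log_convex_on [set r : R^o | 0 <= r]
    (fun r : R^o => (phihat (Num.sqrt r *: t))%:E).

Lemma prod_phihat_logcvx (x y : 'rV[R]_n.+1) (a : R) xi :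
  (forall i, 0 <= x ord0 i) -> (forall i, 0 <= y ord0 i) -> 0 < a < 1 ->
  \prod_i phihat (Num.sqrt ((a *: x + (1 - a) *: y) ord0 i) *: xi) <=
  (\prod_i phihat (Num.sqrt (x ord0 i) *: xi)) `^ a *
  (\prod_i phihat (Num.sqrt (y ord0 i) *: xi)) `^ (1 - a).
Proof.
move=> x0 y0 a01; rewrite !powR_prod; do 1 ? by move=> i; exact: phihat_ge0r.
rewrite -big_split/=; apply: ler_prod => i _; rewrite phihat_ge0r/=.
have [_ /(_ (x ord0 i) (y ord0 i) a (x0 i) (y0 i) a01)] := phihat_logcvx xi.
by rewrite !mxE !poweR_EFin -EFinM lee_fin.
Qed.

End weighted_sum.

(** * Passage to the limit *)

Lemma limn_einf_le (R : realType) (v : (\bar R)^nat) (C : \bar R) :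
  (\forall k \near \oo, v k <= C)%E -> (limn_einf v <= C)%E.
Proof.
move=> [K _ HK]; rewrite limn_einf_lim; apply: lime_le.
  exact: is_cvg_einfs.
apply: nearW => k; apply: (@le_trans _ _ (v (maxn k K))).
  by apply: ereal_inf_lbound; exists (maxn k K) => //=; exact: leq_maxl.
by apply: HK => /=; exact: leq_maxr.
Qed.

Lemma gt0_fineE (R : realType) (z : \bar R) : (0 < z)%E -> z != +oo%E -> exists2 A : R, 0 < A & z = A%:E.
Proof. by case: z => [z|//|//]; rewrite lte_fin => z0 _; exists z. Qed.

Section conclusion.
Context (R : realType) (d n : nat) (disp : measure_display) (T : measurableType disp)
  (P : probability T R) (X : 'I_n.+1 -> {RV P >-> 'rV[R]_d}) (phi : 'rV[R]_d -> R).
Hypotheses (phi_ge0 : forall x, 0 <= phi x) (phi_meas : measurable_fun setT phi).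
Hypothesis X_indep : mutually_independent X.
Hypothesis X_law : forall (i : 'I_n.+1) (A : set 'rV[R]_d), measurable A ->
  distribution P (X i) A = (\int[lebesgue_rV R d]_(x in A) (phi x)%:E)%E.
Hypothesis phihat_pos : forall x, 0 <= fourier (fun y => (phi y)%:C%C) x.
Hypothesis phihat_logcvx : forall t : 'rV[R]_d,
  log_convex_on [set r : R^o | 0 <= r]
    (fun r : R^o => (phihat phi (Num.sqrt r *: t))%:E).
Variables (l : R) (N : 'rV[R]_d -> R).
Hypotheses (l0 : 0 < l) (ld : l < d%:R) (qN : quasi_norm N) (emb : embeds_in_Lneg l N).
Notation S := (wsum X).
Notation rho := (kern N l).
Notation u := (fun y => neg_powere l (N y)).

(** Expectation of the Gaussian average of size 1/(k + 1) of the kernel. *)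
Definition smoothed (k : nat) (a : 'rV[R]_n.+1) : \bar R :=
  (\int[P]_w gauss_avg rho (k.+1%:R^-1) (S a w))%E.

(** The function whose log-convexity is to be proved. *)
Definition expectation_neg_pow (a : 'rV[R]_n.+1) : \bar R :=
  (\int[P]_w u (S a w))%E.

Let mrho : measurable_fun setT rho. Proof. exact: measurable_kern. Qed.

Lemma smoothed_ge0 k a : (0 <= smoothed k a)%E.
Proof.
by apply: integral_ge0 => w _; apply: gauss_avg_ge0; exact: kern_ge0.
Qed.

(** Each integrand [W p * prod] is log-convex in the weights, hence so is the
    integral, by Hoelder's inequality. *)
Lemma smoothed_logcvx k (x y : 'rV[R]_n.+1) (lam : R) :
  (forall i, 0 <= x ord0 i) -> (forall i, 0 <= y ord0 i) -> 0 < lam < 1 ->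
  (smoothed k (lam *: x + (1 - lam) *: y)%R <=
   smoothed k x `^ lam * smoothed k y `^ (1 - lam))%E.
Proof.
move=> x0 y0 l01.
have [sigma H] := embedding_kernel qN l0 ld emb.
have e0 : 0 < k.+1%:R^-1 :> R by rewrite invr_gt0.
have [W [mW W0 iW VE]] := H _ e0.
have mdil : measurable_fun setT (fun p : measurableTypeR R * 'rV[R]_d => p.1 *: p.2).
  apply: measurable_fun_rV => i; under eq_fun do rewrite mxE.
  by apply: measurable_funM => //; exact: (measurableT_comp (measurable_coord i)).
pose m := sigma_finite_product (@lebesgue_measure R) sigma.
have key a : smoothed k a = (\int[m]_p
    (W p * \prod_i phihat phi (Num.sqrt (a ord0 i) *: (p.1 *: p.2)))%:E)%E :=
  @integral_positive_definite R d n disp T P X phi phi_ge0 phi_meas X_indep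
  X_law phihat_pos _ _ m _ _ (gauss_avg rho k.+1%:R^-1) a
  mW mdil W0 iW VE.
rewrite (key x) (key y) (key (lam *: x + (1 - lam) *: y)).
have Pi0 a xi : 0 <= \prod_i phihat phi (Num.sqrt (a ord0 i : R) *: xi).
  by apply: prodr_ge0 => i _; exact: phihat_ge0r.
have mphi := measurable_phihat phi_ge0 phi_meas X_law.
have mWPi (a : 'rV[R]_n.+1) : measurable_fun setT (fun p : measurableTypeR R * 'rV[R]_d =>
    W p * \prod_i phihat phi (Num.sqrt (a ord0 i) *: (p.1 *: p.2))).
  apply: measurable_funM => //; apply: measurable_prod => i _.
  have mz : measurable_fun setT (fun p : measurableTypeR R * 'rV[R]_d =>
      Num.sqrt (a ord0 i) *: (p.1 *: p.2)).
    have := @measurable_rV_affine R d (Num.sqrt (a ord0 i)) 0.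
    under eq_fun do rewrite add0r.
    by move=> maff; have := measurableT_comp maff mdil; apply.
  by have := measurableT_comp mphi mz; apply.
have W0' (a : 'rV[R]_n.+1) (p : measurableTypeR R * 'rV[R]_d) :
   0 <= W p * \prod_i phihat phi (Num.sqrt (a ord0 i) *: (p.1 *: p.2)).
  by rewrite mulr_ge0.
apply: le_trans (ge0_hoelder_powR _ (mWPi x) (mWPi y) (W0' x) (W0' y) l01).
apply: ge0_le_integral => //.
- by move=> p _; rewrite lee_fin.
- exact/measurable_EFinP.
- apply/measurable_EFinP; apply: measurable_funM.
    by have := measurableT_comp (measurable_powR lam) (mWPi x); apply.
  by have := measurableT_comp (measurable_powR (1 - lam)) (mWPi y); apply.
move=> p _; rewrite lee_fin !powRM// mulrACA -powRD; last first.
  by rewrite addrC subrK oner_eq0.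
rewrite [lam + _]addrC subrK powRr1// ler_wpM2l//.
exact: (prod_phihat_logcvx phihat_pos phihat_logcvx).
Qed.

Lemma measurable_neg_pow : measurable_fun setT u.
Proof.
have mN : measurable_fun setT N by exact: continuous_measurable_rV (quasi_norm_continuous qN).
rewrite /neg_powere; apply: measurable_fun_ifT => //.
  by apply: measurable_fun_eqr.
apply/measurable_EFinP.
by have := measurableT_comp (measurable_powR (- l)) mN; apply.
Qed.

Lemma neg_pow_gt0 y : (0 < u y)%E.
Proof.
rewrite /neg_powere; case: eqP => [//|/eqP Ny]; rewrite lte_fin powR_gt0//.
by rewrite lt_neqAle eq_sym Ny quasi_norm_ge0.
Qed.

Lemma neg_pow0 : u 0 = +oo%E.
Proof. by rewrite /neg_powere (quasi_norm0 qN) eqxx. Qed.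

Lemma neg_powE y : y != 0 -> u y = (rho y)%:E.
Proof.
move=> y0; rewrite /neg_powere gt_eqF ?(quasi_norm_gt0 qN)//.
by rewrite /kern powRN.
Qed.

Lemma expectation_neg_pow_gt0 a : (0 < expectation_neg_pow a)%E.
Proof.
rewrite lt0e integral_ge0 ?andbT; last by move=> w _; exact: ltW (neg_pow_gt0 _).
apply/eqP => H.
have mu : measurable_fun setT (fun w => u (S a w)).
  by have := measurableT_comp measurable_neg_pow (measurable_wsum X a); apply.
have : (\int[P]_w `|u (S a w)| = 0)%E.
  by rewrite -H; apply: eq_integral => w _; rewrite gee0_abs// ltW// neg_pow_gt0.
move/(ae_eq_integral_abs P measurableT mu) => [B [mB B0 sB]].
have : (P setT <= P B)%E.
  apply: le_measure; rewrite ?inE// => w _; apply: sB => /= /(_ Logic.I) h.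
  by have := neg_pow_gt0 (S a w); rewrite h ltxx.
by rewrite B0 probability_setT leNgt lte01.
Qed.

Let measurable_gauss_avg e : measurable_fun setT (gauss_avg rho e).
Proof.
have m : measurable_fun setT (fun p : 'rV[R]_d * 'rV[R]_d =>
    (rho (p.1 + e *: p.2) * gauss 1 p.2)%:E).
  apply/measurable_EFinP; apply: measurable_funM; last exact: measurable_fun_gauss.
  have ma : measurable_fun setT (fun p : 'rV[R]_d * 'rV[R]_d => p.1 + e *: p.2).
    apply: measurable_fun_rV => i; under eq_fun do rewrite !mxE.
    apply: measurable_funD; first exact: (measurableT_comp (measurable_coord i)).
    by apply: measurable_funM => //; exact: (measurableT_comp (measurable_coord i)).
  by have := measurableT_comp mrho ma; apply.
have f0 (p : 'rV[R]_d * 'rV[R]_d) : (0 <= (rho (p.1 + e *: p.2)%R * gauss 1 p.2)%:E)%E.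
  by rewrite lee_fin mulr_ge0 ?kern_ge0 ?gauss_ge0.
exact: (measurable_fun_fubini_tonelli_F (m2 := lebesgue_rV R d) _ m f0).
Qed.

Let mS a : measurable_fun setT (S a). Proof. exact: measurable_wsum. Qed.

Lemma exists_gauss_mass : exists2 Z : R, 0 < Z &
  (\int[lebesgue_rV R d]_v (gauss 1 v)%:E = Z%:E)%E.
Proof.
have [Z Z0 HZ] := gauss_mass_fin d (@ltr01 R).
by exists Z => //; exact: gauss_mass_gt0 HZ.
Qed.

(** The two cases of the limit together, with the value [+oo] at the origin. *)
Lemma gauss_avg_limit Z y : 0 < Z ->
  (\int[lebesgue_rV R d]_v (gauss 1 v)%:E = Z%:E)%E ->
  (gauss_avg rho (k.+1%:R^-1) y @[k --> \oo] --> Z%:E * u y)%E.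
Proof.
move=> Z0 HZ; have [K1 K10 HK1] := kern_le qN l0.
have [K0 K00 HK0] := kern_ge qN l0.
have [->|y0] := eqVneq y 0.
  rewrite neg_pow0 gt0_muley ?lte_fin//.
  exact: (gauss_avg_cvg0 l0 ld mrho (kern_ge0 N l) (fun t x t0 => kernZ l qN x t0) K00 HK0).
rewrite neg_powE// -EFinM.
exact: (gauss_avg_cvg l0 ld mrho (kern_ge0 N l) (fun t x t0 => kernZ l qN x t0)
  K10 HK1 (@kern_continuous R d N l qN) HZ y0).
Qed.

(** Finiteness makes [u (S a)] an integrable dominating function. *)
Lemma smoothed_cvg Z a : 0 < Z ->
  (\int[lebesgue_rV R d]_v (gauss 1 v)%:E = Z%:E)%E ->
  (expectation_neg_pow a < +oo)%E ->
  (smoothed k a @[k --> \oo] --> Z%:E * expectation_neg_pow a)%E.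
Proof.
move=> Z0 HZ fin.
have [K1 K10 HK1] := kern_le qN l0.
have [K0 K00 HK0] := kern_ge qN l0.
have [D D0 HD] := gauss_avg_le l0 ld mrho (kern_ge0 N l) (fun t x t0 => kernZ l qN x t0)
  K00 K10 HK1 HK0.
have mu : measurable_fun setT (fun w => u (S a w)).
  by have := measurableT_comp measurable_neg_pow (mS a); apply.
have u0 w : (0 <= u (S a w))%E by exact: ltW (neg_pow_gt0 _).
have iu : P.-integrable setT (fun w => u (S a w)).
  apply/integrableP; split => //.
  by under eq_integral do rewrite gee0_abs//.
have dom w k : [set: T] w -> (`|gauss_avg rho (k.+1%:R^-1) (S a w)| <= (D + 1)%:E * u (S a w))%E.
  move=> _; rewrite gee0_abs ?gauss_avg_ge0//; last exact: kern_ge0.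
  have [->|y0] := eqVneq (S a w) 0.
    by rewrite neg_pow0 gt0_muley ?leey// lte_fin ltr_wpDl.
  rewrite neg_powE//; apply: le_trans (HD _ _ _ y0) _; first by rewrite invr_gt0.
  by rewrite -EFinM lee_fin ler_wpM2r ?kern_ge0// lerDl.
have [_ _] := @dominated_convergence _ _ _ P setT measurableT
  (fun k w => gauss_avg rho (k.+1%:R^-1) (S a w)) (fun w => (Z%:E * u (S a w))%E)
  (fun w => ((D + 1)%:E * u (S a w))%E)
  (fun k => measurableT_comp (measurable_gauss_avg _) (mS a))
  (emeasurable_funM (measurable_cst _) mu)
  (aeW _ (fun w _ => @gauss_avg_limit Z (S a w) Z0 HZ))
  (integrableZl measurableT (D + 1) iu) (aeW _ dom).
by rewrite integralZl.
Qed.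

(** By Fatou's lemma, without any finiteness assumption. *)
Lemma le_liminf_smoothed Z a : 0 < Z ->
  (\int[lebesgue_rV R d]_v (gauss 1 v)%:E = Z%:E)%E ->
  (Z%:E * expectation_neg_pow a <= limn_einf (smoothed ^~ a))%E.
Proof.
move=> Z0 HZ.
have mu : measurable_fun setT (fun w => u (S a w)).
  by have := measurableT_comp measurable_neg_pow (mS a); apply.
have := @fatou _ _ _ P setT measurableT (fun k w => gauss_avg rho (k.+1%:R^-1) (S a w))
   (fun k => measurableT_comp (measurable_gauss_avg _) (mS a)) _.
have f0 k w : [set: T] w -> (0 <= gauss_avg rho (k.+1%:R^-1) (S a w))%E.
  by move=> _; apply: gauss_avg_ge0; exact: kern_ge0.
move=> /(_ f0); apply: le_trans.
rewrite /expectation_neg_pow -ge0_integralZl//; last 2 first.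
- by move=> w _; exact: ltW (neg_pow_gt0 _).
- by rewrite lee_fin ltW.
rewrite le_eqVlt; apply/orP; left; apply/eqP; apply: eq_integral => w _.
have L := @gauss_avg_limit Z (S a w) Z0 HZ.
rewrite is_cvg_limn_einfE; last by apply/cvg_ex; eexists; exact: L.
by rewrite (cvg_lim _ L).
Qed.

Theorem expectation_neg_pow_logcvx :
  log_convex_on [set a : 'rV[R]_n.+1 | forall i, 0 <= a ord0 i] expectation_neg_pow.
Proof.
split=> [a _|x y lam x0 y0 l01].
  by apply: integral_ge0 => w _; exact: ltW (neg_pow_gt0 _).
have /andP[la0 la1] := l01; have lb0 : 0 < 1 - lam by rewrite subr_gt0.
have fx := expectation_neg_pow_gt0 x; have fy := expectation_neg_pow_gt0 y.
have [fxoo|fxfin] := eqVneq (expectation_neg_pow x) +oo%E.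
  rewrite fxoo (poweRyr (lt0r_neq0 la0)).
  by have h := poweR_gt0 (1 - lam) fy; rewrite (gt0_mulye h) leey.
have [fyoo|fyfin] := eqVneq (expectation_neg_pow y) +oo%E.
  rewrite fyoo (poweRyr (lt0r_neq0 lb0)).
  by have h := poweR_gt0 lam fx; rewrite (gt0_muley h) leey.
have [A A0 EA] : exists2 A : R, 0 < A & expectation_neg_pow x = A%:E.
  exact: gt0_fineE fx fxfin.
have [B B0 EB] : exists2 B : R, 0 < B & expectation_neg_pow y = B%:E.
  exact: gt0_fineE fy fyfin.
have [Z Z0 HZ] := exists_gauss_mass.
have cx : (smoothed k x @[k --> \oo] --> (Z * A)%:E)%E.
  by rewrite EFinM -EA; apply: (smoothed_cvg Z0 HZ); rewrite ltey fxfin.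
have cy : (smoothed k y @[k --> \oo] --> (Z * B)%:E)%E.
  by rewrite EFinM -EB; apply: (smoothed_cvg Z0 HZ); rewrite ltey fyfin.
have near_le (M : R) (v : (\bar R)^nat) (e : R) : 0 < M -> 0 < e -> v @ \oo --> M%:E ->
    (\forall k \near \oo, v k <= (M * (1 + e))%:E)%E.
  move=> M0 e0 vM; have Me : M < M * (1 + e) by rewrite ltr_pMr// ltrDl.
  have : nbhs M%:E [set z : \bar R | (z < (M * (1 + e))%:E)%E].
    by apply: open_nbhs_nbhs; split; [exact: open_ereal_lt_ereal|rewrite /= lte_fin].
  by move=> /vM nb; apply: (@filterS _ (nbhs \oo) _ (fun k => v k < (M * (1 + e))%:E)%E _ _ nb) => k /ltW.
pose C := A `^ lam * B `^ (1 - lam).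
have C0 : 0 <= C by rewrite mulr_ge0 ?powR_ge0.
(* Enlarging the limits at x and y by a factor 1 + e bounds the smoothed values
   there for all large k; powers lam and 1 - lam recombine this factor. *)
have key (e : R) : 0 < e -> (Z%:E * expectation_neg_pow (lam *: x + (1 - lam) *: y)%R <=
    (Z * (C * (1 + e)))%:E)%E.
  move=> e0; apply: le_trans (le_liminf_smoothed _ Z0 HZ) _; apply: limn_einf_le.
  near=> k; apply: (le_trans (smoothed_logcvx k x0 y0 l01)).
  have e10 : 0 <= 1 + e by rewrite addr_ge0// ltW.
  apply: (@le_trans _ _ (((Z * A) * (1 + e))%:E `^ lam * ((Z * B) * (1 + e))%:E `^ (1 - lam))%E).
    apply: lee_pmul; rewrite ?poweR_ge0//.
      apply: gt0_ler_poweR; rewrite ?(ltW la0)//.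
      - by rewrite in_itv/= smoothed_ge0 leey.
      - by rewrite in_itv/= leey andbT lee_fin !mulr_ge0// ltW.
      by near: k; apply: near_le cx => //; exact: mulr_gt0.
    apply: gt0_ler_poweR; rewrite ?(ltW lb0)//.
    - by rewrite in_itv/= smoothed_ge0 leey.
    - by rewrite in_itv/= leey andbT lee_fin !mulr_ge0// ltW.
    by near: k; apply: near_le cy => //; exact: mulr_gt0.
  rewrite !poweR_EFin -EFinM lee_fin.
  rewrite !powRM ?mulr_ge0 ?(ltW Z0) ?(ltW A0) ?(ltW B0)//.
  rewrite [leLHS](_ : _ = (Z `^ lam * Z `^ (1 - lam)) * (A `^ lam * B `^ (1 - lam)) *
     ((1 + e) `^ lam * (1 + e) `^ (1 - lam))); last by ring.
  have one (a : R) : 0 <= a -> a `^ lam * a `^ (1 - lam) = a.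
    move=> a0; rewrite -powRD; last by rewrite addrC subrK oner_eq0.
    by rewrite addrC subrK powRr1.
  by rewrite (one Z (ltW Z0)) (one (1 + e) e10) -/C -mulrA.
rewrite EA EB !poweR_EFin -EFinM -/C.
move: key (expectation_neg_pow_gt0 (lam *: x + (1 - lam) *: y)).
move: (expectation_neg_pow _) => G key G0.
have Goo : G != +oo%E.
  apply/eqP => E; have := key 1 ltr01.
  by rewrite E gt0_muley ?lte_fin.
have [F F0 EF] := gt0_fineE G0 Goo.
rewrite EF lee_fin; apply/ler_addgt0Pr => e e0.
have C10 : 0 < C + 1 by rewrite ltr_wpDl.
have := key (e / (C + 1)) (divr_gt0 e0 C10).
rewrite EF -EFinM lee_fin ler_pM2l// => h; apply: (le_trans h).
rewrite mulrDr mulr1 lerD2l mulrCA ler_piMr ?(ltW e0)//.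
by rewrite ler_pdivrMr// mul1r lerDl.
Unshelve. all: by end_near. Qed.

End conclusion.

Theorem theorem4p6 (R : realType) (d n : nat)
  (disp : measure_display) (T : measurableType disp) (P : probability T R)
  (X : 'I_n.+1 -> {RV P >-> 'rV[R]_d})
  (phi : 'rV[R]_d -> R)
  (phi_ge0 : forall x, 0 <= phi x)
  (phi_meas : measurable_fun setT phi)
  (X_indep : mutually_independent X)
  (X_law : forall (i : 'I_n.+1) (A : set 'rV[R]_d), measurable A ->
     distribution P (X i) A = (\int[lebesgue_rV R d]_(x in A) (phi x)%:E)%E)
  (phi_even : forall x, phi (- x) = phi x)
  (phihat_ge0 : forall x, 0 <= fourier (fun y => (phi y)%:C%C) x)
  (phihat_int :
     Cintegrable (lebesgue_rV R d) setT (fourier (fun y => (phi y)%:C%C)))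
  (phihat_logcvx : forall t : 'rV[R]_d,
     log_convex_on [set r : R^o | 0 <= r]
       (fun r : R^o =>
          (complex.Re (fourier (fun y => (phi y)%:C%C) (Num.sqrt r *: t)))%:E))
  (X_moments : forall p : R, 0 < p ->
     (\int[P]_w (enorm (X ord0 w) `^ p)%:E < +oo)%E)
  (l : R) (l_range : 0 < l < d%:R)
  (N : 'rV[R]_d -> R) (N_quasi_norm : quasi_norm N)
  (N_embeds : embeds_in_Lneg l N)
  (X_neg_moment : (\int[P]_w neg_powere l (N (X ord0 w)) < +oo)%E) :
  log_convex_on [set a : 'rV[R]_n.+1 | forall i, 0 <= a ord0 i]
    (fun a : 'rV[R]_n.+1 =>
       \int[P]_w
         neg_powere l (N (\sum_(i < n.+1) Num.sqrt (a ord0 i) *: X i w)%R))%E.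
Proof.
have /andP[l0 ld] := l_range.
exact (expectation_neg_pow_logcvx phi_ge0 phi_meas X_indep X_law phihat_ge0
  phihat_logcvx l0 ld N_quasi_norm N_embeds).
Qed.
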